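(* Suppose that $F:\mathcal K\to L^2(\Omega)$ is Lipschitz and sticking, and that $\Omega_{\bar X}\subset\Omega_{X(t)}$ for all $t\ge0$ and for every Lagrangian solution $X$ starting from any $(\bar X,\bar V)$ with $\bar X\in\mathcal K$, $\bar V\in\mathcal H_{\bar X}$. Then every Lagrangian solution $X$ starting from $(\bar X,\bar V)$ with $\bar X\in\mathcal K$, $\bar V\in\mathcal H_{\bar X}$ is sticky and satisfies the following semigroup property, with $V=\frac{d^+}{dt}X$: for every $\tau>0$ the curve $\tilde X(t):=X(t+\tau)$, $t\ge0$, is the unique Lagrangian solution with initial data $(X(\tau),V(\tau))$. In particular, for all $t\ge t_1\ge0$, $$X(t)=\mathsf P_{\mathcal K}\Big(X(t_1)+(t-t_1)V(t_1)+\int_{t_1}^t(t-s)F[X(s)]\,ds\Big),$$ $$V(t)=\mathsf P_{\mathcal H_{X(t)}}\Big(V(t_1)+\int_{t_1}^tF[X(s)]\,ds\Big).$$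
   Context: $\Omega=(0,1)$. $\mathcal K\subset L^2(\Omega)$ is the closed convex cone of nondecreasing functions (right-continuous representatives). For $X\in\mathcal K$: $\Omega_X$ is the set of $m\in\Omega$ such that $X$ is constant in a neighborhood of $m$; $\mathcal H_X:=\{U\in L^2(\Omega):U\text{ is (a.e.) constant in each interval }(\alpha,\beta)\subset\Omega_X\}$; $\partial I_{\mathcal K}(X)=\{W\in L^2(\Omega):\int_\Omega W(\tilde X-X)\,dm\le0\ \forall\tilde X\in\mathcal K\}$. $\mathsf P_C$ is the metric projection in $L^2(\Omega)$ onto the closed convex set $C$. $F$ is Lipschitz if $\|F[X_1]-F[X_2]\|_{L^2(\Omega)}\le L\|X_1-X_2\|_{L^2(\Omega)}$ for all $X_1,X_2\in\mathcal K$ and some $L\ge0$. $F$ is sticking if for all $X,Y\in\mathcal K$ with $Y\in\mathcal H_X$ one has $F[X]-\mathsf P_{\mathcal H_X}(F[X])\in\partial I_{\mathcal K}(Y)$. A Lagrangian solution with initial data $(\bar X,\bar V)\in\mathcal K\times L^2(\Omega)$ is a curve $X\in\mathrm{Lip}_{\rm loc}([0,\infty);\mathcal K)$ with $X(0)=\bar X$ and $\dot X(t)+\partial I_{\mathcal K}(X(t))\ni\bar V+\int_0^tF[X(s)]\,ds$ for a.e. $t>0$; its right derivative $V(t)$ exists in $L^2(\Omega)$ for all $t\ge0$. It is sticky if $\Omega_{X(t_1)}\subset\Omega_{X(t_2)}$ whenever $t_1\le t_2$. *)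

(* Defs.v *)
From mathcomp Require Import all_boot all_order all_algebra.
From mathcomp Require Import all_classical all_reals all_analysis.
Import Order.TTheory GRing.Theory Num.Theory.
Import numFieldNormedType.Exports.

Set Implicit Arguments.
Unset Strict Implicit.
Unset Printing Implicit Defensive.

Local Open Scope classical_set_scope.
Local Open Scope ring_scope.

Section L2.
Context {R : realType}.

Definition Omega : set R := `]0, 1[.

(* Lebesgue measure on Omega, as a measure on R that vanishes off Omega. *)
Definition muOmega : {measure set (measurableTypeR R) -> \bar R} :=
  mrestr (@lebesgue_measure R) (measurable_itv `]0, 1[%R : measurable Omega).

(* L^2(Omega) through representatives: the library's R-module of
   square-integrable functions.  Equality in L^2(Omega) is [%[ae muOmega]],
   and [norm2] is a seminorm on representatives. *)
Definition L2 : Type := LfunType muOmega (lee1n 2 : (1 <= 2%:E :> \bar R)%E).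

Definition norm2 (U : L2) : R := fine ('N[muOmega]_2%:E [EFin \o U])%E.

Definition inner2 (U W : L2) : R := \int[muOmega]_m (U m * W m).

(* The metric projection of Z onto C as a relation: P is determined only up to
   almost everywhere equality. *)
Definition is_proj (C : set L2) (Z P : L2) : Prop :=
  C P /\ forall Q, C Q -> norm2 (Z - P) <= norm2 (Z - Q).

Record simple_fun := SimpleFun {
  sf_size : nat;
  sf_set : 'I_sf_size -> set (measurableTypeR R);
  sf_measurable : forall i, measurable (sf_set i);
  sf_val : 'I_sf_size -> L2 }.

Definition sf_eval (s : simple_fun) (x : R) : L2 :=
  \sum_(i < sf_size s) \1_(sf_set i) x *: sf_val i.

Definition sf_int (s : simple_fun) (a b : R) : L2 :=
  \sum_(i < sf_size s)
    fine (@lebesgue_measure R (sf_set i `&` `[a, b])) *: sf_val i.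

(* J is the Bochner integral of f : R -> L^2(Omega) over [a, b]. *)
Definition is_bochner (f : R -> L2) (a b : R) (J : L2) : Prop :=
  exists s : nat -> simple_fun,
  [/\ forall k, measurable_fun (`[a, b] : set (measurableTypeR R))
                  (fun x => norm2 (f x - sf_eval (s k) x)),
      ((\int[lebesgue_measure]_(x in `[a, b])
          (norm2 (f x - sf_eval (s k) x))%:E)%E @[k --> \oo] --> 0%E)
    & norm2 (J - sf_int (s k) a b) @[k --> \oo] --> (0 : R)].

Definition is_deriv (X : R -> L2) (t : R) (D : L2) : Prop :=
  norm2 (h^-1 *: (X (t + h) - X t) - D) @[h --> (0 : R)^'] --> (0 : R).

Definition is_rderiv (X : R -> L2) (t : R) (D : L2) : Prop :=
  norm2 (h^-1 *: (X (t + h) - X t) - D) @[h --> (0 : R)^'+] --> (0 : R).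

End L2.
Arguments L2 R : clear implicits.

Section Lagrangian.
Context {R : realType}.
Local Notation L2 := (L2 R).

(* Members of the cone are the right-continuous representatives themselves, so
   pointwise notions such as [Omega_of] make sense; the values of X outside
   Omega play no role. *)
Definition Kcone : set L2 :=
  [set X : L2 | (forall x y : R, Omega x -> Omega y -> x <= y -> X x <= X y) /\
                (forall m : R, Omega m -> X x @[x --> m^'+] --> X m)].

Definition Omega_of (X : L2) : set R :=
  [set m : R | Omega m /\ \forall x \near m, X x = X m].

Definition Hspace (X : L2) : set L2 :=
  [set U : L2 | forall a b : R, `]a, b[ `<=` Omega_of X ->
     exists c : R, {ae muOmega, forall m : R, `]a, b[%classic m -> U m = c}].

Definition subdiff (X : L2) : set L2 :=
  [set W : L2 | forall Z, Kcone Z -> inner2 W (Z - X) <= 0].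

(* A map F : K -> L^2(Omega) is given by a total function on L2 of which only
   the values on [Kcone] are used; [lipschitzK F] makes it compatible with
   almost everywhere equality. *)
Definition lipschitzK (F : L2 -> L2) : Prop :=
  exists2 L : R, 0 <= L &
    forall X1 X2, Kcone X1 -> Kcone X2 ->
      norm2 (F X1 - F X2) <= L * norm2 (X1 - X2).

Definition sticking (F : L2 -> L2) : Prop :=
  forall X Y, Kcone X -> Kcone Y -> Hspace X Y ->
  forall P, is_proj (Hspace X) (F X) P -> subdiff Y (F X - P).

(* Curves [0, oo) -> L^2(Omega) are functions on R whose values at negative
   times are ignored. *)
Definition lip_loc (X : R -> L2) : Prop :=
  forall T : R, 0 <= T -> exists2 L : R, 0 <= L &
    forall s t : R, 0 <= s <= T -> 0 <= t <= T ->
      norm2 (X s - X t) <= L * `|s - t|.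

Definition lagrangian_solution (F : L2 -> L2) (Xb Vb : L2) (X : R -> L2) :
    Prop :=
  [/\ forall t, 0 <= t -> Kcone (X t),
      lip_loc X,
      X 0 = Xb %[ae muOmega]
    & {ae lebesgue_measure, forall t : R, 0 < t ->
        exists D J : L2,
        [/\ is_deriv X t D,
            is_bochner (fun s => F (X s)) 0 t J
          & subdiff (X t) (Vb + J - D)]}].

Definition sticky (X : R -> L2) : Prop :=
  forall t1 t2 : R, 0 <= t1 -> t1 <= t2 -> Omega_of (X t1) `<=` Omega_of (X t2).

End Lagrangian.

(* Main.v *)
Require Import Defs.
From HB Require Import structures.
From mathcomp Require Import all_boot all_order all_algebra.
From mathcomp Require Import all_classical all_reals all_analysis.
From mathcomp Require Import measurable_realfun ring lra.
Import Order.TTheory GRing.Theory Num.Theory.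
Import numFieldNormedType.Exports.

Set Implicit Arguments.
Unset Strict Implicit.
Unset Printing Implicit Defensive.

Local Open Scope classical_set_scope.
Local Open Scope ring_scope.

(** Write [N(X)] for [subdiff X] and [H_X] for [Hspace X].  A Lagrangian solution [X] with
    initial momentum [Vb] is the first component of a solution [u = (X, Y)] of the
    first-order inclusion [u' + N_C(u) ∋ B u], where [C] is the product of the cone of
    nondecreasing functions with [L2], [B (X, Y) = (Y, F X)] is Lipschitz, and [Y] is
    [Vb] plus the integral of [F[X]] ([lagrangian_strong], [strong_lagrangian]).  Such
    evolutions exist and are unique; they have a right derivative at every time, the
    projection of [B u] on the tangent cone, and a two-sided derivative at almost every
    time ([strong_exists], [strong_unique]).  Existence comes from the catching-up scheme.

    The geometry of the cone enters through one fact: [H_X] is exactly the orthogonal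
    complement of [N(X)] ([subdiff_Hspace], [Hspace_orth]).  It is
    tested with explicit vectors: ramps of [X] show that normal vectors are orthogonal to
    the indicators of half-lines starting where [X] is not locally constant, and the kinks,
    step functions supported in the intervals where [X] is constant, are normal vectors
    that detect constancy.  Consequently, larger constancy sets have larger normal
    cones ([subdiff_monotone]).

    Suppose that at time [tau] the momentum splits as [Y tau = W + n] with [W] in
    [H_{X tau}] and [n] in [N(X tau)].  The solution issued from [(X tau, W)] has, by
    hypothesis, constancy sets containing that of [X tau]; hence [n] stays normal along it,
    and adding [n] to its momentum gives a solution issued from [(X tau, Y tau)].  By
    uniqueness this is the given solution after time [tau].  So its constancy sets grow
    from [tau] on, and its shift is the solution issued from [(X tau, W)] ([restart]).

    It remains to split the momentum at every time.  Where [X] has a two-sided derivative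
    [D], difference quotients of both signs show that [D] is orthogonal to [N(X tau)], so
    [D] belongs to [H_{X tau}] and [W = D] works ([derivative_Hspace]).  The remaining times
    are limits from the left of such times, between which the constancy sets are already
    known to grow; that is enough to prove that [Y tau] minus its projection on [H_{X tau}]
    is normal ([restartable_all]).  The vector [W] obtained in this way is the right
    velocity ([restartable_velocity]), which gives stickiness and the semigroup property.
    The formula for [V] holds because the removed vectors [n] at times [t1] and [t] are
    both normal at [X t], hence orthogonal to [H_{X t}]; the formula for [X] follows by
    integrating the inclusion of the restarted solution over [[t1, t]], all the normal
    cones met there being contained in [N(X t)]. *)

(** * Identities in additive groups *)

Section Identities.

Lemma subr_sub2r (E : zmodType) (x y w : E) : x - w - (y - w) = x - y.
Proof. by rewrite opprB subrKA. Qed.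

Lemma subr_sub_shift (E : zmodType) (y d v z : E) : (y - d) - (v + (y - z) - d) = z - v.
Proof. by rewrite subr_sub2r opprD opprB addrCA addrC (addrC z) addNKr. Qed.

Lemma addr_sub2lr (E : zmodType) (v j d q : E) : (v + j - d) - (v + q - d) = j - q.
Proof. by rewrite subr_sub2r opprD addrACA subrr add0r. Qed.

Lemma addr_subAK (E : zmodType) (y a w : E) : y + (a - w) - a = y - w.
Proof. by rewrite addrCA addrAC subrr add0r. Qed.

Lemma subr_subr (E : zmodType) (y z n : E) : y - (z - n) = y + n - z.
Proof. by rewrite opprB addrA. Qed.

Lemma subrB_exchange (E : zmodType) (a b c d : E) : (a - b) - (c - d) = (a - c) + (d - b).
Proof. by rewrite opprB (addrC d) addrACA (addrC (- b)). Qed.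

Lemma addrB_exchange (E : zmodType) (a b c d : E) : a + (b - c) - d = (b - d) - (c - a).
Proof. by rewrite opprB addrCA addrAC. Qed.

Lemma addrB_regroup (E : zmodType) (x y z u v : E) :
  (x - (y - z)) + ((u - z) - v) = x - v - (y - u).
Proof. by rewrite !opprB addrACA !addrA subrK (addrAC x (- v)) (addrAC (x + u)). Qed.

Lemma scale_diff (R : pzRingType) (E : lmodType R) (a b : R) (x y : E) :
  a *: x - b *: y = a *: (x - y) + (a - b) *: y.
Proof. by rewrite scalerBr scalerBl subrKA. Qed.

End Identities.

(** * Real functions of one variable *)

Section RealFunctions.
Context {R : realType}.
Implicit Types (f g : R -> R) (a b t : R).
Local Notation leb := (@lebesgue_measure R).

Definition lip_on a b g := exists2 M : R, 0 <= M &
  forall x y, a <= x <= b -> a <= y <= b -> `|g x - g y| <= M * `|x - y|.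

Lemma lip_on_cst a b (c : R) : lip_on a b (cst c).
Proof. by exists 0 => // x y _ _; rewrite subrr normr0 mul0r. Qed.

Lemma lip_on_id a b : lip_on a b id.
Proof. by exists 1 => // x y _ _; rewrite mul1r. Qed.

Lemma lip_onD a b f g : lip_on a b f -> lip_on a b g -> lip_on a b (fun x => f x + g x).
Proof.
move=> [M M0 HM] [N N0 HN]; exists (M + N); first exact: addr_ge0.
move=> x y hx hy; rewrite opprD addrACA mulrDl.
by apply: le_trans (ler_normD _ _) _; apply: lerD; [exact: HM|exact: HN].
Qed.

Lemma lip_on_bounded a b g : a <= b -> lip_on a b g ->
  exists2 K : R, 0 <= K & forall x, a <= x <= b -> `|g x| <= K.
Proof.
move=> ab [M M0 HM]; exists (`|g a| + M * (b - a)).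
  by apply: addr_ge0 => //; apply: mulr_ge0 => //; rewrite subr_ge0.
move=> x hx; have := HM x a hx; rewrite lexx ab => /(_ isT) h.
have : M * `|x - a| <= M * (b - a).
  by apply: ler_wpM2l => //; move/andP: hx => [? ?]; rewrite ger0_norm; lra.
have := ler_normD (g x - g a) (g a); rewrite subrK; lra.
Qed.

Lemma lip_onM a b f g : a <= b -> lip_on a b f -> lip_on a b g ->
  lip_on a b (fun x => f x * g x).
Proof.
move=> ab lf lg; have [K K0 HK] := lip_on_bounded ab lf; have [K' K'0 HK'] := lip_on_bounded ab lg.
move: lf lg => [M M0 HM] [N N0 HN]; exists (K * N + K' * M).
  by apply: addr_ge0; apply: mulr_ge0.
move=> x y hx hy.
have -> : f x * g x - f y * g y = f x * (g x - g y) + g y * (f x - f y) by ring.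
apply: le_trans (ler_normD _ _) _; rewrite !normrM mulrDl -!mulrA.
by apply: lerD; apply: ler_pM => //; [exact: HK|exact: HN|exact: HK'|exact: HM].
Qed.

Lemma lip_onN a b f : lip_on a b f -> lip_on a b (fun x => - f x).
Proof. by move=> [M M0 HM]; exists M => // x y hx hy; rewrite -opprD normrN; exact: HM. Qed.

Lemma lip_onB a b f g : lip_on a b f -> lip_on a b g -> lip_on a b (fun x => f x - g x).
Proof. by move=> lf /lip_onN; exact: lip_onD. Qed.

Lemma lip_on_expRN a b (c : R) : 0 <= a -> 0 <= c -> lip_on a b (fun x => expR (- (c * x))).
Proof.
move=> a0 c0; exists c => // x y.
wlog xy : x y / x <= y.
  move=> W; case: (leP x y) => h hx hy; first exact: W.
  by rewrite distrC (distrC x); apply: W => //; exact: ltW.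
move=> /andP[ax _] _.
have mono : expR (- (c * y)) <= expR (- (c * x)) by rewrite ler_expR lerN2 ler_wpM2l.
rewrite ger0_norm ?subr_ge0// ler0_norm; last by lra.
have -> : - (c * y) = - (c * x) + - (c * (y - x)) by ring.
rewrite expRD.
have e1 : expR (- (c * x)) <= 1.
  by rewrite -expR0 ler_expR oppr_le0 mulr_ge0//; lra.
have e0 := expR_gt0 (- (c * x)).
have := expR_ge1Dx (- (c * (y - x))).
have : 0 <= c * (y - x) by apply: mulr_ge0; lra.
nra.
Qed.

Lemma is_derive1P f t (l : R) :
  h^-1 * (f (t + h) - f t) @[h --> 0^'] --> l -> is_derive t (1 : R) f l.
Proof.
move=> H.
have E : (fun h => h^-1 *: ((f \o shift t) (h *: (1 : R)) - f t)) =
         (fun h => h^-1 * (f (t + h) - f t)).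
  by apply/funext => h /=; rewrite [h *: _]mulr1 (addrC t h).
apply: DeriveDef; first by rewrite /derivable E; apply/cvg_ex; exists l.
by rewrite /derive E; exact/cvg_lim.
Qed.

(** The gaps between [f x] and [g x] are disjoint nonempty open intervals. *)
Lemma countable_jumps (A : set R) f g :
  (forall x, A x -> f x < g x) ->
  (forall x y, A x -> A y -> x < y -> g x <= f y) -> countable A.
Proof.
move=> fg gf.
refine (@separated_open_countable R R
  (fun x => if `[< A x >] then `]f x, g x[%classic else setT) A _ _ _).
- by move=> i; case: ifP => _; [exact: interval_open|exact: openT].
- move=> i; case: ifP => [/asboolP Ai|_]; last by exists 0.
  exists ((f i + g i) / 2); rewrite /= in_itv/=; have := fg _ Ai; lra.
- move=> x y Ax Ay [z]; rewrite !asboolT// => -[].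
  rewrite /= !in_itv/= => /andP[h1 h2] /andP[h3 h4].
  by case: (ltgtP x y) => // xy;
    [have := gf _ _ Ax Ay xy|have := gf _ _ Ay Ax xy]; lra.
Qed.

(** Real induction: the supremum of the times up to which [g] stays below [g a] has the
    same property by continuity, and could be passed if it were smaller than [b]. *)
Lemma lipschitz_right_nonincreasing g a b M : a <= b ->
  (forall x y, a <= x <= b -> a <= y <= b -> `|g x - g y| <= M * `|x - y|) ->
  (forall x, a <= x < b ->
     exists2 d, 0 < d & forall y, x < y -> y < x + d -> y <= b -> g y <= g x) ->
  g b <= g a.
Proof.
move=> ab glip gr.
have M0 : 0 <= `|M| by [].
pose S := [set t | a <= t <= b /\ forall s, a <= s <= t -> g s <= g a].
have Sa : S a.
  split; first by rewrite lexx ab.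
  by move=> s; rewrite -eq_le => /eqP <-.
have supS : has_sup S.
  by split; [exists a|exists b => t [/andP[]]].
have ac : a <= sup S by apply: sup_upper_bound.
have cb : sup S <= b by apply: ge_sup; [exists a|move=> t [/andP[]]].
have gc : g (sup S) <= g a.
  apply/ler_addgt0Pr => e e0.
  have [|s Ss cs] := @sup_adherent R S (e / (`|M| + 1)) _ supS.
    by rewrite divr_gt0//; lra.
  have sc : s <= sup S by apply: sup_upper_bound.
  have [/andP[as_ sb] Hs] := Ss.
  have H1 : g (sup S) - g s <= M * `|sup S - s|.
    by apply: le_trans (ler_norm _) _; apply: glip; apply/andP; split.
  have H2 : M * `|sup S - s| <= (`|M| + 1) * (e / (`|M| + 1)).
    apply: (@le_trans _ _ ((`|M| + 1) * `|sup S - s|)).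
      by apply: ler_wpM2r => //; have := ler_norm M; lra.
    apply: ler_wpM2l; first by lra.
    by rewrite ger0_norm; lra.
  rewrite mulrCA divff in H2; last by rewrite gt_eqF//; lra.
  have := Hs s; rewrite as_ lexx => /(_ isT); lra.
have Sc : S (sup S).
  split; first by rewrite ac.
  move=> s /andP[as_]; rewrite le_eqVlt => /predU1P[-> //|sc].
  have [|s' Ss' cs] := @sup_adherent R S (sup S - s) _ supS; first by lra.
  by have [_] := Ss'; apply; rewrite as_/=; lra.
case: (ltP (sup S) b) => [cltb|bc]; last by have -> : b = sup S by lra.
have [|d d0 dP] := gr (sup S); first by rewrite ac.
pose y := sup S + Num.min (d / 2) (b - sup S).
have [y1 y2 y3] : [/\ sup S < y, y < sup S + d & y <= b].
  by rewrite /y minEle; case: ifP => h; split; lra.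
have : S y.
  split; first by rewrite y3 andbT; lra.
  move=> s /andP[as_ sy]; case: (leP s (sup S)) => sc.
    by have [_] := Sc; apply; rewrite as_.
  by apply: le_trans (dP s _ _ _) gc => //; lra.
by move/(sup_upper_bound supS); lra.
Qed.

(** The part of an open set of small measure to the left of [t] grows with
    slope one at the points of that set; subtracting it makes up for the points
    where nothing is known about the derivative of a Lipschitz function. *)
Lemma ae_nonincreasing g a b : a <= b -> lip_on a b g ->
  {ae leb, forall t, a < t < b -> exists d, is_derive t (1 : R) g d /\ d <= 0} ->
  g b <= g a.
Proof.
move=> ab [M _ glip] [N [mN N0 Nsub]].
pose K := `|M|.
have K0 : 0 <= K by rewrite /K.
have glipK x y : a <= x <= b -> a <= y <= b -> `|g x - g y| <= K * `|x - y|.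
  by move=> hx hy; apply: le_trans (glip _ _ hx hy) _; apply: ler_wpM2r => //; exact: ler_norm.
suff H e : 0 < e -> g b - g a <= K * e + e * (b - a).
  apply/ler_addgt0Pr => e e0.
  have k0 : 0 < K + (b - a) + 1 by lra.
  have := H (e / (K + (b - a) + 1)) (divr_gt0 e0 k0).
  have : e / (K + (b - a) + 1) * (K + (b - a) + 1) = e by rewrite divfK// gt_eqF.
  have := divr_gt0 e0 k0.
  set q := e / _; nra.
move=> e0.
pose N' := N `|` [set a].
have mN' : measurable N' by apply: measurableU.
have N'0 : leb N' = 0%E.
  apply/eqP; rewrite eq_le measure_ge0 andbT.
  apply: le_trans (measureU2 _ _ _) _ => //.
  rewrite [leLHS](_ : _ = (leb N + leb [set a])%E)//.
  by rewrite N0 [leb _]lebesgue_measure_set1 adde0.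
have N'fin : (leb N' < +oo)%E by rewrite N'0.
have [U [oU NU Ue]] := lebesgue_regularity_outer mN' N'fin e0.
have mU : measurable U by exact: measurable_realfun.open_measurable.
have Ue' : (leb U < e%:E)%E.
  have UE : U = (U `\` N') `|` N' by rewrite setUC setDUK.
  rewrite UE; apply: le_lt_trans (measureU2 _ _ _) _ => //; first exact: measurableD.
  by rewrite [X in (_ + X)%E]N'0 adde0.
pose V t := U `&` `]a, t].
have mV t : measurable (V t) by exact: measurableI.
have leb_le (A B : set R) : measurable A -> measurable B -> A `<=` B -> (leb A <= leb B)%E.
  by move=> mA mB AB; apply: le_measure => //; rewrite inE.
have Vle t : (leb (V t) <= leb U)%E by apply: leb_le => //; exact: subIsetl.
have Vfin t : leb (V t) \is a fin_num.
  by rewrite ge0_fin_numE ?measure_ge0//; apply: le_lt_trans (Vle t) (lt_trans Ue' (ltry _)).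
pose phi t := fine (leb (V t)).
have phiD s t : a <= s -> s <= t -> phi t = phi s + fine (leb (U `&` `]s, t])).
  move=> as_ st.
  have VE : V t = V s `|` (U `&` `]s, t]).
    rewrite /V -setIUr; congr (_ `&` _); apply/seteqP; split => x /=.
      by rewrite !in_itv/= => /andP[h1 h2]; case: (leP x s) => h; [left|right]; rewrite ?h1 ?h ?h2.
    by rewrite !in_itv/= => -[/andP[h1 h2]|/andP[h1 h2]]; rewrite ?h1 ?h2 ?andbT ?andTb; lra.
  have Wfin : leb (U `&` `]s, t]) \is a fin_num.
    rewrite ge0_fin_numE ?measure_ge0//; apply: le_lt_trans (lt_trans Ue' (ltry _)).
    by apply: leb_le; [exact: measurableI|by []|exact: subIsetl].
  have lebE : leb (V t) = (leb (V s) + leb (U `&` `]s, t]))%E.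
    rewrite VE; apply: measureU; [exact: mV|exact: measurableI|].
    apply/seteqP; split => x //= -[[_ +] [_]]; rewrite /= !in_itv/= => /andP[_ ?] /andP[? _]; lra.
  by rewrite /phi lebE fineD.
have phi_mono s t : a <= s -> s <= t -> phi s <= phi t.
  by move=> h1 h2; rewrite (phiD s t)// lerDl fine_ge0 ?measure_ge0.
have phi_lip s t : a <= s -> s <= t -> phi t - phi s <= t - s.
  move=> h1 h2; rewrite (phiD s t)// addrAC subrr add0r.
  have lst : leb `]s, t] = (t - s)%:E.
    rewrite lebesgue_measure_itv/= lte_fin; case: ifPn => [_|]; first by rewrite EFinB.
    rewrite -leNgt => h3; have -> : s = t by apply/eqP; rewrite eq_le h2.
    by rewrite subrr.
  rewrite -lee_fin fineK -?lst.
    by apply: leb_le; [exact: measurableI|by []|exact: subIsetr].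
  rewrite ge0_fin_numE ?measure_ge0//; apply: le_lt_trans (lt_trans Ue' (ltry _)).
  by apply: leb_le; [exact: measurableI|by []|exact: subIsetl].
have phia : phi a = 0.
  rewrite /phi /V (_ : `]a, a]%classic = set0) ?setI0 ?measure0//.
  by apply/seteqP; split => x //=; rewrite in_itv/=; lra.
have phib : phi b <= e.
  by rewrite -lee_fin fineK//; apply: le_trans (Vle b) (ltW Ue').
pose h t := g t - K * phi t - e * t.
suff : h b <= h a by rewrite /h phia; nra.
apply: (@lipschitz_right_nonincreasing h a b (K + K + e)) => //.
  move=> x y hx hy.
  wlog xy : x y hx hy / x <= y.
    move=> W; case: (leP x y) => h'; first exact: W.
    by rewrite distrC (distrC x); apply: W => //; exact: ltW.
  rewrite (distrC x) (ger0_norm (_ : 0 <= y - x)); last by lra.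
  have := glipK _ _ hx hy; rewrite (distrC x) (ger0_norm (_ : 0 <= y - x)); last by lra.
  move: hx hy => /andP[ax xb] /andP[ay yb].
  have := phi_mono _ _ ax xy; have := phi_lip _ _ ax xy.
  rewrite /h !ler_norml => h1 h2 /andP[h3 h4]; apply/andP.
  have : 0 <= K * (phi y - phi x) by apply: mulr_ge0; lra.
  have : K * (phi y - phi x) <= K * (y - x) by apply: ler_wpM2l.
  have : 0 <= e * (y - x) by apply: mulr_ge0; lra.
  rewrite !mulrBr !mulrDl => ? ? ?; split; lra.
move=> x /andP[ax xb].
have [Ux|nUx] := pselect (U x).
  move: oU; rewrite openE => /(_ _ Ux)/nbhs_ballP[d /= d0 dU].
  exists d => // y xy yd yb.
  have -> : h y = h x + (g y - g x) - K * (phi y - phi x) - e * (y - x) by rewrite /h; ring.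
  have -> : phi y - phi x = y - x.
    rewrite (phiD x y)//; last exact: ltW.
    rewrite addrAC subrr add0r (_ : U `&` _ = `]x, y]%classic).
      by rewrite lebesgue_measure_itv/= lte_fin xy.
    apply/seteqP; split => z /=; first by case.
    move=> zi; split=> //; move: zi; rewrite in_itv/= => /andP[h1 h2].
    by apply: dU; rewrite /ball/= ltr_norml; apply/andP; split; lra.
  have : `|g x - g y| <= K * `|x - y| by apply: glipK; apply/andP; split; lra.
  rewrite (ler0_norm (_ : x - y <= 0)); last by lra.
  rewrite ler_norml => /andP[h1 h2].
  have : 0 <= e * (y - x) by apply: mulr_ge0; lra.
  lra.
have [nNx xa] : ~ N x /\ x <> a.
  by split => H; apply: nUx; apply: NU; [left|right].
have {}nNx := contra_notP (Nsub x) nNx.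
have ax' : a < x by lra.
have [|d [gd d0]] := nNx; first by rewrite ax'.
have /cvgrPdist_lt/(_ e e0) : h^-1 *: (g (h + x) - g x) @[h --> 0^'] --> d.
  have [gdx <-] := gd.
  suff -> : (fun k => k^-1 *: (g (k + x) - g x)) =
            (fun k => k^-1 *: ((g \o shift x) (k *: 1) - g x)) by exact: gdx.
  by apply/funext => k /=; rewrite [k *: _]mulr1.
rewrite /dnbhs /within /= => /nbhs_ballP[r /= r0 rP].
exists r => // y xy yr yb.
have := rP (y - x); rewrite /ball/= sub0r normrN (ger0_norm (_ : 0 <= y - x)); last by lra.
move=> /(_ _ _)/wrap[].
  lra.
  by rewrite gt_eqF// subr_gt0.
rewrite subrK ltr_norml => /andP[+ _].
move=> H1.
have yx0 : 0 < y - x by lra.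
have H2 : g y - g x <= e * (y - x).
  have : (y - x)^-1 *: (g y - g x) <= e by lra.
  by rewrite /GRing.scale/= mulrC ler_pdivrMr.
have -> : h y = h x + (g y - g x) - K * (phi y - phi x) - e * (y - x) by rewrite /h; ring.
have : 0 <= K * (phi y - phi x) by apply: mulr_ge0 => //; rewrite subr_ge0 phi_mono//; lra.
lra.
Qed.

Lemma ae_impl (P Q : R -> Prop) : (forall t, P t -> Q t) ->
  {ae leb, forall t, P t} -> {ae leb, forall t, Q t}.
Proof. by move=> PQ; apply: (@filterS _ _ (ae_filter_ringOfSetsType leb)). Qed.

Lemma ae_impl2 (P P' Q : R -> Prop) : (forall t, P t -> P' t -> Q t) ->
  {ae leb, forall t, P t} -> {ae leb, forall t, P' t} -> {ae leb, forall t, Q t}.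
Proof. by move=> PQ; apply: (@filterS2 _ _ (ae_filter_ringOfSetsType leb)). Qed.

End RealFunctions.

Section Shift.
Context {R : realType}.
Local Notation leb := (@lebesgue_measure R).
Definition shiftr (tau : R) : measurableTypeR R -> measurableTypeR R := fun t => t + tau.

Lemma measurable_shiftr tau : measurable_fun setT (shiftr tau).
Proof. by apply: measurable_realfun.measurable_funD => //; exact: measurable_cst. Qed.

HB.instance Definition _ tau := isMeasurableFun.Build _ _ _ _ (shiftr tau) (measurable_shiftr tau).

Lemma lebesgue_measure_shift tau (A : set (measurableTypeR R)) : measurable A ->
  leb (shiftr tau @^-1` A) = leb A.
Proof.
move=> mA; symmetry.
apply: (@lebesgue_measure_unique R (pushforward leb (shiftr tau))) => // X [[a b] _ <-].
have E : shiftr tau @^-1` `]a, b] = `](a - tau), (b - tau)]%classic.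
  by apply/seteqP; split => x; rewrite /shiftr/= !in_itv/=; lra.
rewrite [RHS](_ : _ = leb (shiftr tau @^-1` `]a, b]))// E.
rewrite !lebesgue_measure_itv/= !lte_fin ltrD2r; case: ifP => // _.
by rewrite -!EFinB; congr (_%:E); ring.
Qed.

Lemma ae_shift (P : R -> Prop) tau :
  {ae leb, forall t, P t} -> {ae leb, forall t, P (t + tau)}.
Proof.
move=> [N [mN N0 PN]]; exists (shiftr tau @^-1` N); split.
- by rewrite -[X in measurable X]setTI; exact: measurable_shiftr.
- by rewrite lebesgue_measure_shift.
- by move=> t nP; apply: PN.
Qed.
End Shift.

(** * Spaces with a semi-definite inner product *)

(** Square-integrable representatives form a real vector space on which the
    inner product is only semi-definite; everything below holds up to vectors
    of norm zero, and no quotient is taken. *)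
Record semi_inner (R : realType) (E : lmodType R) := SemiInner {
  sip :> E -> E -> R;
  sipC : forall x y, sip x y = sip y x;
  sipDl : forall x y z, sip (x + y) z = sip x z + sip y z;
  sipZl : forall a x z, sip (a *: x) z = a * sip x z;
  sip_ge0 : forall x, 0 <= sip x x }.

Section SemiInner.
Context {R : realType} {E : lmodType R} (S : semi_inner E).
Implicit Types (x y z w : E) (a t : R) (C : set E).

Definition nrm x : R := Num.sqrt (S x x).

Lemma sipDr x y z : S z (x + y) = S z x + S z y.
Proof. by rewrite sipC sipDl !(sipC S z). Qed.
Lemma sipZr a x z : S z (a *: x) = a * S z x.
Proof. by rewrite sipC sipZl !(sipC S z). Qed.
Lemma sipNl x z : S (- x) z = - S x z.
Proof. by rewrite -scaleN1r sipZl mulN1r. Qed.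
Lemma sipNr x z : S z (- x) = - S z x.
Proof. by rewrite -scaleN1r sipZr mulN1r. Qed.
Lemma sip0l z : S 0 z = 0.
Proof. by rewrite -(scale0r (0 : E)) sipZl mul0r. Qed.
Lemma sip0r z : S z 0 = 0.
Proof. by rewrite sipC sip0l. Qed.
Definition sipE := (sipDl, sipDr, sipNl, sipNr, sipZl, sipZr, sip0l, sip0r).

Lemma nrm_ge0 x : 0 <= nrm x. Proof. exact: sqrtr_ge0. Qed.
Lemma nrm_sq x : nrm x ^+ 2 = S x x.
Proof. by rewrite sqr_sqrtr// sip_ge0. Qed.
Lemma nrm0 : nrm 0 = 0.
Proof. by rewrite /nrm sip0l sqrtr0. Qed.
Lemma nrmZ a x : nrm (a *: x) = `|a| * nrm x.
Proof. by rewrite /nrm !sipE mulrA -expr2 sqrtrM ?sqr_ge0// sqrtr_sqr. Qed.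
Lemma nrmN x : nrm (- x) = nrm x.
Proof. by rewrite -scaleN1r nrmZ normrN1 mul1r. Qed.
Lemma nrmB x y : nrm (x - y) = nrm (y - x).
Proof. by rewrite -nrmN opprB. Qed.

Lemma sip_sq_le x y : S x y ^+ 2 <= S x x * S y y.
Proof.
have H t : 0 <= S x x + 2 * t * S x y + t ^+ 2 * S y y.
  have := sip_ge0 S (x + t *: y); rewrite !sipE (sipC S y x).
  by move/le_trans; apply; rewrite le_eqVlt; apply/orP; left; apply/eqP; ring.
have y0 := sip_ge0 S y.
case: (ltP 0 (S y y)) => [yp|yn].
  have := H (- S x y / S y y).
  have -> : S x x + 2 * (- S x y / S y y) * S x y + (- S x y / S y y) ^+ 2 * S y y
     = (S x x * S y y - S x y ^+ 2) / S y y by field; rewrite gt_eqF.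
  by rewrite pmulr_lge0 ?invr_gt0// subr_ge0.
have yE : S y y = 0 by lra.
rewrite yE mulr0; case: (eqVneq (S x y) 0) => [->|n0]; first by rewrite expr0n.
have := H (- (S x x + 1) / (2 * S x y)).
rewrite yE mulr0 addr0.
have -> : 2 * (- (S x x + 1) / (2 * S x y)) * S x y = - (S x x + 1).
  by field.
lra.
Qed.

Lemma sip_le x y : S x y <= nrm x * nrm y.
Proof.
rewrite /nrm -sqrtrM ?sip_ge0//; apply: le_trans (ler_norm _) _.
by rewrite -sqrtr_sqr ler_sqrt ?sip_sq_le// mulr_ge0 ?sip_ge0.
Qed.
Lemma sip_norm_le x y : `|S x y| <= nrm x * nrm y.
Proof.
rewrite ler_norml sip_le andbT lerNl -sipNl; apply: le_trans (sip_le _ _) _.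
by rewrite nrmN.
Qed.

Lemma nrmD x y : nrm (x + y) <= nrm x + nrm y.
Proof.
rewrite -(@ler_pXn2r _ 2) ?nnegrE ?addr_ge0 ?nrm_ge0// nrm_sq !sipE.
rewrite sqrrD !nrm_sq (sipC S y x); have := sip_le x y; lra.
Qed.
Lemma nrm_tri x y z : nrm (x - z) <= nrm (x - y) + nrm (y - z).
Proof. by rewrite -(subrKA y x) nrmD. Qed.
Lemma nrm_le_dist x y : nrm x <= nrm y + nrm (x - y).
Proof. by rewrite -{1}(subrK y x) addrC nrmD. Qed.

Lemma nrm0_sipl x y z : nrm (x - y) = 0 -> S x z = S y z.
Proof.
move=> h; apply/eqP; rewrite -subr_eq0 -sipNl -sipDl -normr_eq0 eq_le normr_ge0 andbT.
by apply: le_trans (sip_norm_le _ _) _; rewrite h mul0r.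
Qed.
Lemma nrm0_sipr x y z : nrm (x - y) = 0 -> S z x = S z y.
Proof. by move=> h; rewrite !(sipC S z); exact: nrm0_sipl. Qed.
Lemma sip_eq0_nrm x : S x x = 0 -> nrm x = 0.
Proof. by move=> h; rewrite /nrm h sqrtr0. Qed.
Lemma nrm0_sym x y : nrm (x - y) = 0 -> nrm (y - x) = 0.
Proof. by rewrite nrmB. Qed.
Lemma nrm0_trans x y z : nrm (x - y) = 0 -> nrm (y - z) = 0 -> nrm (x - z) = 0.
Proof.
move=> h1 h2; apply/eqP; rewrite eq_le nrm_ge0 andbT.
by apply: le_trans (nrm_tri x y z) _; rewrite h1 h2 addr0.
Qed.
Lemma nrm0_le x : nrm x <= 0 -> nrm x = 0.
Proof. by move=> h; apply/eqP; rewrite eq_le h nrm_ge0. Qed.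

(** ** Convergence in norm *)

Definition tends {T} (F : set_system T) (f : T -> E) y :=
  nrm (f i - y) @[i --> F] --> (0 : R).

Section Tends.
Context {T : Type} {F : set_system T} {FF : ProperFilter F}.
Implicit Types (f g : T -> E).

Lemma tends_le f y (r : T -> R) :
  (\forall i \near F, nrm (f i - y) <= r i) -> r @ F --> (0 : R) -> tends F f y.
Proof.
move=> fr r0; apply: (@squeeze_cvgr _ _ _ _ (cst 0) r) => //; last exact: cvg_cst.
by near=> i; rewrite nrm_ge0/=; near: i.
Unshelve. all: by end_near. Qed.

Lemma tendsP f y : tends F f y <->
  forall e, 0 < e -> \forall i \near F, nrm (f i - y) <= e.
Proof.
split=> [/cvgrPdist_le H e e0|H].
  near=> i; have : `|0 - nrm (f i - y)| <= e by near: i; exact: H.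
  by rewrite sub0r normrN ger0_norm ?nrm_ge0.
apply/cvgrPdist_le => e e0; near=> i.
by rewrite sub0r normrN ger0_norm ?nrm_ge0//; near: i; exact: H.
Unshelve. all: by end_near. Qed.

Lemma tends_cst y : tends F (cst y) y.
Proof. by apply/tendsP => e e0; near=> i; rewrite /= subrr nrm0 ltW. Unshelve. all: by end_near. Qed.

Lemma tendsD f g y z : tends F f y -> tends F g z -> tends F (fun i => f i + g i) (y + z).
Proof.
move=> fy gz; apply: (@tends_le _ _ (fun i => nrm (f i - y) + nrm (g i - z))).
  by near=> i; rewrite opprD addrACA nrmD.
by rewrite -[0 in X in _ --> X]addr0; exact: cvgD.
Unshelve. all: by end_near. Qed.

Lemma tendsZ a f y : tends F f y -> tends F (fun i => a *: f i) (a *: y).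
Proof.
move=> fy; apply: (@tends_le _ _ (fun i => `|a| * nrm (f i - y))).
  by near=> i; rewrite -scalerBr nrmZ.
rewrite -[0 in X in _ --> X](mulr0 `|a|); apply: cvgM => //; exact: cvg_cst.
Unshelve. all: by end_near. Qed.

Lemma tendsN f y : tends F f y -> tends F (fun i => - f i) (- y).
Proof. by move=> /(tendsZ (-1)); under eq_fun do rewrite scaleN1r; rewrite scaleN1r. Qed.

Lemma tendsB f g y z : tends F f y -> tends F g z -> tends F (fun i => f i - g i) (y - z).
Proof. by move=> fy /tendsN; exact: tendsD. Qed.

Lemma tends_nrm f y : tends F f y -> nrm (f i) @[i --> F] --> nrm y.
Proof.
move=> /tendsP H; apply/cvgrPdist_le => e e0; near=> i.
apply: (@le_trans _ _ (nrm (f i - y))); last by near: i; exact: H.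
by rewrite ler_norml; have := nrm_le_dist (f i) y; have := nrm_le_dist y (f i);
  rewrite (nrmB y); move=> ? ?; apply/andP; split; lra.
Unshelve. all: by end_near. Qed.

Lemma tends_sip f g y z : tends F f y -> tends F g z -> S (f i) (g i) @[i --> F] --> S y z.
Proof.
move=> fy gz.
have pol u v : S u v = (nrm (u + v) ^+ 2 - nrm (u - v) ^+ 2) / 4.
  by rewrite !nrm_sq !sipE (sipC S v u); field.
rewrite pol; under eq_fun do rewrite pol.
apply: cvgM; last exact: cvg_cst.
have sqr (h : T -> E) v : tends F h v -> nrm (h i) ^+ 2 @[i --> F] --> nrm v ^+ 2.
  by move=> hv; under eq_fun do rewrite expr2; rewrite expr2; apply: cvgM; exact: tends_nrm.
by apply: cvgB; apply: sqr; [exact: tendsD|exact: tendsB].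
Qed.

Lemma tends_unique f y z : tends F f y -> tends F f z -> nrm (y - z) = 0.
Proof.
move=> fy fz; have := tends_nrm (tendsB fy fz).
under eq_fun do rewrite subrr nrm0.
by move=> /cvg_lim <- //; rewrite lim_cst.
Qed.

Lemma tends_congr f g y z : (forall i, nrm (f i - g i) = 0) -> nrm (y - z) = 0 ->
  tends F f y -> tends F g z.
Proof.
move=> fg yz fy; apply: (tends_le _ fy); near=> i.
apply: le_trans (nrm_tri _ (f i) _) _; rewrite nrmB fg add0r.
by apply: le_trans (nrm_tri _ y _) _; rewrite yz addr0.
Unshelve. all: by end_near. Qed.

End Tends.

(** ** Projection on a complete convex set *)

Definition ncauchy (x : nat -> E) := forall e, 0 < e ->
  exists N, forall m n, (N <= m)%N -> (N <= n)%N -> nrm (x m - x n) <= e.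

Definition ncomplete C := forall x : nat -> E, (forall n, C (x n)) -> ncauchy x ->
  exists2 y, C y & tends \oo x y.

Definition nconvex C := forall x y t, C x -> C y -> 0 <= t <= 1 ->
  C (x + t *: (y - x)).

Definition normal C x n := forall w, C w -> S n (w - x) <= 0.

(** A minimizing sequence is Cauchy by the parallelogram identity. *)
Lemma projection_exists C x : C !=set0 -> nconvex C -> ncomplete C ->
  exists2 p, C p & normal C p (x - p).
Proof.
move=> [c0 Cc0] Ccvx Ccpl.
pose D := [set S (x - w) (x - w) | w in C].
have infD : has_inf D.
  by split; [exists (S (x - c0) (x - c0)), c0|exists 0 => _ [w _ <-]; exact: sip_ge0].
pose d := inf D.
have dle w : C w -> d <= S (x - w) (x - w).
  by move=> Cw; apply: ge_inf; [exact: infD.2|exists w].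
have ex n : exists w, C w /\ S (x - w) (x - w) < d + n.+1%:R^-1.
  have [|_ [w Cw <-] h] := @inf_adherent _ D n.+1%:R^-1 _ infD; first by rewrite invr_gt0.
  by exists w.
have [w_ wP] := choice ex.
clearbody d.
have wC n : C (w_ n) by have [] := wP n.
have cw : ncauchy w_.
  move=> e e0.
  have [N _ NP] := @near_infty_natSinv_lt R (PosNum (divr_gt0 (exprn_gt0 2 e0) (ltr0n R 4))).
  exists N => m n Nm Nn.
  rewrite -(@ler_pXn2r _ 2) ?nnegrE ?nrm_ge0 ?(ltW e0)// nrm_sq.
  have /dle : C (w_ m + 2^-1 *: (w_ n - w_ m)) by apply: Ccvx => //; apply/andP; split; lra.
  have [_ h1] := wP m; have [_ h2] := wP n.
  have := NP _ Nm; have := NP _ Nn => /= h3 h4.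
  have -> : S (x - (w_ m + 2^-1 *: (w_ n - w_ m))) (x - (w_ m + 2^-1 *: (w_ n - w_ m))) =
    (2 * S (x - w_ m) (x - w_ m) + 2 * S (x - w_ n) (x - w_ n) - S (w_ m - w_ n) (w_ m - w_ n)) / 4.
    by rewrite !sipE (sipC S (w_ m) x) (sipC S (w_ n) x) (sipC S (w_ n) (w_ m)); field.
  move: h1 h2 h3 h4; move: (m.+1%:R^-1) (n.+1%:R^-1) (S _ _) (S _ _) (S _ _) => i j A B Q.
  by move: (e ^+ 2) => e2; lra.
have [p Cp wp] := Ccpl _ wC cw.
exists p => //.
have pd : S (x - p) (x - p) <= d.
  have h1 : S (x - w_ n) (x - w_ n) @[n --> \oo] --> S (x - p) (x - p).
    by apply: tends_sip; (apply: tendsB => //; exact: tends_cst).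
  have h2 : (d + n.+1%:R^-1) @[n --> \oo] --> d + 0.
    by apply: cvgD; [exact: cvg_cst|exact: cvg_harmonic].
  rewrite addr0 in h2; apply: (ler_cvg_to h1 h2); near=> n.
  by have [_ /ltW] := wP n.
move=> w Cw.
suff H t : 0 < t -> t <= 1 -> 2 * S (x - p) (w - p) <= t * S (w - p) (w - p).
  apply/ler_addgt0Pr => e e0; rewrite add0r.
  have s0 := sip_ge0 S (w - p); pose s := S (w - p) (w - p); rewrite -/s in s0 H.
  have q0 : 0 < e / (e + s + 1) by rewrite divr_gt0//; lra.
  have q1 : e / (e + s + 1) * (e + s + 1) = e by rewrite divfK// gt_eqF//; lra.
  have := H _ q0; set q := e / _ in q0 q1 *.
  move=> /(_ _)/wrap[]; first by nra.
  by nra.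
move=> t0 t1; have /dle : C (p + t *: (w - p)) by apply: Ccvx => //; rewrite ltW.
move=> /(le_trans pd).
have -> : x - (p + t *: (w - p)) = (x - p) - t *: (w - p) by rewrite opprD addrA.
move: (x - p) (w - p) => a b.
rewrite !sipE (sipC S b a) => h.
have {}h : 0 <= t * (t * S b b - 2 * S a b) by nra.
by rewrite pmulr_rge0// subr_ge0 in h.
Unshelve. all: by end_near. Qed.

End SemiInner.

(** * Evolution in a convex set: uniqueness *)

Section Evolution.
Context {R : realType} {E : lmodType R} (S : semi_inner E).
Implicit Types (x y z w D : E) (C : set E) (B : E -> E) (u v : R -> E) (s t a b : R).
Local Notation leb := (@lebesgue_measure R).

Definition quot u t := fun h : R => h^-1 *: (u (t + h) - u t).

Definition loclip u := forall T : R, 0 <= T -> exists2 K : R, 0 <= K &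
  forall s t, 0 <= s <= T -> 0 <= t <= T -> nrm S (u s - u t) <= K * `|s - t|.

(** A strong solution of the differential inclusion [u' + N_C(u) ∋ B u]. *)
Definition strong C B u := [/\ forall t, 0 <= t -> C (u t), loclip u &
  {ae leb, forall t, 0 < t ->
     exists2 D, tends S (0 : R)^' (quot u t) D & normal S C (u t) (B (u t) - D)}].

Lemma tends_quot_cst z t : tends S (0 : R)^' (quot (cst z) t) 0.
Proof.
apply: (@tends_le _ _ _ _ _ _ _ _ (cst 0)); last exact: cvg_cst.
by near=> h; rewrite /quot subrr scaler0 subrr nrm0.
Unshelve. all: by end_near. Qed.

Lemma tends_quotD u v t D D' :
  tends S (0 : R)^' (quot u t) D -> tends S (0 : R)^' (quot v t) D' ->
  tends S (0 : R)^' (quot (fun r => u r + v r) t) (D + D').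
Proof.
move=> h1 h2; rewrite (_ : quot _ t = fun h => quot u t h + quot v t h); first exact: tendsD.
by apply/funext => h; rewrite /quot -scalerDr addrACA -opprD.
Qed.

Lemma tends_quotN u t D :
  tends S (0 : R)^' (quot u t) D -> tends S (0 : R)^' (quot (fun r => - u r) t) (- D).
Proof.
move=> h1; rewrite (_ : quot _ t = fun h => - quot u t h); first exact: tendsN.
by apply/funext => h; rewrite /quot -scalerN opprD.
Qed.

Lemma tends_quot_continuous u t D : tends S (0 : R)^' (quot u t) D ->
  tends S (0 : R)^' (fun h => u (t + h)) (u t).
Proof.
move=> uD.
have h0 : `|h| @[h --> (0 : R)^'] --> (0 : R).
  rewrite -[X in _ --> X](normr0 R); apply: cvg_norm; exact: nbhs_dnbhs_neq || exact: nbhs_dnbhs.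
apply: (@tends_le _ _ _ _ _ _ _ _ (fun h => `|h| * nrm S (quot u t h))).
  near=> h; rewrite -nrmZ /quot scalerA divff ?scale1r//.
  by near: h; exact: nbhs_dnbhs_neq.
rewrite -[X in _ --> X](mul0r (nrm S D)); apply: cvgM => //.
exact: tends_nrm.
Unshelve. all: by end_near. Qed.

Lemma is_derive_sip u v t D D' :
  tends S (0 : R)^' (quot u t) D -> tends S (0 : R)^' (quot v t) D' ->
  is_derive t (1 : R) (fun r => S (u r) (v r)) (S D (v t) + S (u t) D').
Proof.
move=> uD vD; apply: is_derive1P.
have -> : (fun h => h^-1 * (S (u (t + h)) (v (t + h)) - S (u t) (v t))) =
          (fun h => S (quot u t h) (v (t + h)) + S (u t) (quot v t h)).
  apply/funext => h; rewrite /quot !sipE; ring.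
by apply: cvgD; apply: tends_sip => //; [exact: tends_quot_continuous vD|exact: tends_cst].
Qed.

Lemma lip_on_sip u v (a b : R) : 0 <= a -> a <= b -> loclip u -> loclip v ->
  lip_on a b (fun r => S (u r) (v r)).
Proof.
move=> a0 ab lu lv; have b0 : 0 <= b by lra.
have [K K0 HK] := lu b b0; have [N N0 HN] := lv b b0.
have bd (w : R -> E) (M : R) : 0 <= M -> (forall s t, 0 <= s <= b -> 0 <= t <= b -> nrm S (w s - w t) <= M * `|s - t|) ->
    exists2 c : R, 0 <= c & forall s, 0 <= s <= b -> nrm S (w s) <= c.
  move=> M0 HM; exists (nrm S (w 0) + M * b); first by rewrite addr_ge0 ?nrm_ge0// mulr_ge0.
  move=> s hs; apply: le_trans (nrm_le_dist S _ (w 0)) _; rewrite lerD2l.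
  apply: le_trans (HM _ _ hs _) _; first by rewrite lexx.
  by rewrite subr0; apply: ler_wpM2l => //; case/andP: hs => *; rewrite ger0_norm.
have [c c0 Hc] := bd u K K0 HK; have [d d0 Hd] := bd v N N0 HN.
exists (K * d + c * N); first by rewrite addr_ge0 ?mulr_ge0.
move=> x y /andP[ax xb] /andP[ay yb].
have hx : 0 <= x <= b by apply/andP; split; lra.
have hy : 0 <= y <= b by apply/andP; split; lra.
have -> : S (u x) (v x) - S (u y) (v y) = S (u x - u y) (v x) + S (u y) (v x - v y).
  by rewrite !sipE; ring.
apply: le_trans (ler_normD _ _) _; rewrite mulrDl; apply: lerD.
  apply: le_trans (sip_norm_le _ _ _) _; rewrite mulrAC.
  by apply: ler_pM; rewrite ?nrm_ge0//; [exact: HK|exact: Hd].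
apply: le_trans (sip_norm_le _ _ _) _; rewrite -mulrA.
by apply: ler_pM; rewrite ?nrm_ge0//; [exact: Hc|exact: HN].
Qed.

Lemma loclip_cst z : loclip (cst z).
Proof. by move=> T _; exists 0 => // s t _ _; rewrite subrr nrm0 mul0r. Qed.

Lemma loclipD u v : loclip u -> loclip v -> loclip (fun r => u r + v r).
Proof.
move=> lu lv T T0; have [K K0 HK] := lu T T0; have [N N0 HN] := lv T T0.
exists (K + N); first exact: addr_ge0.
move=> s t hs ht; rewrite opprD addrACA mulrDl.
by apply: le_trans (nrmD _ _ _) _; apply: lerD; [exact: HK|exact: HN].
Qed.

Lemma loclipN u : loclip u -> loclip (fun r => - u r).
Proof.
move=> lu T T0; have [K K0 HK] := lu T T0; exists K => // s t hs ht.
by rewrite -opprD nrmN; exact: HK.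
Qed.

Lemma loclipB u v : loclip u -> loclip v -> loclip (fun r => u r - v r).
Proof. by move=> lu /loclipN; exact: loclipD. Qed.

Definition lipschitz_map C B (L : R) := forall x y, C x -> C y ->
  nrm S (B x - B y) <= L * nrm S (x - y).

(** Gronwall: each inclusion is tested with the other solution, which bounds the
    derivative of the squared distance by [2 * L] times the squared distance. *)
Theorem strong_unique C B (L : R) u v : 0 <= L -> lipschitz_map C B L ->
  strong C B u -> strong C B v -> nrm S (u 0 - v 0) = 0 ->
  forall t, 0 <= t -> nrm S (u t - v t) = 0.
Proof.
move=> L0 BL [uC ul ua] [vC vl va] uv0 t t0.
pose d r := u r - v r.
pose g r := expR (- ((2 * L) * r)) * S (d r) (d r).
have dl : loclip d by exact: loclipB.
have : g t <= g 0.
  apply: ae_nonincreasing => //.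
    apply: lip_onM => //; first by apply: lip_on_expRN => //; apply: mulr_ge0.
    exact: lip_on_sip.
  apply: ae_impl2 ua va => r uD vD /andP[r0 rt].
  have [D uD1 uD2] := uD r0; have [D' vD1 vD2] := vD r0.
  have dD : tends S (0 : R)^' (quot d r) (D - D').
    by apply: tends_quotD => //; exact: tends_quotN.
  have h1 := is_derive_sip dD dD.
  have h2 : is_derive r (1 : R) (fun x : R => expR (- ((2 * L) * x))) (- (2 * L) * expR (- ((2 * L) * r))).
    by apply: is_derive_eq; rewrite /GRing.scale/=; ring.
  have h3 := is_deriveM h2 h1.
  eexists; split; first exact: h3.
  rewrite /GRing.scale/=.
  have r0' := ltW r0.
  have Hu := uD2 _ (vC r r0'); have Hv := vD2 _ (uC r r0').
  have Hl : S (B (u r) - B (v r)) (d r) <= L * S (d r) (d r).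
    apply: le_trans (sip_le _ _ _) _; rewrite -nrm_sq expr2 mulrA.
    by apply: ler_wpM2r; [exact: nrm_ge0|apply: BL; [exact: uC|exact: vC]].
  have key : S (D - D') (d r) <= L * S (d r) (d r).
    apply: le_trans Hl; move: Hu Hv; rewrite /d !sipE; lra.
  rewrite (sipC S (d r)).
  have := expR_gt0 (- (2 * L * r)); move: (expR _) => e e0.
  move: key; move: (S (D - D') (d r)) (S (d r) (d r)) => p q key.
  have : e * (p - L * q) <= 0 by rewrite pmulr_rle0//; lra.
  lra.
rewrite /g /d -!nrm_sq uv0 expr0n mulr0.
rewrite pmulr_rle0 ?expR_gt0// => h.
have : nrm S (u t - v t) ^+ 2 == 0 by rewrite eq_le h sqr_ge0.
by rewrite sqrf_eq0 => /eqP.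
Qed.

(** Strong solutions are insensitive to changes by vectors of norm zero. *)
Lemma strong_congr C B (L : R) u v : 0 <= L -> lipschitz_map C B L ->
  strong C B u -> (forall t, 0 <= t -> C (v t)) ->
  (forall t, 0 <= t -> nrm S (u t - v t) = 0) -> strong C B v.
Proof.
move=> L0 BL [uC ul ua] vC uv; split => //.
  move=> T T0; have [K K0 HK] := ul T T0; exists K => // s t hs ht.
  apply: le_trans (HK s t hs ht).
  apply: le_trans (nrm_tri _ _ (u s) _) _; rewrite nrmB uv ?add0r; last by case/andP: hs.
  apply: le_trans (nrm_tri _ _ (u t) _) _; rewrite uv ?addr0//; by case/andP: ht.
apply: ae_impl ua => t uD t0; have [D uD1 uD2] := uD t0; exists D.
  apply: (@tends_le _ _ _ _ _ _ _ _ (fun h => nrm S (quot u t h - D))) => //.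
  near=> h; have th : 0 <= t + h.
    have : `|h| < t by near: h; exact: dnbhs0_lt.
    by rewrite ltr_norml => /andP[]; lra.
  apply: le_trans (nrm_tri _ _ (quot u t h) _) _.
  rewrite gerDr /quot -scalerBr nrmZ.
  have -> : v (t + h) - v t - (u (t + h) - u t) = (v (t + h) - u (t + h)) + (u t - v t).
    by rewrite opprB addrACA [RHS]addrACA; congr (_ + _); rewrite addrC.
  have h1 : nrm S (v (t + h) - u (t + h)) = 0 by rewrite nrmB uv.
  have h2 : nrm S (u t - v t) = 0 by rewrite uv// ltW.
  have := nrmD S (v (t + h) - u (t + h)) (u t - v t); rewrite h1 h2 addr0.
  by move=> /nrm0_le ->; rewrite mulr0.
have t0' := ltW t0.
move=> w Cw; have := uD2 w Cw.
have h1 := uv t t0'.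
have h2 : nrm S (B (u t) - B (v t)) = 0.
  by apply: nrm0_le; apply: le_trans (BL _ _ (uC _ t0') (vC _ t0')) _; rewrite h1 mulr0.
by rewrite !sipE !(nrm0_sipr _ h1) !(nrm0_sipl _ h2).
Unshelve. all: by end_near. Qed.

Lemma quot_shift u t tau : quot (fun r => u (r + tau)) t = quot u (t + tau).
Proof. by apply/funext => h; rewrite /quot addrAC. Qed.

Lemma loclip_shift u tau : 0 <= tau -> loclip u -> loclip (fun r => u (r + tau)).
Proof.
move=> tau0 ul T T0; have [|K K0 HK] := ul (T + tau); first exact: addr_ge0.
exists K => // s t hs ht; have := HK (s + tau) (t + tau).
by rewrite opprD addrACA subrr addr0; apply; rewrite addr_ge0 ?lerD2r//=;
  case/andP: hs => // ? ?; case/andP: ht.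
Qed.

Lemma strong_shift C B u (tau : R) : 0 <= tau -> strong C B u ->
  strong C B (fun t => u (t + tau)).
Proof.
move=> tau0 [uC ul ua]; split; [|exact: loclip_shift|].
  by move=> t t0; apply: uC; exact: addr_ge0.
apply: ae_impl (ae_shift tau ua) => t H t0.
by have [|D D1 D2] := H; [exact: ltr_wpDr|exists D => //; rewrite quot_shift].
Qed.

End Evolution.

(** * Evolution in a convex set: the catching-up scheme *)

Lemma sqr_le_cancel (R : realType) (q c : R) : 0 <= q -> 0 <= c -> q * q <= c * q -> q <= c.
Proof.
move=> q0 c0 h; case: (eqVneq q 0) => [-> //|qn].
by rewrite -(@ler_pM2r _ q)// lt_neqAle eq_sym qn.
Qed.

Section Euler.
Context {R : realType} {E : lmodType R} (S : semi_inner E).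
Context (C : set E) (B : E -> E) (L : R) (u0 : E) (P : E -> E).
Hypothesis L0 : 0 <= L.
Hypothesis BL : lipschitz_map S C B L.
Hypothesis Cu0 : C u0.
Hypothesis PP : forall x, C (P x) /\ normal S C (P x) (x - P x).
Implicit Types (x y z w D : E) (u v : R -> E) (s t a b eta : R).
Local Notation N := (nrm S).

(** Moreau's catching-up scheme: move with velocity [B], then project back on the
    constraint. *)
Definition eul eta k := iter k (fun x => P (x + eta *: B x)) u0.

Lemma eulC eta k : C (eul eta k).
Proof. by case: k => [//|k] /=; have [] := PP (eul eta k + eta *: B (eul eta k)). Qed.

Lemma eul_step eta k w : C w ->
  S (eul eta k - eul eta k.+1 + eta *: B (eul eta k)) (w - eul eta k.+1) <= 0.
Proof.
move=> Cw; have [_ /(_ w Cw)] := PP (eul eta k + eta *: B (eul eta k)).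
by rewrite -/(eul eta k.+1) addrAC.
Qed.

Lemma eul_incr eta k : 0 <= eta -> N (eul eta k.+1 - eul eta k) <= eta * N (B (eul eta k)).
Proof.
move=> e0; have := eul_step eta k (eulC eta k).
move: (eul eta k) (eul eta k.+1) => x y; set b := B x => h.
rewrite nrmB; apply: sqr_le_cancel; rewrite ?nrm_ge0 ?mulr_ge0 ?nrm_ge0//.
rewrite -expr2 nrm_sq; move: h; rewrite sipDl sipZl => h.
have := sip_le S b (y - x); rewrite (nrmB _ y) => h2.
have : eta * S b (y - x) <= eta * (N b * N (x - y)) by apply: ler_wpM2l.
have -> : S b (y - x) = - S b (x - y) by rewrite -opprB sipNr.
lra.
Qed.

Lemma eul_speed eta k : 0 <= eta -> N (B (eul eta k)) <= (1 + eta * L) ^+ k * N (B u0).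
Proof.
move=> e0; elim: k => [|k IH]; first by rewrite expr0 mul1r.
rewrite exprS -mulrA; apply: (@le_trans _ _ ((1 + eta * L) * N (B (eul eta k)))); last first.
  by apply: ler_wpM2l => //; rewrite addr_ge0// mulr_ge0.
apply: le_trans (nrm_le_dist S _ (B (eul eta k))) _; rewrite mulrDl mul1r lerD2l.
apply: le_trans (BL (eulC _ _) (eulC _ _)) _.
rewrite -mulrA mulrCA; apply: ler_wpM2l => //; exact: eul_incr.
Qed.

Lemma pow_le_expR eta k : 0 <= eta -> (1 + eta * L) ^+ k <= expR (L * (eta * k%:R)).
Proof.
move=> e0; have -> : L * (eta * k%:R) = k%:R * (eta * L) by ring.
rewrite expRM_natl; apply: lerXn2r; rewrite ?nnegrE ?expR_ge0 ?addr_ge0 ?mulr_ge0//.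
exact: expR_ge1Dx.
Qed.

Section Horizon.
Context (T : R).
Hypothesis T0 : 0 <= T.

Definition speed := expR (L * T) * N (B u0).
Local Notation M := speed.

Lemma speed_ge0 : 0 <= M.
Proof. by rewrite mulr_ge0 ?expR_ge0 ?nrm_ge0. Qed.

Lemma eul_speed_le eta k : 0 <= eta -> eta * k%:R <= T -> N (B (eul eta k)) <= M.
Proof.
move=> e0 kT; apply: le_trans (eul_speed k e0) _.
apply: ler_wpM2r; first exact: nrm_ge0.
apply: le_trans (pow_le_expR k e0) _; rewrite ler_expR; exact: ler_wpM2l.
Qed.

Lemma eul_distD eta i n : 0 <= eta -> eta * (i + n)%:R <= T ->
  N (eul eta (i + n) - eul eta i) <= M * (eta * n%:R).
Proof.
move=> e0; elim: n => [|n IH] h; first by rewrite addn0 subrr nrm0 !mulr0.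
have h' : eta * (i + n)%:R <= T.
  by apply: le_trans h; apply: ler_wpM2l => //; rewrite ler_nat addnS.
apply: le_trans (nrm_tri _ _ (eul eta (i + n)) _) _.
have := IH h'; have := eul_incr (i + n) e0; rewrite -addnS => h1 h2.
have : eta * N (B (eul eta (i + n))) <= eta * M by apply: ler_wpM2l => //; exact: eul_speed_le.
rewrite -natr1 mulrDr mulrDr mulr1; lra.
Qed.

Lemma eul_dist eta i j : 0 <= eta -> eta * i%:R <= T -> eta * j%:R <= T ->
  N (eul eta j - eul eta i) <= M * `|eta * j%:R - eta * i%:R|.
Proof.
move=> e0; wlog ij : i j / (i <= j)%N.
  move=> W hi hj; case: (leqP i j) => ij; first exact: W.
  by rewrite nrmB distrC; apply: W => //; exact: ltnW.
move=> _ hj; have := @eul_distD eta i (j - i) e0; rewrite subnKC// => /(_ hj) h.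
apply: le_trans h _; rewrite -mulrBr -natrB// ger0_norm// mulr_ge0//.
Qed.

(** The discrete form of the variational inequality, over several steps at
    once; the base point of the test vector is the endpoint. *)
Lemma eul_evi eta i n w : 0 <= eta -> C w -> eta * (i + n)%:R <= T ->
  S (eul eta (i + n) - eul eta i - (eta * n%:R) *: B (eul eta i)) (eul eta (i + n) - w)
  <= (eta * n%:R) ^+ 2 * (2 * M ^+ 2 + L * M * N (eul eta (i + n) - w)).
Proof.
move=> e0 Cw hT; set z := eul eta (i + n); set h := eta * n%:R.
have h0 : 0 <= h by rewrite mulr_ge0.
have M0 := speed_ge0.
suff : forall k, (k <= n)%N ->
  S (eul eta (i + k) - eul eta i - (eta * k%:R) *: B (eul eta i)) (z - w)
  <= k%:R * (eta * h * (2 * M ^+ 2 + L * M * N (z - w))).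
  move=> /(_ n (leqnn n)) H; apply: le_trans H _.
  by rewrite le_eqVlt; apply/orP; left; apply/eqP; rewrite /h; ring.
elim=> [|k IH] kn; first by rewrite addn0 subrr mulr0 scale0r subrr sip0l mul0r.
have ikT : eta * (i + k)%:R <= T.
  by apply: le_trans hT; apply: ler_wpM2l => //; rewrite ler_nat leq_add2l ltnW.
have ikST : eta * (i + k.+1)%:R <= T.
  by apply: le_trans hT; apply: ler_wpM2l => //; rewrite ler_nat leq_add2l.
have {}IH := IH (ltnW kn).
have st := eul_step eta (i + k) Cw; rewrite -addnS in st.
set x := eul eta (i + k) in IH st *; set y := eul eta (i + k.+1) in st *.
set c := eul eta i in IH *.
have nxy : N (y - x) <= eta * M.
  rewrite /y addnS; apply: le_trans (eul_incr _ e0) _.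
  by apply: ler_wpM2l => //; exact: eul_speed_le.
have nBx : N (B x) <= M by exact: eul_speed_le.
have nzy : N (z - y) <= M * h.
  apply: le_trans (eul_dist e0 ikST hT) _.
  apply: ler_wpM2l => //; rewrite -mulrBr -natrB ?leq_add2l// subnDl ger0_norm ?mulr_ge0//.
  by apply: ler_wpM2l => //; rewrite ler_nat leq_subr.
have nxc : N (B x - B c) <= L * (M * h).
  apply: le_trans (BL (eulC _ _) (eulC _ _)) _; apply: ler_wpM2l => //.
  apply: le_trans (eul_distD e0 ikT) _.
  by apply: ler_wpM2l => //; apply: ler_wpM2l => //; rewrite ler_nat ltnW.
have -> : S (y - c - (eta * k.+1%:R) *: B c) (z - w) =
  S (x - c - (eta * k%:R) *: B c) (z - w) - S (x - y + eta *: B x) (z - w)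
  + S (eta *: (B x - B c)) (z - w) by rewrite -natr1 !sipE; ring.
have e1 : - S (x - y + eta *: B x) (z - w) <= eta * h * (2 * M ^+ 2).
  have -> : z - w = (y - w) + (z - y) by rewrite [RHS]addrC subrKA.
  rewrite sipDr opprD.
  have -> : - S (x - y + eta *: B x) (y - w) = S (x - y + eta *: B x) (w - y) by rewrite -sipNr opprB.
  have : - S (x - y + eta *: B x) (z - y) <= (2 * (eta * M)) * (M * h).
    rewrite -sipNr; apply: le_trans (sip_le _ _ _) _; rewrite nrmN.
    apply: ler_pM; rewrite ?nrm_ge0//.
    apply: le_trans (nrmD _ _ _) _; rewrite nrmB nrmZ ger0_norm//.
    have : eta * N (B x) <= eta * M by exact: ler_wpM2l.
    lra.
  have -> : eta * h * (2 * M ^+ 2) = (2 * (eta * M)) * (M * h) by ring.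
  lra.
have e2 : S (eta *: (B x - B c)) (z - w) <= eta * h * (L * M * N (z - w)).
  have -> : eta * h * (L * M * N (z - w)) = eta * ((L * (M * h)) * N (z - w)) by ring.
  rewrite sipZl; apply: ler_wpM2l => //; apply: le_trans (sip_le _ _ _) _.
  by apply: ler_wpM2r => //; exact: nrm_ge0.
have -> : k.+1%:R * (eta * h * (2 * M ^+ 2 + L * M * N (z - w))) =
  k%:R * (eta * h * (2 * M ^+ 2 + L * M * N (z - w))) + eta * h * (2 * M ^+ 2) +
  eta * h * (L * M * N (z - w)) by rewrite -natr1; ring.
by apply: lerD => //; apply: lerD.
Qed.

(** One step of length [h] against [n] steps of length [h / n]: the square of
    the distance grows by a factor [1 + O(h)] plus [O(h ^ 2)]. *)
Lemma eul_compare_step eta n k : 0 <= eta -> eta * n%:R <= 1 ->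
  (eta * n%:R) * k.+1%:R <= T ->
  N (eul (eta * n%:R) k.+1 - eul eta (k.+1 * n)) ^+ 2 <=
  expR ((1 + 2 * L) * (eta * n%:R)) * N (eul (eta * n%:R) k - eul eta (k * n)) ^+ 2
  + (2 * L ^+ 2 * M ^+ 2 + 4 * M ^+ 2) * (eta * n%:R) ^+ 2.
Proof.
move=> e0 h1 hT; set h := eta * n%:R in h1 hT *.
have M0 := speed_ge0.
have h0 : 0 <= h by rewrite mulr_ge0.
have kT : eta * (k * n + n)%:R <= T.
  by apply: le_trans hT; rewrite -mulSnr natrM /h le_eqVlt; apply/orP; left; apply/eqP; ring.
have ev := @eul_evi eta (k * n) n (eul h k.+1) e0 (eulC _ _) kT.
have st := eul_step h k (eulC eta (k * n + n)).
rewrite mulSnr; rewrite -/h in ev.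
set a := eul h k in st *; set a' := eul h k.+1 in ev st *.
set c := eul eta (k * n) in ev *; set c' := eul eta (k * n + n) in ev st *.
have lip : S (B a - B c) (a' - c') <= L * N (a - c) * N (a' - c').
  apply: le_trans (sip_le _ _ _) _; apply: ler_wpM2r; first exact: nrm_ge0.
  by apply: BL; exact: eulC.
have cs := sip_le S (a - c) (a' - c').
have y0 := nrm_ge0 S (a - c); have x0 := nrm_ge0 S (a' - c').
rewrite (nrmB _ c') in ev.
have key : N (a' - c') ^+ 2 <= S (a - c) (a' - c') + h * S (B a - B c) (a' - c') +
   h ^+ 2 * (2 * M ^+ 2 + L * M * N (a' - c')).
  rewrite nrm_sq; apply: le_trans (_ : _ <= S (a - c) (a' - c') + h * S (B a - B c) (a' - c')
    + (S (c' - c - h *: B c) (c' - a') + S (a - a' + h *: B a) (c' - a'))) _; last first.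
    by rewrite lerD2l; lra.
  rewrite le_eqVlt; apply/orP; left; apply/eqP.
  by rewrite !sipE; ring.
have {ev st} {}key : N (a' - c') ^+ 2 <= ((1 + h * L) * N (a - c) + h ^+ 2 * (L * M)) * N (a' - c')
   + 2 * M ^+ 2 * h ^+ 2.
  have : h * S (B a - B c) (a' - c') <= h * (L * N (a - c) * N (a' - c')) by apply: ler_wpM2l.
  move: key cs; move: (S (a - c) (a' - c')) (S (B a - B c) (a' - c')) (N (a' - c')) (N (a - c)) => p q x y.
  by move: M (h) => m h'; lra.
have ex1 : (1 + h) * (1 + h * L) ^+ 2 <= expR ((1 + 2 * L) * h).
  have -> : (1 + 2 * L) * h = h + 2%:R * (h * L) by ring.
  rewrite expRD expRM_natl; apply: ler_pM; rewrite ?sqr_ge0 ?addr_ge0//.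
    exact: expR_ge1Dx.
  by apply: lerXn2r; rewrite ?nnegrE ?expR_ge0 ?addr_ge0 ?mulr_ge0//; exact: expR_ge1Dx.
move: key ex1; move: (N (a' - c')) (N (a - c)) x0 y0 (expR _) => x y x0 y0 e key ex1.
have q : x ^+ 2 <= ((1 + h * L) * y + h ^+ 2 * (L * M)) ^+ 2 + 4 * M ^+ 2 * h ^+ 2.
  have := sqr_ge0 (x - ((1 + h * L) * y + h ^+ 2 * (L * M))); rewrite sqrrB; lra.
have q2 : ((1 + h * L) * y + h ^+ 2 * (L * M)) ^+ 2 <=
    (1 + h) * (1 + h * L) ^+ 2 * y ^+ 2 + 2 * L ^+ 2 * M ^+ 2 * h ^+ 2.
  have [->|hn] := eqVneq h 0; first by rewrite expr0n/= !mul0r !mulr0 !addr0; lra.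
  have hp : 0 < h by rewrite lt_neqAle eq_sym hn.
  have : 0 <= h * ((1 + h * L) * y - h * (L * M)) ^+ 2 by rewrite mulr_ge0 ?sqr_ge0.
  have : 0 <= (1 - h) * (L * M * h) ^+ 2 by rewrite mulr_ge0 ?sqr_ge0 ?subr_ge0.
  have : 0 <= (1 - h ^+ 2) * (L * M * h) ^+ 2.
    by rewrite mulr_ge0 ?sqr_ge0// subr_ge0 expr_le1.
  nra.
have q3 : (1 + h) * (1 + h * L) ^+ 2 * y ^+ 2 <= e * y ^+ 2 by apply: ler_wpM2r => //; exact: sqr_ge0.
lra.
Qed.

Definition mesh_const := T * (2 * L ^+ 2 * M ^+ 2 + 4 * M ^+ 2) * expR ((1 + 2 * L) * T).

Lemma mesh_const_ge0 : 0 <= mesh_const.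
Proof.
rewrite /mesh_const; apply: mulr_ge0; last exact: expR_ge0.
apply: mulr_ge0 => //; rewrite -mulrA -exprMn.
by have := sqr_ge0 (L * M); have := sqr_ge0 M; lra.
Qed.

(** The one-step comparisons add up by a discrete Gronwall argument. *)
Lemma eul_compare eta n k : 0 <= eta -> eta * n%:R <= 1 -> (eta * n%:R) * k%:R <= T ->
  N (eul (eta * n%:R) k - eul eta (k * n)) ^+ 2 <= mesh_const * (eta * n%:R).
Proof.
move=> e0 h1 hT; set h := eta * n%:R in h1 hT *.
have h0 : 0 <= h by rewrite mulr_ge0.
set K := 2 * L ^+ 2 * M ^+ 2 + 4 * M ^+ 2.
have K0 : 0 <= K.
  by rewrite /K -mulrA -exprMn; have := sqr_ge0 (L * M); have := sqr_ge0 M; lra.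
set e := expR ((1 + 2 * L) * h).
have e1 : 1 <= e by rewrite -expR0 ler_expR mulr_ge0// addr_ge0// mulr_ge0.
have H : N (eul h k - eul eta (k * n)) ^+ 2 <= k%:R * (K * h ^+ 2) * e ^+ k.
  elim: k hT => [|k IH] hT; first by rewrite mul0n subrr nrm0 expr0n !mul0r.
  have hT' : h * k%:R <= T by apply: le_trans hT; apply: ler_wpM2l => //; rewrite ler_nat.
  have IH' := IH hT'.
  apply: le_trans (eul_compare_step e0 h1 hT) _; rewrite -/h -/K -/e.
  have f1 : 1 <= e ^+ k.+1 by exact: exprn_ege1.
  have f2 : e * N (eul h k - eul eta (k * n)) ^+ 2 <= e * (k%:R * (K * h ^+ 2) * e ^+ k).
    by apply: ler_wpM2l => //; exact: le_trans ler01 e1.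
  have f3 : K * h ^+ 2 * 1 <= K * h ^+ 2 * e ^+ k.+1.
    by apply: ler_wpM2l => //; rewrite mulr_ge0 ?sqr_ge0.
  have -> : k.+1%:R * (K * h ^+ 2) * e ^+ k.+1 =
    e * (k%:R * (K * h ^+ 2) * e ^+ k) + K * h ^+ 2 * e ^+ k.+1 by rewrite -natr1 (exprS e); ring.
  by rewrite mulr1 in f3; exact: lerD.
apply: le_trans H _; rewrite /mesh_const -/K.
have ek : e ^+ k <= expR ((1 + 2 * L) * T).
  rewrite -expRM_natl ler_expR mulrCA; apply: ler_wpM2l; first by rewrite addr_ge0// mulr_ge0.
  by rewrite mulrC.
have -> : T * K * expR ((1 + 2 * L) * T) * h = (T * (K * h)) * expR ((1 + 2 * L) * T) by ring.
apply: ler_pM => //.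
- by rewrite !mulr_ge0 ?sqr_ge0.
- by apply: exprn_ge0; exact: le_trans ler01 e1.
- have -> : k%:R * (K * h ^+ 2) = h * k%:R * (K * h) by ring.
  by apply: ler_wpM2r => //; exact: mulr_ge0.
Qed.

End Horizon.
End Euler.

(** * Evolution in a convex set: the limit of the scheme *)

Section EulerLimit.
Context {R : realType} {E : lmodType R} (S : semi_inner E).
Context (C : set E) (B : E -> E) (L : R) (u0 : E) (P : E -> E).
Hypothesis L0 : 0 <= L.
Hypothesis BL : lipschitz_map S C B L.
Hypothesis Cu0 : C u0.
Hypothesis PP : forall x, C (P x) /\ normal S C (P x) (x - P x).
Implicit Types (x y z w D : E) (v : R -> E) (s t a b eta T : R).
Local Notation N := (nrm S).
Local Notation eul := (eul B u0 P).
Local Notation M := (speed S B L u0).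

Definition mesh n : R := 2^-1 ^+ n.

Lemma mesh_gt0 n : 0 < mesh n. Proof. by rewrite exprn_gt0. Qed.
Lemma mesh_le1 n : mesh n <= 1.
Proof. by rewrite exprn_ile1//; lra. Qed.
Lemma mesh_cvg : mesh n @[n --> \oo] --> (0 : R).
Proof. by apply: cvg_expr; rewrite ger0_norm//; lra. Qed.
Lemma mesh_refine n m : (n <= m)%N -> mesh m * (2 ^ (m - n))%:R = mesh n.
Proof.
move=> nm; rewrite /mesh -{1}(subnK nm) exprD mulrAC natrX -exprMn mulVf ?expr1n ?mul1r//.
Qed.

Lemma mesh_le_mesh n m : (n <= m)%N -> mesh m <= mesh n.
Proof. by move=> nm; apply: ler_wiXn2l => //; lra. Qed.

Definition idx n t := Num.truncn (t / mesh n).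
Definition grid n t := mesh n * (idx n t)%:R.

Lemma grid_itv n t : 0 <= t -> grid n t <= t < grid n t + mesh n.
Proof.
move=> t0; have := @truncn_itv R (t / mesh n).
rewrite divr_ge0 ?(ltW (mesh_gt0 n))// => /(_ isT) /andP[h1 h2].
rewrite /grid mulrC -ler_pdivlMr ?mesh_gt0// h1/=.
by rewrite -[X in _ + X]mul1r -mulrDl natr1 -ltr_pdivrMr ?mesh_gt0.
Qed.

Lemma idx_le n s t : s <= t -> (idx n s <= idx n t)%N.
Proof.
move=> st; apply: le_truncn; apply: ler_wpM2r => //.
by rewrite invr_ge0 ltW ?mesh_gt0.
Qed.

Lemma grid_cvg t : 0 <= t -> grid n t @[n --> \oo] --> t.
Proof.
move=> t0; apply: (@squeeze_cvgr _ _ _ _ (fun n => t - mesh n) (cst t)) => //.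
- by near=> n; have /andP[h1 h2] := grid_itv n t0; apply/andP; split => //; lra.
- rewrite -[X in _ --> X]subr0; apply: cvgB; [exact: cvg_cst|exact: mesh_cvg].
- exact: cvg_cst.
Unshelve. all: by end_near. Qed.

Definition euler_at n t := eul (mesh n) (idx n t).

Lemma approx_refine T n m t : (n <= m)%N -> 0 <= t <= T ->
  N (euler_at n t - euler_at m t) <= Num.sqrt (mesh_const S B L u0 T * mesh n) + M T * mesh n.
Proof.
move=> nm /andP[t0 tT].
have T0 : 0 <= T by exact: le_trans t0 tT.
have /andP[g1 g2] := grid_itv n t0; have /andP[g3 g4] := grid_itv m t0.
have mm := mesh_gt0 m; have mn := mesh_gt0 n.
apply: le_trans (nrm_tri _ _ (eul (mesh m) (idx n t * 2 ^ (m - n))) _) _; apply: lerD.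
  rewrite -(ger0_norm (nrm_ge0 _ _)) -sqrtr_sqr ler_sqrt; last first.
    by rewrite mulr_ge0 ?mesh_const_ge0// ltW.
  rewrite /euler_at -(mesh_refine nm); apply: (eul_compare L0 BL Cu0 PP (ltW mm));
    rewrite (mesh_refine nm) ?mesh_le1//; exact: le_trans g1 tT.
rewrite nrmB.
have hk : mesh m * (idx n t * 2 ^ (m - n))%:R = grid n t.
  by rewrite natrM mulrCA mulrC mesh_refine// mulrC.
apply: le_trans (eul_dist (T := T) L0 BL Cu0 PP (ltW mm) _ _) _.
- by rewrite hk; exact: le_trans g1 tT.
- by rewrite -/(grid m t); exact: le_trans g3 tT.
rewrite hk -/(grid m t); apply: ler_wpM2l; first exact: speed_ge0.
by rewrite ler_norml; apply/andP; split; have := mesh_le_mesh nm; lra.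
Qed.

Lemma refine_bound_cvg T :
  Num.sqrt (mesh_const S B L u0 T * mesh n) + M T * mesh n @[n --> \oo] --> (0 : R).
Proof.
rewrite -[X in _ --> X]addr0; apply: cvgD.
  rewrite -[X in _ --> X]sqrtr0 -[in X in _ --> X](mulr0 (mesh_const S B L u0 T)).
  apply: (@cvg_comp _ _ _ (fun n => mesh_const S B L u0 T * mesh n) Num.sqrt); last exact: sqrt_continuous.
  by apply: cvgM; [exact: cvg_cst|exact: mesh_cvg].
rewrite -[X in _ --> X](mulr0 (M T)).
by apply: cvgM; [exact: cvg_cst|exact: mesh_cvg].
Qed.

Lemma approx_cauchy t : 0 <= t -> ncauchy S (euler_at^~ t).
Proof.
move=> t0 e e0.
have e20 : 0 < e / 2 by lra.
have /cvgrPdist_le/(_ _ e20) [K _ KP] := refine_bound_cvg t.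
have H n : (K <= n)%N -> N (euler_at n t - euler_at K t) <= e / 2.
  move=> Kn; rewrite nrmB; apply: le_trans (@approx_refine t K n t Kn _) _.
    by rewrite t0 lexx.
  have := KP K (leqnn K); rewrite /= sub0r normrN; exact: le_trans (ler_norm _).
exists K => m n Km Kn; apply: le_trans (nrm_tri _ _ (euler_at K t) _) _.
by rewrite [X in _ + X]nrmB; have := H _ Km; have := H _ Kn; lra.
Qed.

Context (u : R -> E).
Hypothesis uP : forall t, 0 <= t -> C (u t) /\ tends S \oo (euler_at^~ t) (u t).

(** The scheme is equicontinuous, so nodes may be chosen freely within a bounded
    number of steps from [t]. *)
Lemma euler_limit t (c : R) (k : nat -> nat) : 0 <= t -> 0 <= c ->
  (forall n, `|mesh n * (k n)%:R - t| <= c * mesh n) ->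
  tends S \oo (fun n => eul (mesh n) (k n)) (u t).
Proof.
move=> t0 c0 kP.
have [_ /tendsP ut] := uP t0.
have T0 : 0 <= t + c by exact: addr_ge0.
have M0 : 0 <= M (t + c) by exact: speed_ge0.
apply: (@tends_le _ _ _ _ _ _ _ _ (fun n => M (t + c) * ((c + 1) * mesh n) + N (euler_at n t - u t))).
  near=> n; apply: le_trans (nrm_tri _ _ (euler_at n t) _) _; rewrite lerD2r.
  have /andP[g1 g2] := grid_itv n t0; have := kP n; rewrite ler_norml => /andP[k1 k2].
  have mm := mesh_gt0 n.
  have cm : c * mesh n <= c by rewrite -[leRHS]mulr1; apply: ler_wpM2l => //; exact: mesh_le1.
  rewrite /euler_at; apply: le_trans (eul_dist (T := t + c) L0 BL Cu0 PP (ltW mm) _ _) _.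
  - by rewrite -/(grid n t); lra.
  - by lra.
  rewrite -/(grid n t); apply: ler_wpM2l => //; rewrite ler_norml; apply/andP; split; lra.
rewrite -[X in _ --> X]addr0; apply: cvgD; last by have [] := uP t0.
rewrite -[X in _ --> X](mulr0 (M (t + c))); apply: cvgM; first exact: cvg_cst.
rewrite -[X in _ --> X](mulr0 (c + 1)); apply: cvgM; [exact: cvg_cst|exact: mesh_cvg].
Unshelve. all: by end_near. Qed.

Lemma limit_start : N (u 0 - u0) = 0.
Proof.
apply: (@tends_unique _ _ _ _ \oo _ (euler_at^~ 0)); first by have [] := uP (lexx 0).
apply: (@tends_le _ _ _ _ _ _ _ _ (cst 0)); last exact: cvg_cst.
by near=> n; rewrite /euler_at /idx mul0r truncn0 /= subrr nrm0.
Unshelve. all: by end_near. Qed.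

Lemma limit_lip T s t : 0 <= s <= T -> 0 <= t <= T -> N (u s - u t) <= M T * `|s - t|.
Proof.
move=> /andP[s0 sT] /andP[t0 tT]; have T0 : 0 <= T by lra.
have [_ us] := uP s0; have [_ ut] := uP t0.
have h1 : N (euler_at n s - euler_at n t) @[n --> \oo] --> N (u s - u t).
  by apply: tends_nrm; exact: tendsB.
have h2 : M T * `|grid n s - grid n t| @[n --> \oo] --> M T * `|s - t|.
  by apply: cvgM; [exact: cvg_cst|apply: cvg_norm; apply: cvgB; exact: grid_cvg].
apply: (ler_cvg_to h1 h2); near=> n.
have /andP[g1 g2] := grid_itv n t0; have /andP[g3 g4] := grid_itv n s0.
apply: (eul_dist (T := T) L0 BL Cu0 PP (ltW (mesh_gt0 n))).
- exact: le_trans g1 tT.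
- exact: le_trans g3 sT.
Unshelve. all: by end_near. Qed.

Lemma tends_lipschitz (f : nat -> E) y : (forall n, C (f n)) -> C y ->
  tends S \oo f y -> tends S \oo (fun n => B (f n)) (B y).
Proof.
move=> Cf Cy fy; apply: (@tends_le _ _ _ _ _ _ _ _ (fun n => L * N (f n - y))).
  by near=> n; exact: BL.
rewrite -[X in _ --> X](mulr0 L); apply: cvgM => //; exact: cvg_cst.
Unshelve. all: by end_near. Qed.

Lemma tends_scale (a_ : nat -> R) (f : nat -> E) a y : a_ n @[n --> \oo] --> a ->
  tends S \oo f y -> tends S \oo (fun n => a_ n *: f n) (a *: y).
Proof.
move=> aa fy.
apply: (@tends_le _ _ _ _ _ _ _ _ (fun n => `|a_ n - a| * N (f n) + `|a| * N (f n - y))).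
  near=> n; rewrite -!nrmZ; apply: le_trans (nrmD _ _ _).
  by rewrite scalerBl scalerBr subrKA.
rewrite -[X in _ --> X]addr0; apply: cvgD; last first.
  by rewrite -[X in _ --> X](mulr0 `|a|); apply: cvgM => //; exact: cvg_cst.
rewrite -[X in _ --> X](mul0r (N y)); apply: cvgM; last exact: tends_nrm.
by rewrite -[X in _ --> X](normr0 R) -(subrr a); apply: cvg_norm; apply: cvgB => //; exact: cvg_cst.
Unshelve. all: by end_near. Qed.

Lemma limit_evi T s t w : 0 <= s -> s <= t -> t <= T -> C w ->
  S (u t - u s - (t - s) *: B (u s)) (u t - w) <=
  (t - s) ^+ 2 * (2 * M T ^+ 2 + L * M T * N (u t - w)).
Proof.
move=> s0 st tT Cw; have t0 : 0 <= t by lra. have T0 : 0 <= T by lra.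
have [Cs us] := uP s0; have [Ct ut] := uP t0.
have hg : grid n t - grid n s @[n --> \oo] --> t - s by apply: cvgB; exact: grid_cvg.
have Bu : tends S \oo (fun n => B (euler_at n s)) (B (u s)).
  by apply: tends_lipschitz => // n; exact: (eulC B Cu0 PP).
have h1 : S (euler_at n t - euler_at n s - (grid n t - grid n s) *: B (euler_at n s)) (euler_at n t - w)
   @[n --> \oo] --> S (u t - u s - (t - s) *: B (u s)) (u t - w).
  apply: tends_sip; last by apply: tendsB => //; exact: tends_cst.
  by apply: tendsB; [exact: tendsB|exact: tends_scale].
have h2 : (grid n t - grid n s) ^+ 2 * (2 * M T ^+ 2 + L * M T * N (euler_at n t - w))
   @[n --> \oo] --> (t - s) ^+ 2 * (2 * M T ^+ 2 + L * M T * N (u t - w)).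
  apply: cvgM; first by rewrite expr2; under eq_fun do rewrite expr2; exact: cvgM.
  apply: cvgD; first exact: cvg_cst.
  apply: cvgM; first exact: cvg_cst.
  by apply: tends_nrm; apply: tendsB => //; exact: tends_cst.
apply: (ler_cvg_to h1 h2); near=> n.
have /andP[g1 g2] := grid_itv n t0.
have gE : grid n t - grid n s = mesh n * (idx n t - idx n s)%:R.
  by rewrite natrB ?idx_le// mulrBr.
rewrite gE /euler_at -(subnKC (idx_le n st)) [in eul _ _](subnKC (idx_le n st)).
have := @eul_evi _ _ S C B L u0 P L0 BL Cu0 PP T (mesh n) (idx n s) (idx n t - idx n s) w.
rewrite (subnKC (idx_le n st)) => ->//.
- exact/ltW/mesh_gt0.
- exact: le_trans g1 tT.
Unshelve. all: by end_near. Qed.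

(** Along any velocity [v] for which [B (u s) - v] is normal at [u s], the
    motion is not faster than [v], up to an exponential factor. *)
Lemma limit_speed s t (v : E) : 0 <= s -> s <= t -> normal S C (u s) (B (u s) - v) ->
  N (u t - u s) <= (t - s) * N v * expR (L * (t - s)).
Proof.
move=> s0 st nv; have t0 : 0 <= t by lra.
have [Cs us] := uP s0; have [Ct ut] := uP t0.
have step eta i k : 0 <= eta -> N (eul eta (i + k) - u s) <=
    (1 + eta * L) ^+ k * (N (eul eta i - u s) + (eta * k%:R) * N v).
  move=> e0; elim: k => [|k IH]; first by rewrite addn0 expr0 mul1r mulr0 mul0r addr0.
  have c1 : 1 <= 1 + eta * L by rewrite lerDl mulr_ge0.
  have c1k : 1 <= (1 + eta * L) ^+ k by exact: exprn_ege1.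
  have := eul_step B u0 PP eta (i + k) Cs; rewrite -addnS.
  have := nv _ (eulC B Cu0 PP eta (i + k.+1)).
  have := BL (eulC B Cu0 PP eta (i + k)) Cs.
  move: (eul eta (i + k)) (eul eta (i + k.+1)) IH => y x IH hB h1 h2.
  have key : N (x - u s) <= (1 + eta * L) * N (y - u s) + eta * N v.
    apply: sqr_le_cancel; rewrite ?nrm_ge0// ?addr_ge0 ?mulr_ge0 ?nrm_ge0//.
      exact: le_trans ler01 c1.
    rewrite -expr2 nrm_sq.
    have f1 := sip_le S (y - u s) (x - u s).
    have f2 : eta * S (B y - B (u s)) (x - u s) <= eta * (L * N (y - u s) * N (x - u s)).
      apply: ler_wpM2l => //; apply: le_trans (sip_le _ _ _) _.
      by apply: ler_wpM2r => //; exact: nrm_ge0.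
    have f3 : eta * S v (x - u s) <= eta * (N v * N (x - u s)).
      by apply: ler_wpM2l => //; exact: sip_le.
    have f4 : eta * S (B (u s) - v) (x - u s) <= 0 by rewrite mulr_ge0_le0.
    have e1 : S (x - u s) (x - u s) = S (y - u s) (x - u s) + S (y - x + eta *: B y) (u s - x)
      + eta * S (B y - B (u s)) (x - u s) + eta * S (B (u s) - v) (x - u s) + eta * S v (x - u s).
      by rewrite !sipE; ring.
    rewrite e1.
    move: f1 f2 f3 f4 h2; move: (S _ _) (S _ _) (S _ _) (S _ _) (S _ _) => A1 A2 A3 A4 A5; lra.
  apply: le_trans key _; rewrite exprS.
  have f1 : (1 + eta * L) * N (y - u s) <=
    (1 + eta * L) * ((1 + eta * L) ^+ k * (N (eul eta i - u s) + eta * k%:R * N v)).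
    by apply: ler_wpM2l => //; exact: le_trans ler01 c1.
  have f2 : 1 * (eta * N v) <= ((1 + eta * L) * (1 + eta * L) ^+ k) * (eta * N v).
    by apply: ler_wpM2r; [rewrite mulr_ge0 ?nrm_ge0|rewrite -exprS; exact: exprn_ege1].
  have -> : eta * k.+1%:R * N v = eta * k%:R * N v + eta * N v by rewrite -natr1; ring.
  move: f1 f2.
  by move: ((1 + eta * L) ^+ k) (N (eul eta i - u s)) (eta * k%:R * N v) (N (y - _)) (eta * N v) => p q r r' r''; lra.
have hg : grid n t - grid n s @[n --> \oo] --> t - s by apply: cvgB; exact: grid_cvg.
have h1 : N (euler_at n t - u s) @[n --> \oo] --> N (u t - u s).
  by apply: tends_nrm; apply: tendsB => //; exact: tends_cst.
have h2 : expR (L * (grid n t - grid n s)) * (N (euler_at n s - u s) + (grid n t - grid n s) * N v)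
   @[n --> \oo] --> expR (L * (t - s)) * (0 + (t - s) * N v).
  apply: cvgM.
    apply: (@cvg_comp _ _ _ (fun n => L * (grid n t - grid n s)) expR); last exact: continuous_expR.
    by apply: cvgM => //; exact: cvg_cst.
  by apply: cvgD => //; apply: cvgM => //; exact: cvg_cst.
rewrite mulrC -[X in _ * X]add0r; apply: (ler_cvg_to h1 h2); near=> n.
have gE : grid n t - grid n s = mesh n * (idx n t - idx n s)%:R.
  by rewrite natrB ?idx_le// mulrBr.
rewrite gE /euler_at; have := step (mesh n) (idx n s) (idx n t - idx n s)%N (ltW (mesh_gt0 n)).
rewrite subnKC ?idx_le// => /le_trans; apply; apply: ler_wpM2r.
  by rewrite addr_ge0 ?nrm_ge0// mulr_ge0 ?nrm_ge0// mulr_ge0// ltW// mesh_gt0.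
by apply: pow_le_expR => //; rewrite ltW// mesh_gt0.
Unshelve. all: by end_near. Qed.

(** Two copies of the scheme that start at different points separate at an exponential
    rate, and the scheme started at its own node near [s + h] is a shift of itself. *)
Lemma limit_contract s t h : 0 <= s -> s <= t -> 0 <= h ->
  N (u (t + h) - u t) <= expR (L * (t - s)) * N (u (s + h) - u s).
Proof.
move=> s0 st h0; have t0 : 0 <= t by lra.
have sh0 : 0 <= s + h by lra. have th0 : 0 <= t + h by lra.
have step eta i j k : 0 <= eta ->
    N (eul eta (j + k) - eul eta (i + k)) <= (1 + eta * L) ^+ k * N (eul eta j - eul eta i).
  move=> e0; elim: k => [|k IH]; first by rewrite !addn0 expr0 mul1r.
  have h1 := eul_step B u0 PP eta (i + k) (eulC B Cu0 PP eta (j + k.+1)).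
  have h2 := eul_step B u0 PP eta (j + k) (eulC B Cu0 PP eta (i + k.+1)).
  move: h1 h2; rewrite -!addnS.
  have := BL (eulC B Cu0 PP eta (j + k)) (eulC B Cu0 PP eta (i + k)).
  move: (eul eta (i + k)) (eul eta (i + k.+1)) (eul eta (j + k)) (eul eta (j + k.+1)) IH => a a' b b' IH hB h1 h2.
  have c1 : 0 <= 1 + eta * L by rewrite addr_ge0 ?mulr_ge0.
  apply: (@le_trans _ _ ((1 + eta * L) * N (b - a))); last first.
    by rewrite exprS -mulrA; apply: ler_wpM2l.
  apply: sqr_le_cancel; rewrite ?nrm_ge0 ?mulr_ge0 ?nrm_ge0//.
  rewrite -expr2 nrm_sq.
  have f1 := sip_le S (b - a) (b' - a').
  have f2 : eta * S (B b - B a) (b' - a') <= eta * (L * N (b - a) * N (b' - a')).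
    apply: ler_wpM2l => //; apply: le_trans (sip_le _ _ _) _.
    by apply: ler_wpM2r => //; exact: nrm_ge0.
  have e1 : S (b' - a') (b' - a') = S (b - a) (b' - a') + eta * S (B b - B a) (b' - a')
     + S (a - a' + eta *: B a) (b' - a') + S (b - b' + eta *: B b) (a' - b') by rewrite !sipE; ring.
  rewrite e1; move: f1 f2 h1 h2; move: (S _ _) (S _ _) (S _ _) (S _ _) => A1 A2 A3 A4; lra.
have hg : grid n t - grid n s @[n --> \oo] --> t - s by apply: cvgB; exact: grid_cvg.
have idxB n : (idx n t = idx n s + (idx n t - idx n s))%N by rewrite subnKC ?idx_le.
have k1 : tends S \oo (fun n => eul (mesh n) (idx n (s + h) + (idx n t - idx n s))) (u (t + h)).
  apply: (@euler_limit (t + h) 2) => // n.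
  have -> : mesh n * (idx n (s + h) + (idx n t - idx n s))%:R = grid n (s + h) + (grid n t - grid n s).
    by rewrite natrD natrB ?idx_le// mulrDr mulrBr.
  have /andP[] := grid_itv n t0; have /andP[] := grid_itv n s0; have /andP[] := grid_itv n sh0.
  have := mesh_gt0 n; rewrite ler_norml => *; apply/andP; split; lra.
have [_ ut] := uP t0; have [_ us] := uP s0; have [_ ush] := uP sh0.
have h1 : N (eul (mesh n) (idx n (s + h) + (idx n t - idx n s)) - euler_at n t) @[n --> \oo]
   --> N (u (t + h) - u t) by apply: tends_nrm; exact: tendsB.
have h2 : expR (L * (grid n t - grid n s)) * N (euler_at n (s + h) - euler_at n s)
   @[n --> \oo] --> expR (L * (t - s)) * N (u (s + h) - u s).
  apply: cvgM.
    apply: (@cvg_comp _ _ _ (fun n => L * (grid n t - grid n s)) expR); last exact: continuous_expR.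
    by apply: cvgM => //; exact: cvg_cst.
  by apply: tends_nrm; exact: tendsB.
apply: (ler_cvg_to h1 h2); near=> n.
have gE : grid n t - grid n s = mesh n * (idx n t - idx n s)%:R.
  by rewrite natrB ?idx_le// mulrBr.
rewrite gE /euler_at {2}idxB.
apply: le_trans (step _ _ _ _ (ltW (mesh_gt0 n))) _; apply: ler_wpM2r; first exact: nrm_ge0.
by apply: pow_le_expR => //; rewrite ltW// mesh_gt0.
Unshelve. all: by end_near. Qed.

End EulerLimit.

(** * Evolution in a convex set: velocities *)

Section Velocity.
Context {R : realType} {E : lmodType R} (S : semi_inner E).
Context (C : set E) (B : E -> E) (L : R) (u : R -> E).
Hypothesis L0 : 0 <= L.
Hypothesis BL : lipschitz_map S C B L.
Hypothesis Ccvx : nconvex C.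
Hypothesis Ecpl : ncomplete S [set: E].
Implicit Types (x y z w D : E) (s t a b h : R).
Local Notation N := (nrm S).

(** The closed cone generated by [C - x]. *)
Definition tangent x := [set z : E | forall e : R, 0 < e ->
  exists l w, [/\ 0 <= l, C w & N (z - l *: (w - x)) <= e]].

Lemma tangent_convex x : C x -> nconvex (tangent x).
Proof.
move=> Cx z1 z2 t z1P z2P /andP[t0 t1] e e0.
have [l1 [w1 [l10 Cw1 h1]]] := z1P e e0; have [l2 [w2 [l20 Cw2 h2]]] := z2P e e0.
pose a := (1 - t) * l1; pose b := t * l2.
have a0 : 0 <= a by apply: mulr_ge0 => //; lra.
have b0 : 0 <= b by apply: mulr_ge0.
have [l [w [l0 Cw lw]]] : exists l w, [/\ 0 <= l, C w & l *: (w - x) = a *: (w1 - x) + b *: (w2 - x)].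
  have [ab|ab] := eqVneq (a + b) 0.
    have [-> ->] : a = 0 /\ b = 0 by split; lra.
    by exists 0, x; rewrite !scale0r addr0.
  exists (a + b), (w1 + (b / (a + b)) *: (w2 - w1)); split; first exact: addr_ge0.
    apply: Ccvx => //; rewrite divr_ge0 ?addr_ge0//= ler_pdivrMr ?mul1r ?lerDr//.
    by rewrite lt_neqAle eq_sym ab addr_ge0.
  by rewrite addrAC scalerDr scalerA mulrCA divff// mulr1 scalerDl -addrA -scalerDr
    [w1 - x + _]addrC subrKA.
exists l, w; split => //; rewrite lw.
have -> : z1 + t *: (z2 - z1) - (a *: (w1 - x) + b *: (w2 - x)) =
   (1 - t) *: (z1 - l1 *: (w1 - x)) + t *: (z2 - l2 *: (w2 - x)).
  have -> : z1 + t *: (z2 - z1) = (1 - t) *: z1 + t *: z2.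
    by rewrite scalerBl scale1r scalerBr addrA addrAC.
  by rewrite (scalerBr _ z1) (scalerBr _ z2) !scalerA -/a -/b opprD addrACA.
apply: le_trans (nrmD _ _ _) _; rewrite !nrmZ !ger0_norm//; last by lra.
have : (1 - t) * N (z1 - l1 *: (w1 - x)) <= (1 - t) * e by apply: ler_wpM2l => //; lra.
have : t * N (z2 - l2 *: (w2 - x)) <= t * e by apply: ler_wpM2l.
lra.
Qed.

Lemma tangent_complete x : ncomplete S (tangent x).
Proof.
move=> f fT /(Ecpl (fun=> I))[y _ fy]; exists y => // e e0.
have e20 : 0 < e / 2 by lra.
move/tendsP : (fy) => /(_ _ e20) [n _ /(_ n (leqnn n)) /= h].
have [l [w [l0 Cw lw]]] := fT n _ e20; exists l, w; split => //.
apply: le_trans (nrm_tri _ _ (f n) _) _; rewrite (nrmB _ y); lra.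
Qed.

(** The projection of [b] on the tangent cone; being a projection on a cone makes the
    removed part orthogonal to it. *)
Lemma minimal_velocity x (b : E) : C x -> exists v,
  [/\ tangent x v, normal S C x (b - v) & S (b - v) v = 0].
Proof.
move=> Cx.
have T0 : tangent x 0.
  by move=> e e0; exists 0, x; rewrite scale0r subrr nrm0; split => //; exact: ltW.
have [||| v Tv vn] := @projection_exists _ _ S (tangent x) b.
- by exists 0.
- exact: tangent_convex.
- exact: tangent_complete.
have v0 : S (b - v) v = 0.
  apply/eqP; rewrite eq_le; apply/andP; split.
    have T2 : tangent x (2 *: v).
      move=> e e0; have e20 : 0 < e / 2 by lra.
      have [l [w [l0 Cw lw]]] := Tv _ e20; exists (2 * l), w; split => //.
        by rewrite mulr_ge0.
      by rewrite -scalerA -scalerBr nrmZ ger0_norm//; lra.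
    by have := vn _ T2; rewrite scaler_nat mulr2n addrK.
  by have := vn _ T0; rewrite sub0r sipNr oppr_le0.
exists v; split => // w Cw.
have Tw : tangent x (w - x).
  by move=> e e0; exists 1, w; rewrite scale1r subrr nrm0; split => //; exact: ltW.
by have := vn _ Tw; rewrite sipDr sipNr v0 subr0.
Qed.

(** Why difference quotients converge: they are asymptotically no longer than
    [v], while testing with approximations of [v] by feasible directions bounds
    their component along [v] from below. *)
Lemma quotient_cvg (F : set_system R) {FF : ProperFilter F} (q : R -> E) x (b v : E) :
  tangent x v -> S (b - v) v = 0 ->
  (forall e, 0 < e -> \forall i \near F, N (q i) <= N v + e) ->
  (forall w e, C w -> 0 < e -> \forall i \near F, S (b - q i) (w - x) <= e) ->
  tends S F q v.
Proof.
move=> Tv bv qv qw; apply/tendsP => e e0.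
have e2 : 0 < e ^+ 2 by rewrite exprn_gt0.
pose V := N v; have V0 : 0 <= V by exact: nrm_ge0.
have nb0 := nrm_ge0 S b.
pose d := e ^+ 2 / (8 * (N b + V + 1)).
have d0 : 0 < d by rewrite divr_gt0// mulr_gt0//; lra.
have dE : d * (8 * (N b + V + 1)) = e ^+ 2 by rewrite divfK// gt_eqF// mulr_gt0//; lra.
have [l [w [l0 Cw lw]]] := Tv _ d0.
pose d' := e ^+ 2 / (8 * (l + 1)).
have d'0 : 0 < d' by rewrite divr_gt0// mulr_gt0//; lra.
have d'E : d' * (8 * (l + 1)) = e ^+ 2 by rewrite divfK// gt_eqF// mulr_gt0//; lra.
pose n := Num.min 1 (e ^+ 2 / (2 * (2 * V + 1))).
have n0 : 0 < n by rewrite lt_min ltr01 divr_gt0//; lra.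
have n1 : n <= 1 by rewrite ge_min lexx.
have nE : n * (2 * (2 * V + 1)) <= e ^+ 2.
  by rewrite -ler_pdivlMr ?ge_min ?lexx ?orbT//; lra.
have h1 := qv _ n0; have h2 := qw w _ Cw d'0.
near=> i.
have g1 : N (q i) <= V + n by near: i.
have g2 : S (b - q i) (w - x) <= d' by near: i.
have q0 := nrm_ge0 S (q i).
have g3 : S (b - q i) v <= l * d' + (N b + V + 1) * d.
  have -> : v = l *: (w - x) + (v - l *: (w - x)) by rewrite addrC subrK.
  rewrite sipDr sipZr; apply: lerD; first exact: ler_wpM2l.
  apply: le_trans (sip_le _ _ _) _; apply: ler_pM; rewrite ?nrm_ge0//.
  by apply: le_trans (nrmD _ _ _) _; rewrite nrmN; lra.
rewrite -(@ler_pXn2r _ 2) ?nnegrE ?nrm_ge0 ?(ltW e0)// nrm_sq.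
have bvE : S b v = V ^+ 2 by rewrite nrm_sq; move: bv; rewrite sipDl sipNl; lra.
have -> : S (q i - v) (q i - v) = N (q i) ^+ 2 - 2 * (S b v - S (b - q i) v) + V ^+ 2.
  by rewrite /V !nrm_sq !sipE (sipC S v (q i)); ring.
have g4 : N (q i) ^+ 2 <= (V + n) ^+ 2 by apply: lerXn2r; rewrite ?nnegrE ?addr_ge0 ?(ltW n0).
rewrite bvE.
have g5 : n ^+ 2 <= n by rewrite expr2; nra.
have g6 : l * d' * 8 <= e ^+ 2 by nra.
have : 0 <= V * n by rewrite mulr_ge0// ltW.
rewrite sqrrD in g4.
move: (N (q i) ^+ 2) (S (b - q i) v) g3 g4 => Q A g3 g4.
move: g6 dE; set ld := l * d'; have -> : d * (8 * (N b + V + 1)) = 8 * ((N b + V + 1) * d) by ring.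
move: g3; rewrite -/ld; set bd := _ * d; lra.
Unshelve. all: by end_near. Qed.

Hypothesis uC : forall t, 0 <= t -> C (u t).
Hypothesis ulip : loclip S u.
Hypothesis uevi : forall (T : R) w, 0 <= T -> C w -> exists2 K : R, 0 <= K &
  forall s t, 0 <= s -> s <= t -> t <= T ->
    S (u t - u s - (t - s) *: B (u s)) (u t - w) <= K * (t - s) ^+ 2.
Hypothesis uspeed : forall s t (v : E), 0 <= s -> s <= t ->
  normal S C (u s) (B (u s) - v) -> N (u t - u s) <= (t - s) * N v * expR (L * (t - s)).
Hypothesis ucontract : forall s t h, 0 <= s -> s <= t -> 0 <= h ->
  N (u (t + h) - u t) <= expR (L * (t - s)) * N (u (s + h) - u s).

Lemma nrm_quot_right (f : R -> E) t h : 0 < h -> N (quot f t h) = N (f (t + h) - f t) / h.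
Proof. by move=> h0; rewrite /quot nrmZ ger0_norm ?invr_ge0 ?(ltW h0)// mulrC. Qed.

Lemma nrm_quot_left (f : R -> E) t h : h < 0 -> N (quot f t h) = N (f t - f (t + h)) / (- h).
Proof. by move=> h0; rewrite /quot nrmZ nrmB ltr0_norm ?invr_lt0// -invrN mulrC. Qed.

Lemma quot_evi_right s w : 0 <= s -> C w -> exists2 K : R, 0 <= K & forall h, 0 < h -> h <= 1 ->
  S (B (u s) - quot u s h) (w - u s) <= K * h.
Proof.
move=> s0 Cw; have s10 : 0 <= s + 1 by lra.
have [K K0 HK] := uevi s10 Cw; have [M M0 HM] := ulip s10.
exists (K + (M + N (B (u s))) * M).
  by rewrite addr_ge0// mulr_ge0// addr_ge0// nrm_ge0.
move=> h h0 h1.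
have sh : s + h - s = h by rewrite addrAC subrr add0r.
have ev : S (u (s + h) - u s - h *: B (u s)) (u (s + h) - w) <= K * h ^+ 2.
  by have := HK s (s + h) s0; rewrite sh; apply; lra.
have li : N (u (s + h) - u s) <= M * h.
  by have := HM (s + h) s; rewrite sh (ger0_norm (ltW h0)); apply; apply/andP; split; lra.
have qE : u (s + h) - u s = h *: quot u s h by rewrite /quot scalerA divff ?gt_eqF// scale1r.
have nq : N (quot u s h) <= M by rewrite nrm_quot_right// ler_pdivrMr.
have ev' : S (quot u s h - B (u s)) (u (s + h) - w) <= K * h.
  rewrite -(ler_pM2l h0) -sipZl scalerBr -qE; apply: le_trans ev _.
  by rewrite le_eqVlt; apply/orP; left; apply/eqP; ring.
have -> : S (B (u s) - quot u s h) (w - u s) =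
  S (quot u s h - B (u s)) (u (s + h) - w) + S (B (u s) - quot u s h) (u (s + h) - u s).
  by rewrite !sipE; ring.
rewrite mulrDl; apply: lerD => //; apply: le_trans (sip_le _ _ _) _.
rewrite -mulrA; apply: ler_pM; rewrite ?nrm_ge0//.
by apply: le_trans (nrmD _ _ _) _; rewrite nrmN addrC lerD2r.
Qed.

Lemma quot_evi_left t w : 0 < t -> C w -> exists2 K : R, 0 <= K & forall h, 0 < h -> h <= t ->
  S (B (u t) - quot u t (- h)) (w - u t) <= K * h.
Proof.
move=> t0 Cw; have t0' := ltW t0.
have [K K0 HK] := uevi t0' Cw; have [M M0 HM] := ulip t0'.
exists (K + L * M * N (w - u t)).
  by rewrite addr_ge0// !mulr_ge0// nrm_ge0.
move=> h h0 h1.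
have th0 : 0 <= t - h by lra.
have th : t - (t - h) = h by rewrite opprB addrCA subrr addr0.
have ev : S (u t - u (t - h) - h *: B (u (t - h))) (u t - w) <= K * h ^+ 2.
  by have := HK (t - h) t th0; rewrite th; apply; lra.
have li : N (u t - u (t - h)) <= M * h.
  by have := HM t (t - h); rewrite th (ger0_norm (ltW h0)); apply; apply/andP; split; lra.
have qE : u t - u (t - h) = h *: quot u t (- h).
  by rewrite /quot scalerA invrN mulrN divff ?gt_eqF// scaleN1r opprB.
have ev' : S (quot u t (- h) - B (u (t - h))) (u t - w) <= K * h.
  rewrite -(ler_pM2l h0) -sipZl scalerBr -qE; apply: le_trans ev _.
  by rewrite le_eqVlt; apply/orP; left; apply/eqP; ring.
have -> : S (B (u t) - quot u t (- h)) (w - u t) =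
  S (quot u t (- h) - B (u (t - h))) (u t - w) + S (B (u t) - B (u (t - h))) (w - u t).
  by rewrite !sipE; ring.
rewrite mulrDl; apply: lerD => //; apply: le_trans (sip_le _ _ _) _.
rewrite mulrAC; apply: ler_wpM2r; first exact: nrm_ge0.
apply: le_trans (BL (uC t0') (uC th0)) _.
by rewrite -mulrA; apply: ler_wpM2l.
Qed.

Lemma expR_near (V : R) (F : set_system R) {FF : Filter F} (f : R -> R) e : 0 < e -> 0 <= V ->
  f @ F --> (0 : R) -> \forall h \near F, V * expR (L * f h) <= V + e.
Proof.
move=> e0 V0 f0.
have : V * expR (L * f h) @[h --> F] --> V.
  rewrite -[X in _ --> X]mulr1 -expR0; apply: cvgM; first exact: cvg_cst.
  have Lf : L * f h @[h --> F] --> (0 : R).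
    by rewrite -[X in _ --> X](mulr0 L); apply: cvgM => //; exact: cvg_cst.
  by apply: (@cvg_comp _ _ _ (fun h => L * f h) expR) Lf _; exact: continuous_expR.
move=> /cvgrPdist_le/(_ _ e0); apply: filterS => h.
by rewrite ler_norml => /andP[]; lra.
Qed.

Lemma right_velocity t (v : E) : 0 <= t -> tangent (u t) v -> normal S C (u t) (B (u t) - v) ->
  S (B (u t) - v) v = 0 -> tends S (0 : R)^'+ (quot u t) v.
Proof.
move=> t0 Tv nv v0; apply: (@quotient_cvg _ _ _ (u t) (B (u t))) => //.
  move=> e e0.
  have H : \forall h \near (0 : R)^'+, N v * expR (L * h) <= N v + e.
    by apply: expR_near => //; [exact: nrm_ge0|exact: cvg_at_right_filter].
  near=> h.
  have h0 : 0 < h by near: h; exact: nbhs_right_gt.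
  apply: (@le_trans _ _ (N v * expR (L * h))); last by near: h.
  have th : t <= t + h by lra.
  rewrite nrm_quot_right// ler_pdivrMr//; apply: le_trans (uspeed t0 th nv) _.
  by rewrite le_eqVlt; apply/orP; left; apply/eqP; rewrite addrAC subrr add0r; ring.
move=> w e Cw e0; have [K K0 HK] := quot_evi_right t0 Cw.
near=> h.
have h0 : 0 < h by near: h; exact: nbhs_right_gt.
have h1 : h <= 1 by near: h; apply: nbhs_right_le.
have h2 : h <= e / (K + 1) by near: h; apply: nbhs_right_le; rewrite divr_gt0//; lra.
apply: le_trans (HK h h0 h1) _.
rewrite ler_pdivlMr in h2; last by lra.
by nra.
Unshelve. all: by end_near. Qed.

Lemma left_velocity t (v : R -> E) : 0 < t -> tangent (u t) (v t) ->
  S (B (u t) - v t) (v t) = 0 -> (forall s, 0 <= s -> normal S C (u s) (B (u s) - v s)) ->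
  (forall e, 0 < e -> \forall h \near (0 : R)^'-, N (v (t + h)) <= N (v t) + e) ->
  tends S (0 : R)^'- (quot u t) (v t).
Proof.
move=> t0 Tv v0 vn vl; apply: (@quotient_cvg _ _ _ (u t) (B (u t))) => //.
  move=> e e0; have e20 : 0 < e / 2 by lra.
  have H : \forall h \near (0 : R)^'-, (N (v t) + e / 2) * expR (L * (- h)) <= (N (v t) + e / 2) + e / 2.
    apply: expR_near => //; first by rewrite addr_ge0 ?nrm_ge0//; lra.
    rewrite -[X in _ --> X]oppr0; apply: cvgN; exact: cvg_at_left_filter.
  have H2 := vl _ e20.
  near=> h.
  have h0 : h < 0 by near: h; exact: nbhs_left_lt.
  have ht : - t < h by near: h; apply: nbhs_left_gt; lra.
  have th0 : 0 <= t + h by lra.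
  have zv : N (v (t + h)) <= N (v t) + e / 2 by near: h.
  have Hh : (N (v t) + e / 2) * expR (L * (- h)) <= (N (v t) + e / 2) + e / 2 by near: h.
  have th : t + h <= t by lra.
  rewrite nrm_quot_left// ler_pdivrMr ?oppr_gt0//; apply: le_trans (uspeed th0 th (vn _ th0)) _.
  have -> : t - (t + h) = - h by rewrite opprD addrA subrr add0r.
  rewrite -mulrA mulrC; apply: ler_wpM2r; first by lra.
  apply: (@le_trans _ _ ((N (v t) + e / 2) * expR (L * (- h)))); last by lra.
  by apply: ler_wpM2r => //; exact: expR_ge0.
move=> w e Cw e0; have [K K0 HK] := quot_evi_left t0 Cw.
near=> h.
have h0 : 0 < - h by rewrite oppr_gt0; near: h; exact: nbhs_left_lt.
have h1 : - h <= t by rewrite lerNl; near: h; apply: nbhs_left_ge; lra.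
have h2 : - h <= e / (K + 1).
  by rewrite lerNl; near: h; apply: nbhs_left_ge; rewrite oppr_lt0 divr_gt0//; lra.
have := HK _ h0 h1; rewrite opprK => /le_trans; apply.
rewrite ler_pdivlMr in h2; last by lra.
by nra.
Unshelve. all: by end_near. Qed.

(** Where the speed, which grows at most exponentially, does not drop at [t],
    the left derivative exists and equals the right one; a monotone function
    drops at countably many points only. *)
Lemma evolution_velocity : exists v : R -> E,
  (forall t, 0 <= t -> [/\ tends S (0 : R)^'+ (quot u t) (v t),
     normal S C (u t) (B (u t) - v t) & S (B (u t) - v t) (v t) = 0]) /\
  {ae (@lebesgue_measure R), forall t, 0 < t -> tends S (0 : R)^' (quot u t) (v t)}.
Proof.
have /choice[v vP] : forall t, exists v, 0 <= t ->
    [/\ tangent (u t) v, normal S C (u t) (B (u t) - v) & S (B (u t) - v) v = 0].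
  move=> t; have [t0|tn] := leP 0 t; last by exists 0.
  by have [v vP] := minimal_velocity (B (u t)) (uC t0); exists v.
exists v.
have vr t : 0 <= t -> tends S (0 : R)^'+ (quot u t) (v t).
  by move=> t0; have [h1 h2 h3] := vP t t0; exact: right_velocity.
split; first by move=> t t0; have [h1 h2 h3] := vP t t0; split => //; exact: vr.
have vmono s t : 0 <= s -> s <= t -> N (v t) <= expR (L * (t - s)) * N (v s).
  move=> s0 st; have t0 : 0 <= t by lra.
  have h1 : N (quot u t h) @[h --> (0 : R)^'+] --> N (v t) by apply: tends_nrm; exact: vr.
  have h2 : expR (L * (t - s)) * N (quot u s h) @[h --> (0 : R)^'+] --> expR (L * (t - s)) * N (v s).
    by apply: cvgM; [exact: cvg_cst|apply: tends_nrm; exact: vr].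
  apply: (ler_cvg_to h1 h2); near=> h.
  have h0 : 0 < h by near: h; exact: nbhs_right_gt.
  rewrite /quot !nrmZ mulrCA; apply: ler_wpM2l => //; exact/ucontract/ltW.
pose phi t := expR (- (L * t)) * N (v t).
have phi_mono s t : 0 <= s -> s <= t -> phi t <= phi s.
  move=> s0 st; rewrite /phi.
  have -> : - (L * s) = - (L * t) + L * (t - s) by ring.
  rewrite expRD -mulrA; apply: ler_wpM2l; [exact: expR_ge0|exact: vmono].
pose good t := forall e, 0 < e -> \forall h \near (0 : R)^'-, N (v (t + h)) <= N (v t) + e.
pose A := [set t : R | 0 < t /\ ~ good t].
have drop t : A t -> exists e, 0 < e /\ forall s, 0 <= s -> s < t -> phi t + e <= phi s.
  move=> [t0 /existsNP[e /not_implyP[e0 ngood]]].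
  exists (expR (- (L * t)) * e); split; first by rewrite mulr_gt0 ?expR_gt0.
  move=> s s0 st; rewrite leNgt; apply/negP => drop.
  apply: ngood; near=> h.
  have h0 : h < 0 by near: h; exact: nbhs_left_lt.
  have hs : s - t < h by near: h; apply: nbhs_left_gt; lra.
  have : phi (t + h) < phi t + expR (- (L * t)) * e.
    by apply: (le_lt_trans _ drop); apply: phi_mono => //; lra.
  rewrite /phi -mulrDr => lt'.
  have ex : expR (- (L * t)) <= expR (- (L * (t + h))).
    by rewrite ler_expR lerN2; apply: ler_wpM2l => //; lra.
  have ex0 := expR_gt0 (- (L * (t + h))).
  have Ve : 0 <= N (v t) + e by rewrite addr_ge0 ?nrm_ge0// ltW.
  rewrite -(ler_pM2l ex0) ltW//; apply: lt_le_trans lt' _.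
  exact: ler_wpM2r.
have cA : countable A.
  have /choice[d dP] : forall t, exists e, A t -> 0 < e /\ forall s, 0 <= s -> s < t -> phi t + e <= phi s.
    by move=> t; have [/drop[e eP]|nA] := pselect (A t); [exists e|exists 0].
  apply: (@countable_jumps _ _ (fun t => - (phi t + d t)) (fun t => - phi t)).
    by move=> t /dP[d0 _]; lra.
  by move=> x y [x0 _] /dP[_ dy] xy; rewrite lerN2; apply: dy => //; exact: ltW.
exists A; split.
- exact: countable_measurable.
- exact: countable_lebesgue_measure0.
move=> t /= /not_implyP[t0 nt]; split => // gt; apply: nt.
have t0' := ltW t0; have [h1 h2 h3] := vP t t0'.
apply: (@cvg_at_right_left_dnbhs _ R^o); first exact: vr.
by apply: left_velocity => // s s0; have [_ ? _] := vP s s0.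
Unshelve. all: by end_near. Qed.

End Velocity.

(** The limit of the catching-up scheme along dyadic meshes. *)
Theorem strong_exists (R : realType) (E : lmodType R) (S : semi_inner E) (C : set E)
    (B : E -> E) (L : R) (u0 : E) :
  0 <= L -> lipschitz_map S C B L -> nconvex C -> ncomplete S C -> ncomplete S [set: E] -> C u0 ->
  exists u : R -> E, [/\ strong S C B u, nrm S (u 0 - u0) = 0 &
    forall t, 0 <= t -> exists v, [/\ tends S (0 : R)^'+ (quot u t) v,
      normal S C (u t) (B (u t) - v) & S (B (u t) - v) v = 0]].
Proof.
move=> L0 BL Ccvx Ccpl Ecpl Cu0.
have /choice[P PP] : forall x, exists p, C p /\ normal S C p (x - p).
  by move=> x; have [|p Cp np] := projection_exists x _ Ccvx Ccpl; [exists u0|exists p].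
have /choice[u uP] : forall t, exists y, 0 <= t -> C y /\ tends S \oo ((euler_at B u0 P)^~ t) y.
  move=> t; have [t0|tn] := leP 0 t; last by exists 0.
  have [|y Cy ty] := Ccpl _ _ (approx_cauchy L0 BL Cu0 PP t0); last by exists y.
  by move=> n; exact: (eulC B Cu0 PP).
have uC t : 0 <= t -> C (u t) by move=> /uP[].
have ulip : loclip S u.
  move=> T T0; exists (speed S B L u0 T); first exact: speed_ge0.
  by move=> s t hs ht; exact: (limit_lip L0 BL Cu0 PP uP).
have uevi (T : R) w : 0 <= T -> C w -> exists2 K : R, 0 <= K &
  forall s t, 0 <= s -> s <= t -> t <= T ->
    S (u t - u s - (t - s) *: B (u s)) (u t - w) <= K * (t - s) ^+ 2.
  move=> T0 Cw; have [M M0 HM] := ulip T T0.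
  set m := speed S B L u0 T; have m0 : 0 <= m by exact: speed_ge0.
  exists (2 * m ^+ 2 + L * m * (nrm S (u 0 - w) + M * T)).
    by rewrite addr_ge0// ?mulr_ge0 ?addr_ge0 ?nrm_ge0 ?mulr_ge0.
  move=> s t s0 st tT; apply: le_trans (limit_evi L0 BL Cu0 PP uP s0 st tT Cw) _.
  rewrite mulrC; apply: ler_wpM2r; first exact: sqr_ge0.
  rewrite lerD2l; apply: ler_wpM2l; first exact: mulr_ge0.
  apply: le_trans (nrm_tri _ _ (u 0) _) _; rewrite addrC lerD2l.
  apply: le_trans (HM t 0 _ _) _; [apply/andP; split; lra|by rewrite lexx|].
  by rewrite subr0 ger0_norm; [apply: ler_wpM2l|lra].
have [v [v1 v2]] := evolution_velocity L0 BL Ccvx Ecpl uC ulip uevi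
  (limit_speed L0 BL Cu0 PP uP) (limit_contract L0 BL Cu0 PP uP).
exists u; split; last by move=> t /v1 vt; exists (v t).
- split => //; apply: ae_impl v2 => t vt t0; exists (v t); first exact: vt.
  by have [] := v1 t (ltW t0).
- exact: (limit_start uP).
Qed.

(** * The space of square-integrable functions on the unit interval *)

Section L2space.
Context {R : realType}.
Local Notation L2 := (L2 R).
Local Notation mu := (@muOmega R).
Local Notation T := (measurableTypeR R).
Implicit Types (U V W X Z : L2) (f g : R -> R) (a b c m : R).

Lemma mu_setT : mu setT = 1%E.
Proof. by rewrite /muOmega/= /mrestr setTI lebesgue_measure_itv/= lte01 oppr0 adde0. Qed.

Lemma mu_fin : (mu setT < +oo)%E.
Proof. by rewrite mu_setT ltry. Qed.

Lemma ae_Omega (P : R -> Prop) : (forall m, Omega m -> P m) -> {ae mu, forall m, P m}.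
Proof.
move=> OP; exists (~` Omega); split.
- by apply: measurableC; exact: measurable_itv.
- by rewrite /muOmega/= /mrestr setICl measure0.
- by move=> m /= nP /OP.
Qed.

Lemma L2_measurable U : measurable_fun setT (U : T -> R).
Proof. by []. Qed.
Hint Resolve L2_measurable : core.

Lemma integrable_prod U V : mu.-integrable setT (EFin \o (fun m => U m * V m)).
Proof. by apply/Lfun1_integrable; apply: Lfun2_mul_Lfun1; exact: LfunP. Qed.

Lemma integrable_cst c : mu.-integrable setT (EFin \o (fun _ : T => c)).
Proof.
apply: measurable_bounded_integrable => //; first exact: mu_fin.
exists `|c|; split; first exact: num_real.
by move=> x cx t _ /=; exact: ltW.
Qed.

Lemma sq_integrable_Lfun f : measurable_fun setT (f : T -> R) ->
  mu.-integrable setT (EFin \o (fun m => f m ^+ 2)) -> (f : T -> R) \in Lfun mu 2%:E.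
Proof.
move=> mf /integrableP[_ fi].
rewrite inE; apply/andP; split; first by rewrite inE.
rewrite inE/= /finite_norm unlock; apply: poweR_lty.
apply: le_lt_trans fi; apply: ge0_le_integral => //=.
- apply/measurable_EFinP; apply: (@measurableT_comp _ _ _ _ _ _ (fun x : R => x `^ 2)) => //.
  exact: measurableT_comp.
- apply/measurable_EFinP; apply: measurableT_comp => //.
  exact: measurable_funX.
- by move=> x _; rewrite lee_fin normrX powR_mulrn.
Qed.

Lemma L2_dominated f U c : measurable_fun setT (f : T -> R) ->
  (forall m, `|f m| <= `|U m| + c) -> exists V, forall m, V m = f m.
Proof.
move=> mf fU.
suff H : (f : T -> R) \in Lfun mu 2%:E.
  by exists (Lfun_Sub (lee1n 2 : (1 <= 2%:E :> \bar R)%E) H).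
apply: sq_integrable_Lfun => //.
have bnd (y : R) : (`|y| + c) ^+ 2 <= 2 * (y * y) + 2 * c ^+ 2.
  have h : `|y| ^+ 2 = y ^+ 2 by rewrite real_normK ?num_real.
  by have := sqr_ge0 (`|y| - c); nra.
pose g (m : T) : \bar R := ((2 : R)%:E * (U m * U m)%R%:E + (2 * c ^+ 2)%R%:E)%E.
have ig : mu.-integrable setT g.
  apply: integrableD => //; last exact: integrable_cst.
  by apply: integrableZl => //; exact: integrable_prod.
apply: le_integrable ig => //.
- by apply/measurable_EFinP; exact: measurable_funX.
- move=> x _; rewrite /= lee_fin.
  have h : `|f x| ^+ 2 <= (`|U x : R| + c) ^+ 2.
    by apply: lerXn2r; rewrite ?nnegrE//; exact: le_trans (normr_ge0 _) (fU x).
  rewrite normrX; apply: le_trans h _; apply: le_trans (bnd (U x)) _.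
  exact: ler_norm.
Qed.

Lemma inner2C U V : inner2 U V = inner2 V U.
Proof. by rewrite /inner2; under eq_Rintegral do rewrite mulrC. Qed.

Lemma inner2Dl U V W : inner2 (U + V) W = inner2 U W + inner2 V W.
Proof.
rewrite /inner2 -RintegralD//; [|exact: integrable_prod..].
by apply: eq_Rintegral => m _; exact: mulrDl.
Qed.

Lemma inner2Zl a U W : inner2 (a *: U) W = a * inner2 U W.
Proof.
rewrite /inner2 -RintegralZl//; last exact: integrable_prod.
by apply: eq_Rintegral => m _; exact/esym/mulrA.
Qed.

Lemma inner2_ge0 U : 0 <= inner2 U U.
Proof. by apply: Rintegral_ge0 => m _; rewrite -expr2 sqr_ge0. Qed.

Definition ipL2 : semi_inner L2 := SemiInner inner2C inner2Dl inner2Zl inner2_ge0.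

Lemma norm2E U : norm2 U = nrm ipL2 U.
Proof.
rewrite /norm2 /nrm /= -[LHS]ger0_norm ?fine_ge0 ?Lnorm_ge0// -sqrtr_sqr; congr (Num.sqrt _).
have two : (2 : R) != 0 by rewrite pnatr_eq0.
have h := @poweR_Lnorm _ _ _ mu (EFin \o U) 2 two.
have nfin := finite_norm_fine U.
rewrite -nfin poweR_EFin powR_mulrn ?fine_ge0 ?Lnorm_ge0// in h.
apply/EFin_inj; rewrite h /inner2 /Rintegral fineK; last first.
  by apply: integrable_fin_num => //; exact: integrable_prod.
apply: eq_integral => x _ /=.
by rewrite powR_mulrn// real_normK ?num_real// expr2.
Qed.

Lemma inner2_ae U U' V : U = U' %[ae mu] -> inner2 U V = inner2 U' V.
Proof.
move=> UU; rewrite /inner2 /Rintegral; congr fine; apply: ae_eq_integral => //.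
- by apply/measurable_EFinP; exact: measurable_funM.
- by apply/measurable_EFinP; exact: measurable_funM.
- by apply: filterS UU => m Um _ /=; rewrite Um.
Qed.

Lemma nrm0_ae U V : nrm ipL2 (U - V) = 0 <-> U = V %[ae mu].
Proof.
split=> [h|UV].
  have := @fine_Lnormr_eq0 _ _ _ mu 2%:E (lee1n 2) (U - V).
  rewrite -/(norm2 (U - V)) norm2E => /(_ h); apply: filterS => m Hm /Hm /=.
  by move/subr0_eq.
apply: sip_eq0_nrm => /=; rewrite (_ : inner2 (U - V) (U - V) = inner2 0 (U - V)).
  exact: (sip0l ipL2).
by apply: inner2_ae; apply: filterS UV => m Um I /=; rewrite -/(_ - _) [RHS]/= ; apply/eqP; rewrite subr_eq0; apply/eqP; exact: Um.
Qed.

(** ** Dominated convergence and completeness *)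

Lemma inner2_dominated (f : nat -> L2) U (G : L2) W c : (forall n m, Omega m -> `|f n m : R| <= `|G m : R| + c) ->
  (forall m, Omega m -> f n m @[n --> \oo] --> (U m : R)) ->
  inner2 (f n) W @[n --> \oo] --> inner2 U W.
Proof.
move=> fG fU.
pose g n : T -> \bar R := fun m => (f n m * W m)%:E.
pose ha (m : T) : R := `|G m * W m|; pose hb (m : T) : R := `|c| * `|W m : R|.
pose h (m : T) : \bar R := ((ha m)%:E + (hb m)%:E)%E.
have ih : mu.-integrable setT h.
  apply: integrableD => //.
    exact: (integrable_norm (integrable_prod G W)).
  have W1 : mu.-integrable setT (EFin \o (W : T -> R)).
    apply/Lfun1_integrable; apply: (@Lfun_subset12 _ _ _ mu); last exact: LfunP.
    by rewrite mu_setT.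
  apply: (@integrableZl _ _ _ mu setT measurableT `|c| (EFin \o (fun m => `|W m : R|))).
  exact: (integrable_norm W1).
have mg n : measurable_fun setT (g n).
  by apply/measurable_EFinP; exact: measurable_funM.
have mU : measurable_fun setT (fun m : T => (U m * W m)%:E).
  by apply/measurable_EFinP; exact: measurable_funM.
have cv : {ae mu, forall m : T, setT m -> g ^~ m @ \oo --> (U m * W m)%:E}.
  apply: ae_Omega => m Om _; apply: cvg_EFin; first by near=> n.
  by apply: cvgM; [exact: fU|exact: cvg_cst].
have dom : {ae mu, forall (m : T) n, setT m -> (`|g n m| <= h m)%E}.
  apply: ae_Omega => m Om n _; rewrite /g /h /ha /hb /= lee_fin !normrM -mulrDl; apply: ler_wpM2r => //.
  by apply: le_trans (fG n m Om) _; rewrite lerD2l ler_norm.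
have [h1 h2 h3] := dominated_convergence measurableT mg mU cv ih dom.
rewrite /inner2 /Rintegral.
have fin : (\int[mu]_x (U x * W x)%:E)%E \is a fin_num.
  by apply: integrable_fin_num => //; exact: integrable_prod.
apply: fine_cvg; rewrite fineK//; exact: h3.
Unshelve. all: by end_near. Qed.

Lemma L1_le_nrm U : (\int[mu]_m (`|U m : R|)%:E <= (nrm ipL2 U)%:E)%E.
Proof.
have [one oneE] : exists V, forall m, V m = 1.
  by apply: (@L2_dominated (fun=> 1) 0 1) => // m; rewrite normr1 lerDr.
have [aU aUE] : exists V, forall m, V m = `|U m : R|.
  apply: (@L2_dominated (fun m => `|U m : R|) U 0); first exact: measurableT_comp.
  by move=> m; rewrite addr0 normr_id.
have -> : (\int[mu]_m (`|U m : R|)%:E = (inner2 aU one)%:E)%E.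
  rewrite /inner2 /Rintegral fineK; last by apply: integrable_fin_num => //; exact: integrable_prod.
  by apply: eq_integral => m _; rewrite aUE oneE mulr1.
rewrite lee_fin; apply: le_trans (sip_le ipL2 _ _) _.
have -> : nrm ipL2 one = 1.
  rewrite /nrm/= /inner2 (_ : Rintegral _ _ _ = 1) ?sqrtr1// /Rintegral.
  under eq_integral => m _ do rewrite oneE mulr1.
  by rewrite integral_cst// mu_setT mul1e.
rewrite mulr1 /nrm/= (_ : inner2 aU aU = inner2 U U)//.
by apply: eq_Rintegral => m _; rewrite aUE -expr2 real_normK ?num_real.
Qed.

(** Riesz-Fischer, along a subsequence: the increments are summable in [L^1],
    hence almost everywhere. *)
Lemma L2_fast_cvg (x : nat -> L2) : (forall n, nrm ipL2 (x n.+1 - x n) <= 2^-1 ^+ n) ->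
  exists U, {ae mu, forall m, x n m @[n --> \oo] --> (U m : R)} /\
    forall n, nrm ipL2 (x n - U) <= 2 * 2^-1 ^+ n.
Proof.
move=> xn.
pose d n (m : T) : \bar R := (`|(x n.+1 - x n) m : R|)%:E.
have md n : measurable_fun setT (d n).
  by apply/measurable_EFinP; exact: measurableT_comp.
have d0 n (m : T) : setT m -> (0 <= d n m)%E by rewrite lee_fin.
pose s (m : T) : \bar R := (\sum_(n <oo) d n m)%E.
have ms : measurable_fun setT s by apply: ge0_emeasurable_sum => // n m _ _; exact: d0.
have s0 (m : T) : (0 <= s m)%E by apply: nneseries_ge0 => n _ _; exact: d0.
have si : mu.-integrable setT s.
  apply/integrableP; split => //.
  under eq_integral => m _ do rewrite gee0_abs//.
  rewrite /s integral_nneseries//.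
  apply: (@le_lt_trans _ _ (\sum_(n <oo) (((2 : R) / (2 ^ (n + 1))%:R)%:E))%E).
    apply: lee_nneseries => [n _ _|n _]; first by apply: integral_ge0 => m _; exact: d0.
    apply: le_trans (L1_le_nrm _) _; rewrite lee_fin; apply: le_trans (xn n) _.
    by rewrite addn1 expnS natrM invfM mulrA divff ?mul1r ?pnatr_eq0// natrX exprVn.
  have -> : (\sum_(n <oo) (((2 : R) / (2 ^ (n + 1))%:R)%:E))%E = ((2 : R) / 2 ^+ 0)%:E.
    by apply: cvg_lim => //; exact: (@cvg_geometric_eseries_half R 2 0).
  exact: ltry.
have sfin : {ae mu, forall m : T, s m \is a fin_num}.
  by have := integrable_ae measurableT si; apply: filterS => m; exact.
have xcvg (m : T) : s m \is a fin_num -> cvgn (fun n => x n m : R).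
  move=> sm.
  have c1 : cvgn (series (fun n => `|(x n.+1 - x n) m : R|)).
    have sf : (s m < +oo)%E by rewrite -ge0_fin_numE.
    by apply: (@nnseries_is_cvg _ (fun n => `|(x n.+1 - x n) m : R|)).
  have c2 : cvgn (series (fun n => (x n.+1 - x n) m : R)) by exact: normed_cvg c1.
  have -> : (fun n => x n m : R) = (fun n => (x 0%N m : R) + series (fun n => (x n.+1 - x n) m : R) n).
    apply/funext => n; rewrite /series/=.
    have -> : \sum_(0 <= k < n) ((x k.+1 - x k) m : R) = \sum_(0 <= k < n) ((x k.+1 m : R) - x k m) by [].
    by rewrite telescope_sumr// addrC subrK.
  apply: is_cvgD => //; exact: is_cvg_cst.
have [N [mN N0 NP]] := sfin.
pose y n (m : T) : R := (x n m : R) * \1_(~` N) m.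
have yN n m : ~ N m -> y n m = x n m by move=> nm; rewrite /y indicE mem_set// mulr1.
pose U' (m : T) : R := lim (y n m @[n --> \oo]).
have yU (m : T) : y n m @[n --> \oo] --> U' m.
  suff : cvgn (fun n => y n m) by [].
  have [Nm|nNm] := pselect (N m).
    have -> : (fun n => y n m) = (fun=> 0).
      by apply/funext => n; rewrite /y indicE memNset ?mulr0//; apply.
    exact: is_cvg_cst.
  have -> : (fun n => y n m) = (fun n => x n m : R) by apply/funext => n; exact: yN.
  by apply: xcvg; apply: contrapT => h; apply: nNm; exact: NP.
have my n : measurable_fun setT (y n).
  by apply: measurable_funM => //; apply: measurable_indic; exact: measurableC.
have mU' : measurable_fun setT U'.
  by apply: (measurable_fun_cvg my) => m _; exact: yU.
have aeN (P : T -> Prop) : (forall m, ~ N m -> P m) -> {ae mu, forall m : T, P m}.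
  by move=> NP'; exists N; split => // m /= nP; apply: contrapT => /NP'.
have tail k j : (k <= j)%N -> nrm ipL2 (x k - x j) <= 2 * 2^-1 ^+ k.
  move=> kj; rewrite -(subnKC kj); set i := (j - k)%N.
  suff : nrm ipL2 (x k - x (k + i)%N) <= 2 * 2^-1 ^+ k - 2 * 2^-1 ^+ (k + i).
    have : 0 <= (2^-1 : R) ^+ (k + i) by rewrite exprn_ge0.
    by move: (2^-1 ^+ (k + i)) (2^-1 ^+ k) (nrm _ _) => p q r; lra.
  elim: i => [|i IH]; first by rewrite addn0 !subrr nrm0.
  apply: le_trans (nrm_tri _ _ (x (k + i)%N) _) _.
  have h : nrm ipL2 (x (k + i)%N - x (k + i.+1)%N) <= 2^-1 ^+ (k + i).
    by rewrite nrmB addnS; exact: xn.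
  have e1 : (2^-1 : R) ^+ (k + i.+1) = 2^-1 * 2^-1 ^+ (k + i) by rewrite addnS exprS.
  rewrite e1; move: IH h.
  by move: (2^-1 ^+ (k + i)) (2^-1 ^+ k) (nrm _ _) (nrm _ _) => p q r r'; lra.
have intE k j : (\int[mu]_m ((y k m - y j m) ^+ 2)%:E = (nrm ipL2 (x k - x j) ^+ 2)%:E)%E.
  rewrite nrm_sq/= /inner2 /Rintegral fineK; last first.
    by apply: integrable_fin_num => //; exact: integrable_prod.
  apply: ae_eq_integral => //.
  - by apply/measurable_EFinP; apply: measurable_funX; exact: measurable_funB.
  - by apply/measurable_EFinP; exact: measurable_funM.
  - by apply: aeN => m nm _; rewrite !yN// expr2.
have key k : (\int[mu]_m ((y k m - U' m) ^+ 2)%:E <= ((2 * 2^-1 ^+ k) ^+ 2)%:E)%E.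
  have -> : (\int[mu]_m ((y k m - U' m) ^+ 2)%:E =
             \int[mu]_m limn_einf (fun j => ((y k m - y j m) ^+ 2)%:E))%E.
    apply: eq_integral => m _; apply/esym; apply: (cvg_limn_einf_sup _).1.
    apply: cvg_EFin; first by near=> j.
    by rewrite expr2; under eq_fun do rewrite expr2; apply: cvgM; apply: cvgB => //; exact: cvg_cst.
  apply: (@le_trans _ _ (limn_einf (fun j => \int[mu]_m ((y k m - y j m) ^+ 2)%:E)%E)).
    apply: (@fatou _ _ _ mu setT measurableT (fun j m => ((y k m - y j m) ^+ 2)%:E)) => //.
    - by move=> j; apply/measurable_EFinP; apply: measurable_funX; exact: measurable_funB.
    - by move=> j m _; rewrite lee_fin sqr_ge0.
  rewrite limn_einf_lim; apply: lime_le; first exact: is_cvg_einfs.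
  apply: nearW => j; apply: (@le_trans _ _ (\int[mu]_m ((y k m - y (k + j)%N m) ^+ 2)%:E)%E).
    by apply: ereal_inf_lbound; exists (k + j)%N => //=; exact: leq_addl.
  rewrite intE lee_fin; apply: lerXn2r; rewrite ?nnegrE ?nrm_ge0 ?mulr_ge0 ?exprn_ge0//.
  exact/tail/leq_addr.
have [V VE] : exists V : L2, forall m, V m = y 0%N m - U' m.
  have H : (fun m : T => y 0%N m - U' m) \in Lfun mu 2%:E.
    apply: sq_integrable_Lfun; first exact: measurable_funB.
    apply/integrableP; split.
      by apply/measurable_EFinP; apply: measurable_funX; exact: measurable_funB.
    under eq_integral => m _ do rewrite /= ger0_norm ?sqr_ge0//.
    exact: le_lt_trans (key 0%N) (ltry _).
  by exists (Lfun_Sub (lee1n 2 : (1 <= 2%:E :> \bar R)%E) H).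
have UE (m : T) : ~ N m -> (x 0%N - V) m = U' m :> R.
  move=> nm; have -> : (x 0%N - V) m = (x 0%N m : R) - V m :> R by [].
  by rewrite VE yN// opprB addrC subrK.
exists (x 0%N - V); split.
  apply: aeN => m nm; rewrite UE//.
  have -> : (fun n => x n m : R) = (fun n => y n m) by apply/funext => n; rewrite yN.
  exact: yU.
move=> k; rewrite -(@ler_pXn2r _ 2) ?nnegrE ?nrm_ge0 ?mulr_ge0 ?exprn_ge0//.
rewrite nrm_sq -lee_fin; apply: le_trans (key k).
rewrite /= /inner2 /Rintegral fineK; last by apply: integrable_fin_num => //; exact: integrable_prod.
rewrite le_eqVlt; apply/orP; left; apply/eqP; apply: ae_eq_integral => //.
- by apply/measurable_EFinP; exact: measurable_funM.
- by apply/measurable_EFinP; apply: measurable_funX; exact: measurable_funB.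
- apply: aeN => m nm _.
  have -> : (x k - (x 0%N - V)) m = (x k m : R) - (x 0%N - V) m :> R by [].
  by rewrite UE// yN// expr2.
Unshelve. all: by end_near. Qed.

End L2space.

Section CauchySubsequences.
Context {R : realType} {E : lmodType R} (S : semi_inner E).

Lemma ncauchy_fast_subsequence (x : nat -> E) : ncauchy S x ->
  exists2 k : nat -> nat, (forall n, (n <= k n)%N) &
    forall n, nrm S (x (k n.+1) - x (k n)) <= 2^-1 ^+ n.
Proof.
move=> cx.
have /choice[N HN] : forall n : nat, exists N, forall i j, (N <= i)%N -> (N <= j)%N ->
    nrm S (x i - x j) <= 2^-1 ^+ n.
  by move=> n; apply: cx; rewrite exprn_gt0.
pose k n := (n + \sum_(i < n.+1) N i)%N.
have Nk i n : (i <= n)%N -> (N i <= k n)%N.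
  move=> lin; have ln : (i < n.+1)%N by [].
  by rewrite /k (bigD1 (Ordinal ln))//= addnCA leq_addr.
exists k => n; first exact: leq_addr.
by apply: HN; apply: Nk.
Qed.

Lemma ncauchy_subsequence_tends (x : nat -> E) (k : nat -> nat) y : ncauchy S x ->
  (forall n, (n <= k n)%N) -> tends S \oo (x \o k) y -> tends S \oo x y.
Proof.
move=> cx kn /tendsP xk; apply/tendsP => e e0.
have e20 : 0 < e / 2 by rewrite divr_gt0.
have [N HN] := cx _ e20; have [M _ HM] := xk _ e20.
exists N => // n /= Nn; apply: le_trans (nrm_tri _ _ (x (k (maxn M n))) _) _.
have h1 : nrm S (x n - x (k (maxn M n))) <= e / 2.
  by apply: HN => //; apply: leq_trans (kn _); apply: leq_trans Nn _; exact: leq_maxr.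
have h2 : nrm S (x (k (maxn M n)) - y) <= e / 2 by apply: HM => /=; exact: leq_maxl.
lra.
Qed.

End CauchySubsequences.

Section L2elements.
Context {R : realType}.
Local Notation L2 := (L2 R).
Local Notation mu := (@muOmega R).
Local Notation T := (measurableTypeR R).
Implicit Types (U V W X Z p : L2) (f g : R -> R) (a b c m : R).

Lemma ae_mu_impl (P Q : R -> Prop) : (forall t, P t -> Q t) ->
  {ae mu, forall t, P t} -> {ae mu, forall t, Q t}.
Proof. by move=> PQ; apply: (@filterS _ _ (ae_filter_ringOfSetsType mu)). Qed.

Lemma ae_mu_impl2 (P P' Q : R -> Prop) : (forall t, P t -> P' t -> Q t) ->
  {ae mu, forall t, P t} -> {ae mu, forall t, P' t} -> {ae mu, forall t, Q t}.
Proof. by move=> PQ; apply: (@filterS2 _ _ (ae_filter_ringOfSetsType mu)). Qed.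

Lemma L2_ae_subsequence (x : nat -> L2) : ncauchy ipL2 x ->
  exists U k, [/\ forall n, (n <= k n)%N, tends ipL2 \oo x U &
    {ae mu, forall m, x (k n) m @[n --> \oo] --> (U m : R)}].
Proof.
move=> cx; have [k kn kx] := ncauchy_fast_subsequence cx.
have [U [Uae Un]] := L2_fast_cvg kx.
exists U, k; split => //; apply: (ncauchy_subsequence_tends cx kn).
apply: (@tends_le _ _ _ _ _ _ _ _ (fun n => 2 * 2^-1 ^+ n)); first by near=> n; exact: Un.
have H : 2 * 2^-1 ^+ n @[n --> \oo] --> (2 * 0 : R).
  apply: cvgM; first exact: cvg_cst.
  by apply: cvg_expr; rewrite ger0_norm// invf_lt1// ltr1n.
by rewrite mulr0 in H.
Unshelve. all: by end_near. Qed.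

Lemma L2_complete : ncomplete ipL2 [set: L2].
Proof. by move=> x _ /L2_ae_subsequence[U [k [_ xU _]]]; exists U. Qed.

(** The zero function unless [f] is square integrable. *)
Definition mkL2 f : L2 := xget 0 [set V : L2 | forall m, V m = f m].

Lemma mkL2_val f V : (forall m, V m = f m) -> forall m, mkL2 f m = f m.
Proof. by move=> Vf; apply: (@xgetPex _ 0 [set V : L2 | forall m, V m = f m]); exists V. Qed.

Lemma mkL2E f U c : measurable_fun setT (f : T -> R) ->
  (forall m, `|f m| <= `|U m : R| + c) -> forall m, mkL2 f m = f m.
Proof. by move=> mf fU; have [V VE] := L2_dominated mf fU; exact: mkL2_val VE. Qed.

Lemma mkL2_boundedE f c : measurable_fun setT (f : T -> R) ->
  (forall m, `|f m| <= c) -> forall m, mkL2 f m = f m.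
Proof.
move=> mf fc; apply: (@mkL2E f 0 c) => // m.
by rewrite (_ : (0 : L2) m = 0)// normr0 add0r.
Qed.

Definition oneL2 := mkL2 (fun=> 1).
Definition ind m := mkL2 (fun x => (m <= x)%R%:R).

Lemma oneE m : oneL2 m = 1 :> R.
Proof. by apply: (@mkL2_boundedE _ 1) => // ?; rewrite normr1. Qed.

Lemma indE m x : ind m x = (m <= x)%R%:R :> R.
Proof.
apply: (@mkL2_boundedE (fun x => (m <= x)%R%:R) 1) => [|y]; last first.
  by case: (m <= y); rewrite ?normr0 ?normr1 ?ler01.
rewrite (_ : (fun x => _) = \1_(`[m, +oo[)).
  by apply: measurable_indic; exact: measurable_itv.
by apply/funext => y; rewrite indicE mem_setE in_itv/= andbT.
Qed.

Lemma integrable_L2 U : mu.-integrable setT (EFin \o (U : T -> R)).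
Proof.
apply/Lfun1_integrable; apply: (@Lfun_subset12 _ _ _ mu); last exact: LfunP.
by rewrite mu_setT.
Qed.

(** The superlevel sets generate the Borel sets, so an element orthogonal to all
    of their indicators has vanishing integral over every Borel set. *)
Lemma ind_total p : inner2 p oneL2 = 0 -> (forall m, Omega m -> inner2 p (ind m) = 0) ->
  nrm ipL2 p = 0.
Proof.
move=> p1 pm.
have iE (A : set T) : measurable A -> mu.-integrable A (fun m => (p m)%:E).
  by move=> mA; apply: integrableS (integrable_L2 p).
have int0 (U : L2) (A : set T) : measurable A -> inner2 p U = 0 ->
    {ae mu, forall m, U m = \1_A m} -> (\int[mu]_(m in A) (p m)%:E = 0)%E.
  move=> mA pU UA; rewrite integral_mkcond.
  rewrite -[RHS](_ : (inner2 p U)%:E = 0%E); last by rewrite pU.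
  rewrite /inner2 /Rintegral fineK; last first.
    by apply: integrable_fin_num => //; exact: integrable_prod.
  apply: ae_eq_integral => //.
  - apply/(measurable_restrictT _ _).1 => //; apply/measurable_EFinP.
    exact: measurable_funTS.
  - by apply/measurable_EFinP; exact: measurable_funM.
  - apply: ae_mu_impl UA => m Um _; rewrite patchE Um indicE.
    by case: (m \in A); rewrite ?mulr1 ?mulr0.
have G0 (A : set T) : @RGenCInfty.G R A -> (\int[mu]_(m in A) (p m)%:E = 0)%E.
  move=> [m ->]; have mA : measurable (`[m, +oo[ : set T) by exact: measurable_itv.
  have [m0|m0] := leP m 0.
    apply: (int0 oneL2) => //; apply: ae_Omega => x; rewrite /Omega/= in_itv/= => /andP[x0 _].
    by rewrite oneE indicE mem_setE in_itv/= andbT (ltW (le_lt_trans m0 x0)).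
  have [m1|m1] := leP 1 m.
    apply: (int0 0) => //; first by exact: (sip0r ipL2).
    apply: ae_Omega => x; rewrite /Omega/= in_itv/= => /andP[_ x1].
    by rewrite indicE mem_setE in_itv/= andbT leNgt (lt_le_trans x1 m1).
  apply: (int0 (ind m)) => //; first by apply: pm; rewrite /Omega/= in_itv/= m0 m1.
  by apply: ae_Omega => x _; rewrite indE indicE mem_setE in_itv/= andbT.
have all0 (A : set T) : measurable A -> (\int[mu]_(m in A) (p m)%:E = 0)%E.
  move=> mA.
  apply: (@dynkin_induction _ T (@RGenCInfty.G R)
    [set A : set T | (\int[mu]_(m in A) (p m)%:E = 0)%E]) => //=.
  - exact: RGenCInfty.measurableE.
  - move=> _ _ [x ->] [y ->]; exists (Num.max x y).
    by apply/seteqP; split => z /=; rewrite !in_itv/= !andbT ge_max; [move=> [-> ->]|move=> /andP[]].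
  - by apply: (int0 oneL2) => //; apply: ae_Omega => m _; rewrite oneE indicT.
  - move=> B mB B0; have mBC : measurable (~` B) by exact: measurableC.
    have : (\int[mu]_(m in setT) (p m)%:E = 0)%E.
      by apply: (int0 oneL2) => //; apply: ae_Omega => m _; rewrite oneE indicT.
    rewrite -(setUv B) integral_setU//=.
    + by rewrite B0 add0e.
    + by rewrite setUv; apply/measurable_EFinP.
    + by apply/disj_setPCl.
  - move=> F mF tF F0; rewrite integral_bigcup//.
      by apply: eseries0 => i _ _; exact: F0.
    by apply: iE; exact: bigcupT_measurable.
  - by move: mA; rewrite -[X in X -> _]/(((R.-ocitv).-measurable).-sigma.-measurable A) RGenCInfty.measurableE.
have : ae_eq mu setT (fun m => (p m)%:E) (cst 0%E).
  apply: integral_ae_eq => //; first exact: iE.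
  by move=> A _ mA; rewrite all0// integral0.
move=> H; rewrite -(subr0 p); apply/nrm0_ae; apply: filterS H => m /(_ I) [].
by [].
Qed.

End L2elements.

(** * The cone of nondecreasing functions *)

Section Cone.
Context {R : realType}.
Local Notation L2 := (L2 R).
Local Notation mu := (@muOmega R).
Local Notation T := (measurableTypeR R).
Local Notation K := (@Kcone R).
Implicit Types (U V W X Y Z p : L2) (f g : R -> R) (a b c m : R).

Lemma OmegaE m : Omega m <-> 0 < m /\ m < 1.
Proof. by rewrite /Omega/= in_itv/=; split=> [/andP[]|[-> ->]]. Qed.

Lemma inner2_congr U V U' V' : (forall m, U m * V m = U' m * V' m :> R) ->
  inner2 U V = inner2 U' V'.
Proof. by move=> h; apply: eq_Rintegral => m _; exact: h. Qed.

Lemma inner2_le U V U' V' : (forall m, Omega m -> U m * V m <= U' m * V' m :> R) ->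
  inner2 U V <= inner2 U' V'.
Proof.
move=> h; rewrite -subr_ge0.
have -> : inner2 U' V' - inner2 U V = \int[mu]_m (U' m * V' m - U m * V m).
  by rewrite /inner2 RintegralB//; exact: integrable_prod.
pose g (m : T) : R := (U' m * V' m - U m * V m).
pose g' (m : T) : R := Num.max (g m) 0.
rewrite (_ : Rintegral _ _ _ = \int[mu]_m g' m).
  by apply: Rintegral_ge0 => m _; rewrite le_max lexx orbT.
have mg : measurable_fun setT g by apply: measurable_funB; exact: measurable_funM.
rewrite /Rintegral; congr fine; apply: ae_eq_integral => //.
- by apply/measurable_EFinP.
- by apply/measurable_EFinP; apply: measurable_maxr.
- apply: ae_Omega => m Om _; congr EFin; rewrite /g' /g.
  by apply/esym/max_idPl; rewrite subr_ge0; exact: h.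
Qed.

Lemma mu_itv_gt0 a b : 0 <= a -> a < b -> b <= 1 -> mu (`]a, b[%classic : set R) = (b - a)%:E.
Proof.
move=> a0 ab b1; rewrite /muOmega/= /mrestr/= setIidl; last first.
  move=> x; rewrite /Omega/= !in_itv/= => /andP[h1 h2].
  by rewrite (le_lt_trans a0 h1) (lt_le_trans h2 b1).
by rewrite lebesgue_measure_itv/= lte_fin ab EFinB.
Qed.

Lemma ae_dense (P : R -> Prop) a b : {ae mu, forall m, P m} -> 0 <= a -> a < b -> b <= 1 ->
  exists2 x, a < x < b & P x.
Proof.
move=> [N [mN N0 NP]] a0 ab b1; apply: contrapT => h.
have : (mu (`]a, b[%classic : set R) <= mu N)%E.
  have mI : measurable (`]a, b[%classic : set R) by exact: measurable_itv.
  apply: (le_measure mu (mem_set mI) (mem_set mN)) => x /=; rewrite in_itv/= => xab; apply: NP => Px.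
  by apply: h; exists x.
by rewrite N0 mu_itv_gt0// lee_fin leNgt subr_gt0 ab.
Qed.

Lemma ae_countable (A : set R) : countable A -> {ae mu, forall m, ~ A m}.
Proof.
move=> cA; have mA : measurable (A : set T).
  by apply: countable_measurable => // t; exact: measurable_set1.
exists A; split => //; last by move=> x /= /contrapT.
apply/eqP; rewrite eq_le measure_ge0 andbT /muOmega/= /mrestr.
apply: (@le_trans _ _ (lebesgue_measure A)).
  by apply: le_measure; rewrite ?inE//; apply: measurableI => //; exact: measurable_itv.
by rewrite countable_lebesgue_measure0.
Qed.

Lemma ae_neq b : {ae mu, forall m : R, m <> b}.
Proof. exact: (ae_countable (countable1 b)). Qed.

Lemma K_nondecreasing X x y : K X -> Omega x -> Omega y -> x <= y -> X x <= X y :> R.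
Proof. by move=> [+ _]; exact. Qed.

Lemma K_ae_le X Y : K X -> K Y -> {ae mu, forall m, X m <= Y m :> R} ->
  forall m, Omega m -> X m <= Y m :> R.
Proof.
move=> [_ Xr] [_ Yr] XY m Om; have [m0 m1] := (OmegaE m).1 Om.
rewrite leNgt; apply/negP => h.
have c : X x - Y x @[x --> m^'+] --> (X m - Y m : R) by apply: cvgB; [exact: Xr|exact: Yr].
have : \forall x \near m^'+, 0 < X x - Y x :> R.
  by apply: (cvgr_gt (X m - Y m : R) c); rewrite subr_gt0.
move=> [d /= d0 H].
have mx : m < Num.min (m + d) 1 by rewrite lt_min ltrDl d0 m1.
have [|x /andP[mx1 mx2] xle] := ae_dense XY (ltW m0) mx; first by rewrite ge_min lexx orbT.
have xd : x < m + d by apply: lt_le_trans mx2 _; rewrite ge_min lexx.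
have := H x; rewrite /ball/= distrC gtr0_norm ?subr_gt0// ltrBlDl => /(_ xd mx1).
by rewrite ltNge xle.
Qed.

Lemma K_ae_eq X Y : K X -> K Y -> X = Y %[ae mu] -> forall m, Omega m -> X m = Y m :> R.
Proof.
move=> KX KY XY m Om; apply/eqP; rewrite eq_le; apply/andP; split.
  by apply: K_ae_le KX KY _ m Om; apply: ae_mu_impl XY => t /(_ I) ->.
by apply: K_ae_le KY KX _ m Om; apply: ae_mu_impl XY => t /(_ I) ->.
Qed.

Lemma Omega_nbhs m : Omega m -> \forall x \near m, Omega x.
Proof. by move=> Om; apply: open_nbhs_nbhs; split => //; exact: interval_open. Qed.

Lemma Omega_of_eq X Y : (forall m, Omega m -> X m = Y m :> R) -> Omega_of X `<=` Omega_of Y.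
Proof.
move=> XY m [Om H]; split => //.
have HO := Omega_nbhs Om; near=> x; rewrite -!XY//; last by near: x.
by near: x.
Unshelve. all: by end_near. Qed.

Lemma K_D X Y : K X -> K Y -> K (X + Y).
Proof.
move=> [X1 X2] [Y1 Y2]; split=> [x y Ox Oy xy|m Om].
  by apply: lerD; [exact: X1|exact: Y1].
by apply: (@cvgD _ R^o); [exact: X2|exact: Y2].
Qed.

Lemma K_Z a X : 0 <= a -> K X -> K (a *: X).
Proof.
move=> a0 [X1 X2]; split=> [x y Ox Oy xy|m Om].
  exact: (ler_wpM2l a0 (X1 x y Ox Oy xy)).
by apply: (cvgM (cvg_cst a) (X2 m Om)).
Qed.

Lemma K_0 : K 0.
Proof. by split=> // m Om; exact: cvg_cst. Qed.

Lemma K_cst c : K (c *: oneL2).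
Proof.
have E : (fun x => (c *: oneL2 : L2) x : R) = fun=> c.
  by apply/funext => x; rewrite -[LHS]/(c * (oneL2 x : R)) oneE mulr1.
split=> [x y _ _ _|m _].
  have e z : (c *: oneL2 : L2) z = c by rewrite (congr1 (fun h => h z) E).
  by rewrite !e.
rewrite E (_ : (c *: oneL2 : L2) m = c :> R) ?(congr1 (fun h => h m) E)//.
exact: cvg_cst.
Qed.

Lemma mkL2_aeE f U : measurable_fun setT (f : T -> R) -> {ae mu, forall m, f m = U m} ->
  forall m, mkL2 f m = f m.
Proof.
move=> mf fU.
suff H : (f : T -> R) \in Lfun mu 2%:E.
  by apply: (@mkL2_val _ _ (Lfun_Sub (lee1n 2 : (1 <= 2%:E :> \bar R)%E) H)).
apply: sq_integrable_Lfun => //; apply/integrableP; split.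
  by apply/measurable_EFinP; exact: measurable_funX.
rewrite (_ : (\int[mu]_x _ = \int[mu]_x `|(U x * U x)%R%:E|)%E).
  by have /integrableP[] := integrable_prod U U.
apply: ae_eq_integral => //.
- by apply: measurableT_comp => //; apply/measurable_EFinP; exact: measurable_funX.
- by apply: measurableT_comp => //; apply/measurable_EFinP; exact: measurable_funM.
- by apply: ae_mu_impl fU => m Um _; rewrite /= Um expr2.
Qed.

(** Such an [f] may be unbounded near the ends of the interval, so it need not extend to
    a monotone function on the line; it is the pointwise limit of the extensions by
    constants of its restrictions to smaller intervals. *)
Lemma nondecreasing_measurable_Omega (f : R -> R) :
  (forall x y, Omega x -> Omega y -> x <= y -> f x <= f y) ->
  measurable_fun setT ((fun x => f x * \1_(@Omega R) x) : T -> R).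
Proof.
move=> fnd.
pose e n : R := (n.+2)%:R^-1.
have e0 n : 0 < e n by rewrite invr_gt0.
have e1 n : e n <= 1 - e n.
  rewrite lerBrDr -mulr2n -mulr_natr /e mulrC ler_pdivrMr// mul1r ler_nat//.
pose cl n (x : R) := Num.max (e n) (Num.min x (1 - e n)).
have Ocl n x : Omega (cl n x).
  apply/OmegaE; rewrite /cl lt_max e0 gt_max; split=> //.
  rewrite (le_lt_trans (e1 n)) ?gtrBl// ?e0//= gt_min gtrBl e0 orbT.
  by [].
pose fn n (x : T) : R := f (cl n x) * \1_(@Omega R) x.
have mfn n : measurable_fun setT (fn n).
  apply: measurable_funM; last by apply: measurable_indic; exact: measurable_itv.
  apply: nondecreasing_measurable => // x y xy; apply: fnd => //.
  by rewrite /cl; apply: le_max2 => //; exact: le_min2.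
apply: (measurable_fun_cvg mfn) => x _; rewrite /fn.
have [Ox|nOx] := pselect (Omega x); last first.
  by rewrite indicE memNset// mulr0; under eq_fun do rewrite mulr0; exact: cvg_cst.
apply: (@cvg_trans _ ((fun=> f x * \1_(@Omega R) x) @ \oo)); last exact: cvg_cst.
apply: near_eq_cvg.
have [x0 x1] := (OmegaE x).1 Ox.
have small d : 0 < d -> \forall n \near \oo, e n < d.
  move=> d0; near=> n; apply: (@le_lt_trans _ _ (n.+1%:R^-1)).
    by rewrite lef_pV2 ?posrE// ler_nat.
  by near: n; apply: near_infty_natSinv_lt (PosNum d0).
have := small _ x0; have : 0 < 1 - x by rewrite subr_gt0.
move=> /small h1 h2; near=> n.
have -> // : cl n x = x.
rewrite /cl min_l; last first.
  by rewrite lerBrDl -lerBrDr; apply: ltW; near: n.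
by rewrite max_r//; apply: ltW; near: n.
Unshelve. all: by end_near. Qed.

(** A monotone almost everywhere limit has a right-continuous representative: its
    right limits along the full-measure set of convergence.  The two functions differ
    only where that representative jumps, which is a countable set. *)
Lemma K_complete : ncomplete ipL2 K.
Proof.
move=> x Kx /L2_ae_subsequence[U [k [_ xU ae]]].
pose P m := Omega m /\ x (k n) m @[n --> \oo] --> (U m : R).
have aeP : {ae mu, forall m, Omega m -> P m}.
  by apply: ae_mu_impl ae => m h Om; split.
have Pnd y z : P y -> P z -> y <= z -> U y <= U z :> R.
  move=> [Oy cy] [Oz cz] yz; apply: (ler_cvg_to cy cz); near=> n.
  by apply: K_nondecreasing yz => //; exact: Kx.
have Pdense a b : 0 <= a -> a < b -> b <= 1 -> exists2 z, a < z < b & P z.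
  move=> a0 ab b1; have [z zab Pz] := ae_dense aeP a0 ab b1.
  exists z => //; apply: Pz; move: zab => /andP[az zb].
  by apply/OmegaE; split; [exact: le_lt_trans az|exact: lt_le_trans b1].
pose A m := [set (U z : R) | z in [set z | P z /\ m < z]].
pose f m := inf (A m).
have Alb m : Omega m -> has_inf (A m).
  move=> /OmegaE[m0 m1]; split.
    have [z /andP[mz _] Pz] := Pdense m 1 (ltW m0) m1 (lexx 1).
    by exists (U z); exists z.
  have [z /andP[z0 zm] Pz] := Pdense 0 m (lexx 0) m0 (ltW m1).
  exists (U z) => _ [y [Py my] <-]; apply: Pnd => //.
  by apply: ltW; apply: lt_trans my.
have fle m z : Omega m -> P z -> m < z -> f m <= U z.
  by move=> Om Pz mz; apply: ge_inf; [exact: (Alb m Om).2|exists z].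
have lef m c : Omega m -> (forall z, P z -> m < z -> c <= U z) -> c <= f m.
  move=> Om h; apply: lb_le_inf; first exact: (Alb m Om).1.
  by move=> _ [z [Pz mz] <-]; exact: h.
have fnd y z : Omega y -> Omega z -> y <= z -> f y <= f z.
  by move=> Oy Oz yz; apply: lef => // w Pw zw; apply: fle => //; exact: le_lt_trans zw.
have Uf m : P m -> U m <= f m.
  by move=> Pm; apply: lef => [|z Pz mz]; [exact: Pm.1|apply: Pnd => //; exact: ltW].
have fcont m : Omega m -> f y @[y --> m^'+] --> f m.
  move=> Om; have [m0 m1] := (OmegaE m).1 Om.
  apply/cvgrPdist_le => e e0.
  have [_ [z [Pz mz] <-] zlt] := inf_adherent e0 (Alb m Om).
  near=> y.
  have my : m < y by near: y; exact: nbhs_right_gt.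
  have yz : y < z by near: y; exact: nbhs_right_lt.
  have Oy : Omega y.
    have [_ z1] := (OmegaE z).1 Pz.1.
    by apply/OmegaE; split; [exact: lt_trans my|exact: lt_trans yz z1].
  have h1 := fnd _ _ Om Oy (ltW my); have h2 := fle _ _ Oy Pz yz.
  rewrite distrC ger0_norm ?subr_ge0// lerBlDl; apply: le_trans h2 _.
  by apply: ltW; rewrite addrC in zlt; rewrite addrC.
have fU : {ae mu, forall m, Omega m -> f m = U m}.
  have cJ : countable [set m | P m /\ (U m : R) < f m].
    apply: (@countable_jumps _ _ (fun m => U m : R) f) => [z []//|y z [Py _] [Pz _] yz].
    by apply: fle => //; exact: Py.1.
  apply: ae_mu_impl2 aeP (ae_countable cJ) => m Pm nJ Om.
  apply/eqP; rewrite eq_le Uf ?andbT; last exact: Pm.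
  by rewrite leNgt; apply/negP => h; apply: nJ; split => //; exact: Pm.
have f'E m : Omega m -> f m * \1_(@Omega R) m = f m.
  by move=> Om; rewrite indicE mem_set// mulr1.
have f'U : {ae mu, forall m, f m * \1_(@Omega R) m = U m}.
  have O : {ae mu, forall m : R, Omega m} by exact: ae_Omega.
  by apply: ae_mu_impl2 fU O => m h Om; rewrite f'E// h.
have E := mkL2_aeE (nondecreasing_measurable_Omega fnd) f'U.
exists (mkL2 (fun m => f m * \1_(@Omega R) m)).
  split=> [y z Oy Oz yz|m Om]; first by rewrite !E !f'E//; exact: fnd.
  rewrite E f'E//; apply: cvg_trans (fcont m Om); apply: near_eq_cvg.
  have [m0 m1] := (OmegaE m).1 Om; near=> y; rewrite E f'E//.
  have my : m < y by near: y; exact: nbhs_right_gt.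
  apply/OmegaE; split; first exact: lt_trans my.
  by near: y; exact: nbhs_right_lt.
apply: tends_congr xU => [i|]; first by rewrite subrr nrm0.
by apply/nrm0_ae; apply: ae_mu_impl f'U => m h _; rewrite E.
Unshelve. all: by end_near. Qed.

Lemma K_convex : nconvex K.
Proof.
move=> X Y t KX KY /andP[t0 t1].
have -> : X + t *: (Y - X) = (1 - t) *: X + t *: Y.
  by rewrite scalerBr scalerBl scale1r addrA addrAC.
by apply: K_D; apply: K_Z; rewrite ?subr_ge0.
Qed.

End Cone.

(** ** Constancy intervals and ramps *)

Section RealFacts.
Context {R : realType}.
Implicit Types (O : set R) (f : R -> R) (a b m x y z : R).

Lemma component_left O m z : open O -> O m -> z < m -> ~ O z ->
  exists a, [/\ z <= a, a < m, forall x, a < x -> x < m -> O x & ~ O a].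
Proof.
move=> oO Om zm nOz.
pose A := [set a | a < m /\ forall x, a < x -> x < m -> O x].
have nb x : O x -> exists2 d, 0 < d & forall y, `|x - y| < d -> O y.
  by move=> Ox; have /nbhs_ballP[d /= d0 H] := open_nbhs_nbhs (conj oO Ox); exists d.
have Az a : A a -> z <= a.
  by move=> [am h]; rewrite leNgt; apply/negP => az; apply: nOz; apply: h.
have [d d0 Hd] := nb _ Om.
have Ad : A (m - d).
  split; first by rewrite ltrBlDr ltrDl.
  by move=> x h1 h2; apply: Hd; rewrite gtr0_norm ?subr_gt0//; lra.
have hA : has_inf A by split; [exists (m - d)|exists z].
have am : inf A < m.
  by apply: le_lt_trans (ge_inf hA.2 Ad) _; rewrite ltrBlDr ltrDl.
have Oright x : inf A < x -> x < m -> O x.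
  move=> ax xm; have xa : 0 < x - inf A by rewrite subr_gt0.
  have [c [cm hc] cx] := inf_adherent xa hA.
  by apply: hc => //; move: cx; rewrite addrC subrK.
exists (inf A); split => //.
  by apply: lb_le_inf; [exact: hA.1|exact: Az].
move=> /nb[e e0 He].
have : A (inf A - e / 2).
  split; first by lra.
  move=> x h1 h2; have [ax|xa] := ltP (inf A) x; first exact: Oright.
  by apply: He; rewrite ger0_norm ?subr_ge0//; lra.
by move=> /(ge_inf hA.2); lra.
Qed.

Lemma component_right O m z : open O -> O m -> m < z -> ~ O z ->
  exists b, [/\ b <= z, m < b, forall x, m < x -> x < b -> O x & ~ O b].
Proof.
move=> oO Om mz nOz.
have oO' : open (-%R @^-1` O).
  by apply: open_comp => // x _; exact: opp_continuous.
have h1 : (-%R @^-1` O) (- m) by rewrite /= opprK.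
have h2 : ~ (-%R @^-1` O) (- z) by rewrite /= opprK.
have h3 : - z < - m by rewrite ltrN2.
have [a [za am Oa nOa]] := component_left oO' h1 h3 h2.
exists (- a); split => //; [by rewrite lerNl|by rewrite ltrNr|].
move=> x mx xa; rewrite -(opprK x); apply: Oa; first by rewrite ltrNr.
by rewrite ltrN2.
Qed.

Lemma locally_constant_itv f a b : (forall x, a < x -> x < b -> \forall y \near x, f y = f x) ->
  forall x y, a < x -> y < b -> x <= y -> f x = f y.
Proof.
move=> fl x y ax yb xy.
have dx z : x <= z -> z <= y -> is_derive z (1 : R) f 0.
  move=> xz zy; have h : \forall t \near z, cst (f z) t = f t.
    have h' : \forall t \near z, f t = f z.
      by apply: fl; [exact: lt_le_trans xz|exact: le_lt_trans yb].
    by apply: filterS h' => t ->.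
  exact: (near_eq_is_derive h (is_derive_cst _ _ _)).
have [z|z|c _] := @MVT_segment R f (fun=> 0) x y xy.
- by rewrite in_itv/= => /andP[/ltW h1 /ltW h2]; exact: dx.
- apply: derivable_within_continuous => w; rewrite in_itv/= => /andP[h1 h2].
  by have [] := dx _ h1 h2.
by rewrite mul0r => /subr0_eq.
Qed.

(** A ramp of slope [n] starting at [a] and saturating at height one. *)
Definition ramp (n a x : R) : R := Num.min 1 (Num.max 0 (n * (x - a))).

Lemma ramp_ge0 n a x : 0 <= ramp n a x.
Proof. by rewrite /ramp le_min ler01 le_max lexx. Qed.

Lemma ramp_le1 n a x : ramp n a x <= 1.
Proof. by rewrite /ramp ge_min lexx. Qed.

Lemma ramp_nondecreasing n a x y : 0 <= n -> x <= y -> ramp n a x <= ramp n a y.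
Proof.
move=> n0 xy; rewrite /ramp; apply: le_min2 => //; apply: le_max2 => //.
by apply: ler_wpM2l => //; rewrite lerD2r.
Qed.

Lemma ramp_slope n a x y : 0 <= n -> x <= y -> ramp n a y - ramp n a x <= n * (y - x).
Proof.
move=> n0 xy; have : 0 <= n * (y - x) by rewrite mulr_ge0 ?subr_ge0.
have -> : n * (y - x) = n * (y - a) - n * (x - a) by ring.
rewrite /ramp; move: (n * (y - a)) (n * (x - a)) => u v uv.
have cl (w : R) : [\/ w <= 0 /\ Num.min 1 (Num.max 0 w) = 0,
    [/\ 0 <= w, w <= 1 & Num.min 1 (Num.max 0 w) = w] |
    1 <= w /\ Num.min 1 (Num.max 0 w) = 1].
  have [w0|w0] := leP w 0; first by constructor 1; rewrite min_r ?ler01.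
  have [w1|w1] := leP w 1; first by constructor 2; split => //; exact: ltW.
  by constructor 3; split => //; exact: ltW.
by case: (cl u) => [[h ->]|[h h' ->]|[h ->]]; case: (cl v) => [[k ->]|[k k' ->]|[k ->]]; lra.
Qed.

Lemma ramp_lipschitz n a x y : 0 <= n -> `|ramp n a x - ramp n a y| <= n * `|x - y|.
Proof.
move=> n0; wlog xy : x y / x <= y.
  move=> W; case: (leP x y) => h; first exact: W.
  by rewrite distrC (distrC x); apply: W; exact: ltW.
rewrite distrC (distrC x) !ger0_norm ?subr_ge0//; first exact: ramp_slope.
exact: ramp_nondecreasing.
Qed.

Lemma ramp_eq0 n a x : 0 <= n -> x <= a -> ramp n a x = 0.
Proof.
move=> n0 xa; rewrite /ramp max_l ?min_r ?ler01//.
by rewrite mulr_ge0_le0// subr_le0.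
Qed.

Lemma ramp_eq1 n a x : 1 <= n * (x - a) -> ramp n a x = 1.
Proof. by move=> h; rewrite /ramp min_l// le_max h orbT. Qed.

End RealFacts.

(** * Normal vectors and constancy intervals *)

Section Duality.
Context {R : realType}.
Local Notation L2 := (L2 R).
Local Notation mu := (@muOmega R).
Local Notation T := (measurableTypeR R).
Local Notation K := (@Kcone R).
Local Notation ip := (@ipL2 R).
Implicit Types (U V W X Y Z p : L2) (a b c m : R).

Lemma inner2Dr U V W : inner2 U (V + W) = inner2 U V + inner2 U W.
Proof. exact: (sipDr ip). Qed.
Lemma inner2Nr U V : inner2 U (- V) = - inner2 U V.
Proof. exact: (sipNr ip). Qed.
Lemma inner2Nl U V : inner2 (- U) V = - inner2 U V.
Proof. exact: (sipNl ip). Qed.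
Lemma inner2Zr a U V : inner2 U (a *: V) = a * inner2 U V.
Proof. exact: (sipZr ip). Qed.
Lemma inner20l U : inner2 0 U = 0.
Proof. exact: (sip0l ip). Qed.
Lemma inner20r U : inner2 U 0 = 0.
Proof. exact: (sip0r ip). Qed.
Definition inner2E :=
  (@inner2Dl R, inner2Dr, inner2Nl, inner2Nr, @inner2Zl R, inner2Zr, inner20l, inner20r).

Lemma subdiff_orth X W : K X -> subdiff X W -> inner2 W X = 0.
Proof.
move=> KX WX; have h0 := WX _ (@K_0 R); have h2 := WX _ (K_D KX KX).
have e0 : inner2 W (0 - X) = - inner2 W X by rewrite sub0r inner2E.
have e2 : inner2 W (X + X - X) = inner2 W X by rewrite addrK.
rewrite e0 oppr_le0 in h0; rewrite e2 in h2.
by apply/eqP; rewrite eq_le h2 h0.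
Qed.

Lemma subdiff_polar X W Z : K X -> subdiff X W -> K Z -> inner2 W Z <= 0.
Proof.
move=> KX WX KZ; have := WX _ KZ; have h := subdiff_orth KX WX.
by rewrite !inner2E h subr0.
Qed.

Lemma subdiffI X W : inner2 W X = 0 -> (forall Z, K Z -> inner2 W Z <= 0) -> subdiff X W.
Proof. by move=> h H Z KZ; rewrite !inner2E h subr0; exact: H. Qed.

Lemma subdiff_one X W : K X -> subdiff X W -> inner2 W oneL2 = 0.
Proof.
move=> KX WX; have h1 := subdiff_polar KX WX (K_cst 1).
have h2 := subdiff_polar KX WX (K_cst (-1)).
by rewrite inner2E in h1; rewrite inner2E in h2; lra.
Qed.

(** Both [ramp o X] and [X - n^-1 ramp o X] are nondecreasing. *)
Lemma subdiff_ramp X W n a : K X -> subdiff X W -> 0 < n ->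
  inner2 W (mkL2 (fun x => ramp n a (X x))) = 0.
Proof.
move=> KX WX n0; have n0' := ltW n0.
have mr : measurable_fun setT (fun x : T => ramp n a (X x)).
  apply: measurable_minr => //; apply: measurable_maxr => //.
  by apply: measurable_funM => //; exact: measurable_funB.
have E : forall x, mkL2 (fun x => ramp n a (X x)) x = ramp n a (X x).
  by apply: (@mkL2_boundedE _ _ 1) => // x; rewrite ger0_norm ?ramp_ge0// ramp_le1.
set Z := mkL2 _ in E *.
have Zr m : Omega m -> Z x @[x --> m^'+] --> (Z m : R).
  move=> Om; apply: (@squeeze_cvgr _ _ _ _ (fun x => Z m - n * `|X x - X m|)
    (fun x => Z m + n * `|X x - X m|)).
  - near=> x; rewrite !E; have := ramp_lipschitz a (X x) (X m) n0'.
    by rewrite ler_norml; move: (n * _) (ramp _ _ _) (ramp _ _ _) => u v w /andP[]; lra.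
  - have h : n * `|X x - X m : R| @[x --> m^'+] --> n * `|X m - X m : R|.
      apply: cvgM; first exact: cvg_cst.
      apply: (@cvg_norm _ R^o); apply: (@cvgB _ R^o); last exact: cvg_cst.
      exact: KX.2.
    rewrite subrr normr0 mulr0 in h.
    by rewrite -[X in _ --> X]subr0; apply: cvgB => //; exact: cvg_cst.
  - have h : n * `|X x - X m : R| @[x --> m^'+] --> n * `|X m - X m : R|.
      apply: cvgM; first exact: cvg_cst.
      apply: (@cvg_norm _ R^o); apply: (@cvgB _ R^o); last exact: cvg_cst.
      exact: KX.2.
    rewrite subrr normr0 mulr0 in h.
    by rewrite -[X in _ --> X]addr0; apply: cvgD => //; exact: cvg_cst.
have KZ : K Z.
  split=> // x y Ox Oy xy; rewrite !E; apply: ramp_nondecreasing => //.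
  exact: K_nondecreasing.
have KZ' : K (X - n^-1 *: Z).
  split=> [x y Ox Oy xy|m Om].
    rewrite -[X in X <= _]/(X x - n^-1 * Z x) -[X in _ <= X]/(X y - n^-1 * Z y).
    have xy' := K_nondecreasing KX Ox Oy xy.
    have := ramp_slope a n0' xy'; rewrite !E => h.
    have : n^-1 * (ramp n a (X y) - ramp n a (X x)) <= X y - X x.
      by rewrite ler_pdivrMl.
    by rewrite mulrBr; lra.
  rewrite -[X in _ --> X]/(X m - n^-1 * Z m : R).
  apply: (@cvgB _ R^o); first exact: KX.2.
  by apply: (cvgM (cvg_cst _) (Zr m Om)).
have h1 := subdiff_polar KX WX KZ; have h2 := subdiff_polar KX WX KZ'.
rewrite !inner2E (subdiff_orth KX WX) sub0r oppr_le0 in h2.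
apply/eqP; rewrite eq_le h1/=; move: h2; rewrite pmulr_rge0// invr_gt0.
exact.
Unshelve. all: by end_near. Qed.

Lemma subdiff_ramp_limit X W U (s : nat -> R) : K X -> subdiff X W ->
  (forall x, Omega x -> \forall k \near \oo, ramp k.+1%:R (s k) (X x) = U x) ->
  inner2 W U = 0.
Proof.
move=> KX WX H.
pose f k := mkL2 (fun x => ramp k.+1%:R (s k) (X x)).
have fE k x : f k x = ramp k.+1%:R (s k) (X x).
  apply: (@mkL2_boundedE _ (fun x => ramp k.+1%:R (s k) (X x)) 1).
    apply: measurable_minr => //; apply: measurable_maxr => //.
    by apply: measurable_funM => //; exact: measurable_funB.
  by move=> y; rewrite ger0_norm ?ramp_ge0// ramp_le1.
have : inner2 (f k) W @[k --> \oo] --> inner2 U W.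
  apply: (@inner2_dominated _ f U 0 W 1) => [n m _|m Om].
    by rewrite (_ : (0 : L2) m = 0)// normr0 add0r fE ger0_norm ?ramp_ge0// ramp_le1.
  apply: (@cvg_trans _ ((fun=> U m : R) @ \oo)); last exact: cvg_cst.
  by apply: near_eq_cvg; apply: filterS (H m Om) => k <-; rewrite fE.
have -> : (fun k => inner2 (f k) W) = fun=> 0.
  by apply/funext => k; rewrite inner2C; exact: subdiff_ramp.
by rewrite inner2C => h; rewrite -(cvg_lim (@Rhausdorff R) h) lim_cst.
Qed.

Lemma not_Omega_of X m : K X -> Omega m -> ~ Omega_of X m ->
  (forall y, Omega y -> m < y -> X m < X y :> R) \/ (forall y, Omega y -> y < m -> X y < X m :> R).
Proof.
move=> KX Om nO; apply: contrapT => /not_orP[/existsNP[y1 h1] /existsNP[y2 h2]].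
move/not_implyP: h1 => [Oy1 /not_implyP[my1 /negP]]; rewrite -leNgt => h1.
move/not_implyP: h2 => [Oy2 /not_implyP[my2 /negP]]; rewrite -leNgt => h2.
apply: nO; split => //; near=> x.
have xy1 : x <= y1 by apply: ltW; near: x; exact: lt_nbhsl.
have xy2 : y2 <= x by apply: ltW; near: x; exact: lt_nbhsr.
have Ox : Omega x by near: x; exact: Omega_nbhs.
apply/eqP; rewrite eq_le; apply/andP; split.
  by apply: le_trans h1; exact: K_nondecreasing.
by apply: le_trans h2 _; exact: K_nondecreasing.
Unshelve. all: by end_near. Qed.

(** [X] increases strictly on one side of [m], so ramps of [X] that steepen at the level
    [X m] converge to [ind m], up to the value at [m]. *)
Lemma subdiff_ind X W m : K X -> subdiff X W -> Omega m -> ~ Omega_of X m ->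
  inner2 W (ind m) = 0.
Proof.
move=> KX WX Om nO.
have small (d : R) : 0 < d -> \forall k \near \oo, 1 <= k.+1%:R * d.
  move=> d0; near=> k; rewrite -ler_pdivrMr// div1r -[leLHS]invrK -[leRHS]invrK.
  rewrite lef_pV2 ?posrE ?invr_gt0// invrK; apply: ltW; near: k.
  exact: (near_infty_natSinv_lt (PosNum d0)).
have [H|H] := not_Omega_of KX Om nO.
- have mU : measurable_fun setT (fun x : T => (m < x)%R%:R : R).
    rewrite (_ : (fun x => _) = \1_(`]m, +oo[)).
      by apply: measurable_indic; exact: measurable_itv.
    by apply/funext => y; rewrite indicE mem_setE in_itv/= andbT.
  have UE : forall x, mkL2 (fun x => (m < x)%R%:R) x = (m < x)%R%:R.
    by apply: (@mkL2_boundedE _ _ 1) => // x; case: (m < x); rewrite ?normr0 ?normr1 ?ler01.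
  rewrite inner2C (@inner2_ae _ _ (mkL2 (fun x => (m < x)%R%:R))).
    rewrite inner2C; apply: (subdiff_ramp_limit (s := fun=> X m) KX WX) => x Ox.
    rewrite UE; have [mx|xm] := ltP m x.
      have d0 : 0 < X x - X m :> R by rewrite subr_gt0; exact: H.
      by apply: filterS (small _ d0) => k; exact: ramp_eq1.
    by apply: nearW => k; apply: ramp_eq0 => //; exact: K_nondecreasing.
  by apply: ae_mu_impl (@ae_neq R m) => x xm _; rewrite UE indE lt_neqAle eq_sym; case: eqVneq xm.
- apply: (subdiff_ramp_limit (s := fun k => X m - k.+1%:R^-1) KX WX) => x Ox.
  rewrite indE; have [mx|xm] := leP m x.
    apply: nearW => k; apply: ramp_eq1; rewrite opprB addrCA mulrDr mulfV// lerDl.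
    by rewrite mulr_ge0// subr_ge0; exact: K_nondecreasing.
  have d0 : 0 < X m - X x :> R by rewrite subr_gt0; exact: H.
  apply: filterS (small _ d0) => k hk; apply: ramp_eq0 => //.
  have : (k.+1%:R^-1 : R) <= X m - X x by rewrite -[leLHS]mul1r ler_pdivrMr// mulrC.
  by move: (X x : R) (X m : R) (_^-1) => u v w; lra.
Unshelve. all: by end_near. Qed.

(** ** Kinks *)

(** A mean-zero step function, constant on each side of [m] inside [[a, b]], positive on
    the left and negative on the right: it is normal at every [X] that is constant on
    [[a, b]], and these vectors together detect constancy on [[a, b]]. *)
Definition kink a b m : L2 :=
  ((b - m) / (b - a)) *: ind a + ((m - a) / (b - a)) *: ind b - ind m.

Lemma kinkE a b m x : kink a b m x =
  (b - m) / (b - a) * (a <= x)%R%:R + (m - a) / (b - a) * (b <= x)%R%:R - (m <= x)%R%:R.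
Proof. by rewrite -(indE a) -(indE b) -(indE m). Qed.

Lemma ind_one c : 0 <= c -> c <= 1 -> inner2 (ind c) oneL2 = 1 - c.
Proof.
move=> c0 c1; have m1 : measurable (`[c, +oo[%classic : set R) by exact: measurable_itv.
have -> : inner2 (ind c) oneL2 = fine (mu (`[c, +oo[%classic : set R)).
  rewrite /inner2 /Rintegral -(setIT `[c, +oo[%classic) -integral_indic//; congr fine.
  apply: eq_integral => x _; rewrite indE oneE mulr1 indicE mem_setE in_itv/= andbT.
  by [].
rewrite /muOmega/= /mrestr.
have [c0'|c0'] := ltP 0 c.
  have -> : `[c, +oo[ `&` (@Omega R) = `[c, 1[%classic.
    apply/seteqP; split=> x /=; rewrite /Omega/= !in_itv/= andbT.
      by move=> [-> /andP[_ ->]].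
    by move=> /andP[cx ->]; rewrite (lt_le_trans c0' cx).
  rewrite lebesgue_measure_itv/= lte_fin; case: ltP => //= h.
  by apply/esym/eqP; rewrite subr_eq0 eq_le h.
have -> : c = 0 by apply/eqP; rewrite eq_le c0' c0.
have -> : `[0, +oo[ `&` (@Omega R) = `]0, 1[%classic.
  apply/seteqP; split=> x /=; rewrite /Omega/= !in_itv/= andbT; first by case.
  by move=> /andP[x0 ->]; rewrite x0 ltW.
by rewrite lebesgue_measure_itv/= lte_fin ltr01 oppr0 adde0 addr0.
Qed.

Lemma kink_one a b m : 0 <= a -> a < m -> m < b -> b <= 1 -> inner2 (kink a b m) oneL2 = 0.
Proof.
move=> a0 am mb b1; have ab := lt_trans am mb.
rewrite !inner2E !ind_one//; [|lra..].
have : b - a != 0 by rewrite subr_eq0 gt_eqF.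
by move=> h; field.
Qed.

Lemma kink_weights a b m : a < m -> m < b ->
  [/\ 0 <= (b - m) / (b - a), 0 <= (m - a) / (b - a) & (b - m) / (b - a) + (m - a) / (b - a) = 1].
Proof.
move=> am mb; have ab := lt_trans am mb; split.
- by apply: divr_ge0; rewrite subr_ge0 ltW.
- by apply: divr_ge0; rewrite subr_ge0 ltW.
- have : b - a != 0 by rewrite subr_eq0 gt_eqF.
  by move=> h; field.
Qed.

Lemma kink_values a b m x : a < m -> m < b ->
  [\/ x < a /\ kink a b m x = 0 :> R,
      [/\ a <= x, x < m & kink a b m x = (b - m) / (b - a) :> R],
      [/\ m <= x, x < b & kink a b m x = - ((m - a) / (b - a)) :> R] |
      b <= x /\ kink a b m x = 0 :> R].
Proof.
move=> am mb; have [_ _ s] := kink_weights am mb.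
rewrite kinkE; have [xa|ax] := ltP x a.
  have -> : (b <= x)%R = false by apply/negbTE; rewrite -ltNge (lt_trans xa)// (lt_trans am).
  have -> : (m <= x)%R = false by apply/negbTE; rewrite -ltNge (lt_trans xa).
  by constructor 1; rewrite !mulr0 addr0 subr0.
have [xm|mx] := ltP x m.
  have -> : (b <= x)%R = false by apply/negbTE; rewrite -ltNge (lt_trans xm).
  by constructor 2; rewrite mulr0 mulr1 addr0 subr0.
have [xb|bx] := ltP x b.
  by constructor 3; rewrite mulr0 mulr1 addr0; split => //; apply/eqP;
    rewrite subr_eq -[true%:R]/(1 : R) -s addrCA addNr addr0.
by constructor 4; rewrite !mulr1 s subrr.
Qed.

Lemma kink_polar a b m Z : 0 <= a -> a < m -> m < b -> b <= 1 -> K Z ->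
  inner2 (kink a b m) Z <= 0.
Proof.
move=> a0 am mb b1 KZ.
have Om : Omega m by apply/OmegaE; split; [exact: le_lt_trans am|exact: lt_le_trans b1].
have -> : 0 = inner2 (kink a b m) (Z m *: oneL2) by rewrite inner2E kink_one// mulr0.
apply: inner2_le => x Ox.
have -> : (Z m *: oneL2 : L2) x = Z m :> R.
  by rewrite -[LHS]/(Z m * oneL2 x : R) oneE mulr1.
have [w1 w2 _] := kink_weights am mb.
have [[_ ->]|[_ xm ->]|[mx _ ->]|[_ ->]] := kink_values x am mb; rewrite ?mul0r//.
  by apply: ler_wpM2l => //; apply: K_nondecreasing => //; exact: ltW.
by apply: ler_wnM2l; [rewrite oppr_le0|exact: K_nondecreasing].
Qed.

Lemma kink_const a b m U c : 0 <= a -> a < m -> m < b -> b <= 1 ->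
  {ae mu, forall x : R, `]a, b[%classic x -> U x = c} -> inner2 U (kink a b m) = 0.
Proof.
move=> a0 am mb b1 Uc.
have -> : inner2 U (kink a b m) = inner2 (c *: oneL2) (kink a b m).
  have E : inner2 (U - c *: oneL2) (kink a b m) = 0.
    rewrite -(inner20l oneL2); rewrite /inner2 /Rintegral; congr fine.
    apply: ae_eq_integral => //.
    - by apply/measurable_EFinP; exact: measurable_funM.
    - by apply/measurable_EFinP; exact: measurable_funM.
    - apply: ae_mu_impl2 Uc (@ae_neq R a) => x Ux xa _; congr EFin.
      rewrite -[X in X * _]/(U x - c * oneL2 x) -[RHS]/(0 * oneL2 x) mul0r oneE mulr1.
      have [[_ ->]|[ax xm _]|[mx xb _]|[_ ->]] := kink_values x am mb; rewrite ?mulr0//.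
        rewrite Ux ?subrr ?mul0r// /= in_itv/= lt_neqAle ax (lt_trans xm mb) eq_sym !andbT.
        exact/eqP.
      by rewrite Ux ?subrr ?mul0r//= in_itv/= (lt_le_trans am mx) xb.
  by move: E; rewrite inner2Dl inner2Nl => /subr0_eq.
by rewrite inner2Zl inner2C kink_one// mulr0.
Qed.

Lemma Omega_of_itv X a b m : `]a, b[ `<=` Omega_of X -> a < m -> m < b -> 0 <= a /\ b <= 1.
Proof.
move=> H am mb; have [Om _] : Omega_of X m by apply: H; rewrite /= in_itv/= am mb.
have [m0 m1] := (OmegaE m).1 Om; split; rewrite leNgt; apply/negP => h.
  have [/OmegaE[]] : Omega_of X 0 by apply: H; rewrite /= in_itv/= h (lt_trans m0 mb).
  by rewrite ltxx.
have [/OmegaE[]] : Omega_of X 1 by apply: H; rewrite /= in_itv/= h (lt_trans am m1).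
by rewrite ltxx.
Qed.

Lemma Hspace_kink X U a b m : Hspace X U -> `]a, b[ `<=` Omega_of X -> a < m -> m < b ->
  inner2 U (kink a b m) = 0.
Proof.
move=> HU ab am mb; have [a0 b1] := Omega_of_itv ab am mb.
by have [c Uc] := HU a b ab; exact: kink_const Uc.
Qed.

(** Orthogonality to the kinks in [[a, b]] says that [U] minus its mean over [[a, b]],
    cut off outside, is orthogonal to every [ind m]. *)
Lemma kink_Hspace X U : (forall a b m, `]a, b[ `<=` Omega_of X -> a < m -> m < b ->
  inner2 U (kink a b m) = 0) -> Hspace X U.
Proof.
move=> H a b ab; have [ba|a_b] := leP b a.
  exists 0; apply: nearW => m /=; rewrite in_itv/= => /andP[h1 h2].
  by have := lt_trans h1 h2; rewrite ltNge ba.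
have mid : a < (a + b) / 2 /\ (a + b) / 2 < b by lra.
have [a0 b1] := Omega_of_itv ab mid.1 mid.2.
have ab0 : b - a != 0 by rewrite subr_eq0 gt_eqF.
pose chi := ind a - ind b.
have chiE x : chi x = (a <= x)%R%:R - (b <= x)%R%:R :> R by rewrite -(indE a) -(indE b).
have chi1 : inner2 oneL2 chi = b - a.
  by rewrite inner2C !inner2E !ind_one//; lra.
pose c := inner2 U chi / (b - a); exists c.
pose V := U - c *: oneL2.
have VE x : V x = U x - c :> R by rewrite -[LHS]/(U x - c * oneL2 x) oneE mulr1.
have Vchi : inner2 V chi = 0.
  by rewrite inner2Dl inner2Nl inner2Zl chi1 /c; field.
have Vk m : a < m -> m < b -> inner2 V (kink a b m) = 0.
  by move=> am mb; rewrite inner2Dl inner2Nl inner2Zl H// (inner2C oneL2) kink_one// mulr0 subr0.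
pose G := mkL2 (fun x => V x * chi x).
have GE x : G x = V x * chi x :> R.
  apply: (@mkL2E _ (fun x => V x * chi x) V 0); first exact: measurable_funM.
  move=> y; rewrite addr0 normrM chiE ler_piMr//.
  by case: (a <= y)%R; case: (b <= y)%R; rewrite ?subrr ?subr0 ?sub0r ?normrN ?normr0 ?normr1 ?ler01.
have G0 : nrm ip G = 0.
  apply: ind_total => [|m Om].
    rewrite -Vchi; apply: inner2_congr => x.
    by rewrite GE oneE mulr1.
  have [ma|am] := leP m a.
    rewrite -Vchi; apply: inner2_congr => x; rewrite GE indE chiE.
    have [mx|xm] := leP m x; first by rewrite mulr1.
    have xa : (a <= x)%R = false by apply/negbTE; rewrite -ltNge (lt_le_trans xm).
    have xb : (b <= x)%R = false by apply/negbTE; rewrite -ltNge (lt_trans _ a_b)// (lt_le_trans xm).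
    by rewrite xa xb subrr !mulr0.
  have [bm|mb] := leP b m.
    rewrite -(inner20r V); apply: inner2_congr => x; rewrite GE indE chiE -[X in _ = _ * X]/(0 : R) mulr0.
    have [mx|xm] := leP m x; last by rewrite mulr0.
    by rewrite (le_trans (ltW am) mx) (le_trans bm mx) subrr mulr0 mul0r.
  have [_ _ s] := kink_weights am mb.
  have -> : 0 = inner2 V (((b - m) / (b - a)) *: chi - kink a b m).
    by rewrite inner2Dr inner2Nr inner2Zr Vchi Vk// mulr0 subr0.
  apply: inner2_congr => x; rewrite GE indE -mulrA; congr (_ * _).
  rewrite -[RHS]/((b - m) / (b - a) * chi x - kink a b m x) kinkE chiE.
  have [mx|xm] := leP m x.
    rewrite (le_trans (ltW am) mx) !mulr1.
    move: s; move: (_ / _) (_ / _) => u v s.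
    have -> : v = 1 - u by lra.
    by case: (b <= x)%R; rewrite -?[true%:R]/(1 : R) -?[false%:R]/(0 : R); ring.
  have xb : (b <= x)%R = false by apply/negbTE; rewrite -ltNge (lt_trans xm).
  by rewrite xb !mulr0 addr0 !subr0 subrr.
have /nrm0_ae G0' : nrm ip (G - 0) = 0 by rewrite subr0.
apply: ae_mu_impl G0' => x /(_ I) + /=; rewrite in_itv/= => Gx /andP[ax xb].
have : G x = 0 :> R by exact: Gx.
have xb' : (b <= x)%R = false by apply/negbTE; rewrite -ltNge.
rewrite GE chiE (ltW ax) xb' subr0 mulr1 VE.
by move/subr0_eq.
Qed.

Lemma Omega_of_const X a b : `]a, b[ `<=` Omega_of X ->
  forall x y, a < x -> x < b -> a < y -> y < b -> X x = X y :> R.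
Proof.
move=> H.
have h x y : a < x -> y < b -> x <= y -> X x = X y :> R.
  apply: (@locally_constant_itv _ (fun x => X x : R) a b) => z az zb.
  by have [] : Omega_of X z by apply: H; rewrite /= in_itv/= az zb.
move=> x y ax xb ay yb; have [xy|yx] := leP x y; first exact: h.
by apply/esym/h => //; exact: ltW.
Qed.

Lemma Hspace_self X : Hspace X X.
Proof.
move=> a b ab; exists (X ((a + b) / 2)); apply: nearW => x /=; rewrite in_itv/= => /andP[ax xb].
by apply: (Omega_of_const ab) => //; lra.
Qed.

Lemma kink_subdiff X a b m : `]a, b[ `<=` Omega_of X -> a < m -> m < b ->
  subdiff X (kink a b m).
Proof.
move=> ab am mb; have [a0 b1] := Omega_of_itv ab am mb.
apply: subdiffI => [|Z KZ]; last exact: kink_polar.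
by rewrite inner2C; apply: Hspace_kink ab am mb; exact: Hspace_self.
Qed.

(** ** The space of functions constant on the constancy intervals *)

Lemma Hspace_D X U V : Hspace X U -> Hspace X V -> Hspace X (U + V).
Proof. by move=> HU HV; apply: kink_Hspace => a b m ab am mb; rewrite inner2Dl !(Hspace_kink _ ab)// addr0. Qed.

Lemma Hspace_Z X a U : Hspace X U -> Hspace X (a *: U).
Proof. by move=> HU; apply: kink_Hspace => c b m ab am mb; rewrite inner2Zl !(Hspace_kink _ ab)// mulr0. Qed.

Lemma Hspace_N X U : Hspace X U -> Hspace X (- U).
Proof. by rewrite -scaleN1r; exact: Hspace_Z. Qed.

Lemma Hspace_0 X : Hspace X 0.
Proof. by apply: kink_Hspace => c b m ab am mb; rewrite inner20l. Qed.

Lemma Hspace_one X : Hspace X oneL2.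
Proof. by move=> a b _; exists 1; apply: nearW => m _; rewrite oneE. Qed.

Lemma Hspace_ind X m : ~ Omega_of X m -> Hspace X (ind m).
Proof.
move=> nO a b ab; have [ma|am] := leP m a.
  exists 1; apply: nearW => x /=; rewrite in_itv/= => /andP[ax xb].
  by rewrite indE (le_trans ma (ltW ax)).
exists 0; apply: nearW => x /=; rewrite in_itv/= => /andP[ax xb].
rewrite indE; have [mx|//] := leP m x; exfalso; apply: nO; apply: ab.
by rewrite /= in_itv/= am (le_lt_trans mx xb).
Qed.

Lemma Hspace_complete X : ncomplete ip (Hspace X).
Proof.
move=> x Hx cx; have [U _ xU] := L2_complete (fun=> I) cx; exists U => //.
apply: kink_Hspace => a b m ab am mb.
have h : ip (x i) (kink a b m) @[i --> \oo] --> ip U (kink a b m).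
  by apply: (tends_sip xU); exact: tends_cst.
have e : (fun i => ip (x i) (kink a b m)) = fun=> 0.
  by apply/funext => i; exact: Hspace_kink (Hx i) ab am mb.
by rewrite e in h; rewrite -[LHS](cvg_lim (@Rhausdorff R) h) lim_cst.
Qed.

Lemma Hspace_convex X : nconvex (Hspace X).
Proof. by move=> U V t HU HV _; apply: Hspace_D => //; apply/Hspace_Z/Hspace_D => //; exact: Hspace_N. Qed.

Lemma Hspace_projection X U : exists2 p, Hspace X p & forall w, Hspace X w -> inner2 (U - p) w = 0.
Proof.
have [|p Hp np] := @projection_exists _ _ ip (Hspace X) U _ (@Hspace_convex X) (@Hspace_complete X).
  by exists 0; exact: Hspace_0.
exists p => // w Hw.
have h1 := np _ (Hspace_D Hp Hw); have h2 := np _ (Hspace_D Hp (Hspace_N Hw)).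
rewrite addrAC subrr add0r in h1; rewrite addrAC subrr add0r in h2.
apply/eqP; rewrite eq_le; apply/andP; split; first exact: h1.
by rewrite -oppr_le0 -inner2Nr; exact: h2.
Qed.

Lemma Hspace_sub X X' : Omega_of X `<=` Omega_of X' -> Hspace X' `<=` Hspace X.
Proof. by move=> XX' U HU a b ab; apply: HU; exact: subset_trans XX'. Qed.

Lemma Omega_of_open X : open (Omega_of X).
Proof.
rewrite openE => m [Om H]; rewrite /interior.
have := nbhs_interior H; apply: filterS2 (Omega_nbhs Om) => x Ox Hx.
have e : X x = X m :> R by exact: nbhs_singleton Hx.
by split => //; apply: filterS Hx => y /= ->.
Qed.

Lemma constancy_interval X m : Omega m ->
  ~ Omega_of X m \/
  exists a b, [/\ 0 <= a, a < m, m < b & b <= 1] /\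
    [/\ `]a, b[ `<=` Omega_of X, ~ Omega_of X a & ~ Omega_of X b].
Proof.
move=> Om; have [XO|] := pselect (Omega_of X m); last by left.
right; have [m0 m1] := (OmegaE m).1 Om.
have n0 : ~ Omega_of X 0 by case=> /OmegaE[]; rewrite ltxx.
have n1 : ~ Omega_of X 1 by case=> /OmegaE[_]; rewrite ltxx.
have [a [a0 am Ha na]] := component_left (@Omega_of_open X) XO m0 n0.
have [b [b1 mb Hb nb]] := component_right (@Omega_of_open X) XO m1 n1.
exists a, b; split; split => // x /=; rewrite in_itv/= => /andP[ax xb].
by case: (ltgtP x m) => [xm|mx|->//]; [exact: Ha|exact: Hb].
Qed.

Lemma inner2_ind_le0 W a : a <= 0 -> inner2 W (ind a) = inner2 W oneL2.
Proof.
move=> a0; rewrite inner2C [RHS]inner2C; apply: inner2_ae.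
by apply: ae_Omega => x /OmegaE[x0 _] _; rewrite indE oneE (le_trans a0 (ltW x0)).
Qed.

Lemma inner2_ind_ge1 W a : 1 <= a -> inner2 W (ind a) = 0.
Proof.
move=> a1; rewrite -(inner20r W) inner2C [RHS]inner2C; apply: inner2_ae.
by apply: ae_Omega => x /OmegaE[_ x1] _; rewrite indE leNgt (lt_le_trans x1 a1).
Qed.

Lemma ind_outside X W : inner2 W oneL2 = 0 ->
  (forall m, Omega m -> ~ Omega_of X m -> inner2 W (ind m) <= 0) ->
  forall a, ~ Omega_of X a -> inner2 W (ind a) <= 0.
Proof.
move=> W1 Wm a na; have [a0|a0] := ltP 0 a; last by rewrite inner2_ind_le0// W1.
have [a1|a1] := ltP a 1; last by rewrite inner2_ind_ge1.
by apply: Wm => //; exact/OmegaE.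
Qed.

(** The indicator at a point of a constancy interval is a convex combination of the
    indicators at the two ends of that interval, minus a kink. *)
Lemma ind_sign X W : inner2 W oneL2 = 0 ->
  (forall m, Omega m -> ~ Omega_of X m -> inner2 W (ind m) <= 0) ->
  (forall a b m, 0 <= a -> a < m -> m < b -> b <= 1 -> `]a, b[ `<=` Omega_of X ->
     0 <= inner2 W (kink a b m)) ->
  forall m, Omega m -> inner2 W (ind m) <= 0.
Proof.
move=> W1 Wm Wk m Om.
have [nm|[a [b [[a0 am mb b1] [ab na nb]]]]] := constancy_interval X Om; first exact: Wm.
have [u0 v0 _] := kink_weights am mb.
have := Wk _ _ _ a0 am mb b1 ab; rewrite [inner2 W (kink _ _ _)]inner2Dr inner2Nr inner2Dr !inner2Zr.
rewrite subr_ge0 => /le_trans; apply.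
have ha := ind_outside W1 Wm na; have hb := ind_outside W1 Wm nb.
by rewrite -oppr_ge0 opprD addr_ge0// oppr_ge0 mulr_ge0_le0.
Qed.

(** Let [p] be the part of the normal vector [W] in [Hspace X].  It is orthogonal to the
    kinks, as an element of that space, and to the indicators at the ends of the
    constancy intervals, as [W] is; these combine to every [ind m], so [p] vanishes. *)
Lemma subdiff_Hspace X W U : K X -> subdiff X W -> Hspace X U -> inner2 W U = 0.
Proof.
move=> KX WX HU; have [p Hp Wp] := Hspace_projection X W.
suff p0 : nrm ip p = 0.
  have := Wp _ HU; rewrite inner2Dl inner2Nl => /subr0_eq ->.
  have := @nrm0_sipl _ _ ip p 0 U; rewrite subr0 => /(_ p0) h.
  by rewrite -[LHS]/(ip p U) h; exact: inner20l.
have pW w : Hspace X w -> inner2 p w = inner2 W w.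
  by move/Wp; rewrite inner2Dl inner2Nl => /subr0_eq.
have p1 : inner2 p oneL2 = 0 by rewrite (pW _ (@Hspace_one X)) (subdiff_one KX WX).
have pind m : Omega m -> ~ Omega_of X m -> inner2 p (ind m) = 0.
  by move=> Om nm; rewrite (pW _ (Hspace_ind nm)) (subdiff_ind KX WX).
apply: (ind_total p1) => m Om; apply/eqP; rewrite eq_le; apply/andP; split.
  apply: (ind_sign (X := X)) Om => // [k Ok nk|a b k _ ak kb _ ab]; first by rewrite pind.
  by rewrite (Hspace_kink Hp ab ak kb).
rewrite -oppr_le0 -inner2Nl; apply: (ind_sign (X := X)) Om => [|k Ok nk|a b k _ ak kb _ ab].
- by rewrite inner2Nl p1 oppr0.
- by rewrite inner2Nl pind// oppr0.
- by rewrite inner2Nl (Hspace_kink Hp ab ak kb) oppr0.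
Qed.

Lemma Hspace_orth X U : (forall W, subdiff X W -> inner2 U W = 0) -> Hspace X U.
Proof. by move=> H; apply: kink_Hspace => a b m ab am mb; apply: H; exact: kink_subdiff. Qed.

Lemma subdiff_monotone X X' : K X -> K X' -> Omega_of X `<=` Omega_of X' ->
  subdiff X `<=` subdiff X'.
Proof.
move=> KX KX' XX' W WX; apply: subdiffI => [|Z KZ]; last exact: (subdiff_polar KX).
by apply: (subdiff_Hspace KX WX); apply: Hspace_sub XX' _ _; exact: Hspace_self.
Qed.

(** The projection [p] of [w] on the cone satisfies [w - p] normal at [p], so the kink
    argument gives [inner2 p (ind m) <= 0] for all [m]; a nondecreasing function of
    mean zero satisfies the opposite inequality. *)
Lemma polar_ind w : inner2 w oneL2 = 0 -> (forall m, Omega m -> inner2 w (ind m) <= 0) ->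
  forall Z, K Z -> inner2 w Z <= 0.
Proof.
move=> w1 wm.
have [|p Kp np] := @projection_exists _ _ ip K w _ (@K_convex R) (@K_complete R).
  by exists 0; exact: K_0.
have wp : subdiff p (w - p) by exact: np.
have p1 : inner2 p oneL2 = 0.
  by have := subdiff_one Kp wp; rewrite inner2Dl inner2Nl w1 sub0r => /eqP; rewrite oppr_eq0 => /eqP.
have ple m : Omega m -> inner2 p (ind m) <= 0.
  apply: (ind_sign (X := p)) => // [k Ok nk|a b k _ ak kb _ ab].
    have := subdiff_ind Kp wp Ok nk; rewrite inner2Dl inner2Nl => /subr0_eq <-.
    exact: wm.
  by rewrite (Hspace_kink (Hspace_self (X := p)) ab ak kb).
have p0 : nrm ip p = 0.
  apply: ind_total => // m Om; apply/eqP; rewrite eq_le ple//=.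
  have [m0 m1] := (OmegaE m).1 Om.
  have := kink_polar (lexx 0) m0 m1 (lexx 1) Kp.
  rewrite inner2C [inner2 p (kink _ _ _)]inner2Dr inner2Nr inner2Dr !inner2Zr.
  by rewrite inner2_ind_le0// inner2_ind_ge1// p1 !mulr0 addr0 sub0r oppr_le0.
move=> Z KZ; have h := subdiff_polar Kp wp KZ.
have := @nrm0_sipl _ _ ip p 0 Z; rewrite subr0 => /(_ p0) e.
move: h; rewrite inner2Dl inner2Nl -[inner2 p Z]/(ip p Z) e (sip0l ip) subr0.
exact.
Qed.

(** Chebyshev's inequality on each constancy interval: averaging [Z] there lowers its
    inner product with monotone functions. *)
Lemma projection_polar X Z p : K X -> K Z -> Hspace X p ->
  (forall w, Hspace X w -> inner2 (Z - p) w = 0) ->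
  forall Z', K Z' -> inner2 (p - Z) Z' <= 0.
Proof.
move=> KX KZ Hp Zp.
have H w : Hspace X w -> inner2 (p - Z) w = 0.
  by move=> Hw; rewrite -opprB inner2Nl Zp// oppr0.
have H1 := H _ (@Hspace_one X).
apply: polar_ind => //; apply: (ind_sign (X := X)) => // [m _ nm|a b m a0 am mb b1 ab].
  by rewrite H//; exact: Hspace_ind.
rewrite inner2Dl inner2Nl (Hspace_kink Hp ab am mb) sub0r oppr_ge0 inner2C.
exact: kink_polar.
Qed.

End Duality.

(** * Primitives of Lipschitz curves *)

Section ProductSpace.
Context {R : realType} {E1 E2 : lmodType R} (S1 : semi_inner E1) (S2 : semi_inner E2).
Local Notation E := (E1 * E2)%type.

Definition prod_sip (x y : E) : R := S1 x.1 y.1 + S2 x.2 y.2.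

Lemma prod_sipC x y : prod_sip x y = prod_sip y x.
Proof. by rewrite /prod_sip (sipC S1) (sipC S2). Qed.
Lemma prod_sipDl x y z : prod_sip (x + y) z = prod_sip x z + prod_sip y z.
Proof. by rewrite /prod_sip (sipDl S1) (sipDl S2) addrACA. Qed.
Lemma prod_sipZl a x z : prod_sip (a *: x) z = a * prod_sip x z.
Proof. by rewrite /prod_sip (sipZl S1) (sipZl S2) mulrDr. Qed.
Lemma prod_sip_ge0 x : 0 <= prod_sip x x.
Proof. by rewrite addr_ge0 ?sip_ge0. Qed.

Definition ip_prod : semi_inner E := SemiInner prod_sipC prod_sipDl prod_sipZl prod_sip_ge0.

Lemma nrm_fst (x : E) : nrm S1 x.1 <= nrm ip_prod x.
Proof. by rewrite /nrm ler_wsqrtr// lerDl sip_ge0. Qed.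
Lemma nrm_snd (x : E) : nrm S2 x.2 <= nrm ip_prod x.
Proof. by rewrite /nrm ler_wsqrtr// lerDr sip_ge0. Qed.

Lemma nrm_prod (x : E) : nrm ip_prod x <= nrm S1 x.1 + nrm S2 x.2.
Proof.
have h : 0 <= nrm S1 x.1 + nrm S2 x.2 by rewrite addr_ge0 ?nrm_ge0.
rewrite -(@ler_pXn2r _ 2) ?nnegrE ?nrm_ge0// nrm_sq sqrrD !nrm_sq /= /prod_sip.
have : 0 <= nrm S1 x.1 * nrm S2 x.2 by rewrite mulr_ge0 ?nrm_ge0.
by rewrite mulr2n; move: (S1 _ _) (S2 _ _) (_ * _) => p q r; lra.
Qed.

Lemma tends_fst {T} {F : set_system T} {FF : ProperFilter F} (f : T -> E) y :
  tends ip_prod F f y -> tends S1 F (fun i => (f i).1) y.1.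
Proof. by move=> fy; apply: (tends_le _ fy); near=> i; exact: (nrm_fst (f i - y)). Unshelve. all: by end_near. Qed.
Lemma tends_snd {T} {F : set_system T} {FF : ProperFilter F} (f : T -> E) y :
  tends ip_prod F f y -> tends S2 F (fun i => (f i).2) y.2.
Proof. by move=> fy; apply: (tends_le _ fy); near=> i; exact: (nrm_snd (f i - y)). Unshelve. all: by end_near. Qed.

Lemma tends_prod {T} {F : set_system T} {FF : ProperFilter F} (f : T -> E) y :
  tends S1 F (fun i => (f i).1) y.1 -> tends S2 F (fun i => (f i).2) y.2 -> tends ip_prod F f y.
Proof.
move=> h1 h2; apply: (@tends_le _ _ _ _ _ _ _ _ (fun i => nrm S1 ((f i).1 - y.1) + nrm S2 ((f i).2 - y.2))).
  by near=> i; exact: (nrm_prod (f i - y)).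
by rewrite -[0 in X in _ --> X]addr0; exact: cvgD.
Unshelve. all: by end_near. Qed.

Lemma prod_complete C1 C2 : ncomplete S1 C1 -> ncomplete S2 C2 ->
  ncomplete ip_prod [set x : E | C1 x.1 /\ C2 x.2].
Proof.
move=> c1 c2 x Cx cx.
have [|y1 Cy1 t1] := c1 (fun n => (x n).1) (fun n => (Cx n).1).
  move=> e /cx[N HN]; exists N => m n Nm Nn.
  by apply: le_trans (HN m n Nm Nn); exact: (nrm_fst (x m - x n)).
have [|y2 Cy2 t2] := c2 (fun n => (x n).2) (fun n => (Cx n).2).
  move=> e /cx[N HN]; exists N => m n Nm Nn.
  by apply: le_trans (HN m n Nm Nn); exact: (nrm_snd (x m - x n)).
by exists (y1, y2) => //; exact: tends_prod.
Qed.

Lemma prod_convex C1 C2 : nconvex C1 -> nconvex C2 ->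
  nconvex [set x : E | C1 x.1 /\ C2 x.2].
Proof. by move=> c1 c2 x y t [x1 x2] [y1 y2] t01; split; [exact: c1|exact: c2]. Qed.

End ProductSpace.

Lemma normal_setT (R : realType) (E : lmodType R) (S : semi_inner E) (x n : E) :
  (forall w, S n (w - x) <= 0) -> nrm S n = 0.
Proof.
move=> h; have := h (x + n); rewrite addrAC subrr add0r => nn.
by apply: sip_eq0_nrm; apply/eqP; rewrite eq_le nn sip_ge0.
Qed.

Section Primitive.
Context {R : realType} {E : lmodType R} (S : semi_inner E).
Implicit Types (f g Q u : R -> E) (a b c t T L M : R).
Local Notation leb := (@lebesgue_measure R).

Definition liponE a b L u := forall s t, a <= s <= b -> a <= t <= b ->
  nrm S (u s - u t) <= L * `|s - t|.

(** For Lipschitz [f] the quadratic remainder makes this equivalent to [Q' = f], in a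
    form from which Riemann sums are estimated directly. *)
Definition primitive a b f Q := exists2 M, 0 <= M & forall c d, a <= c -> c <= d -> d <= b ->
  nrm S (Q d - Q c - (d - c) *: f c) <= M * (d - c) ^+ 2.

Lemma primitive_sub a b c d f Q : a <= c -> d <= b -> primitive a b f Q -> primitive c d f Q.
Proof.
move=> ac db [M M0 H]; exists M => // x y cx xy yd; apply: H => //.
  exact: le_trans cx.
exact: le_trans db.
Qed.

(** The remainder [r] is estimated by integrating its scalar product with itself. *)
Lemma primitive_of_ae a b f Q L M : 0 <= L -> liponE a b L f -> liponE a b M Q ->
  {ae leb, forall t, a < t < b -> tends S (0 : R)^' (quot Q t) (f t)} -> primitive a b f Q.
Proof.
move=> L0 fL QM ae; exists L => // c d ac cd db.
set r := Q d - Q c - (d - c) *: f c.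
pose g s := S (Q s) r - (s * S (f c) r + (L * (d - c) * nrm S r) * s).
have lipQ : lip_on c d (fun s => S (Q s) r).
  exists (`|M| * nrm S r); first by rewrite mulr_ge0 ?nrm_ge0.
  move=> x y /andP[cx xd] /andP[cy yd]; rewrite -sipNl -sipDl; apply: le_trans (sip_norm_le _ _ _) _.
  rewrite mulrAC ler_wpM2r ?nrm_ge0//; apply: le_trans (QM _ _ _ _) _.
  - by rewrite (le_trans ac cx) (le_trans xd db).
  - by rewrite (le_trans ac cy) (le_trans yd db).
  - by rewrite ler_wpM2r// ler_norm.
have : g d <= g c.
  apply: ae_nonincreasing => //.
    apply: lip_onB => //; apply: lip_onD; apply: lip_onM => //;
      solve [exact: lip_on_id|exact: lip_on_cst].
  apply: ae_impl ae => t Ht /andP[ct td].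
  have [|h] := (Ht _, I); first by rewrite (le_lt_trans ac ct) (lt_le_trans td db).
  have h1 := is_derive_sip h (tends_quot_cst S r t).
  have h2 : is_derive t (1 : R) g (S (f t) r + S (Q t) 0 - (S (f c) r + L * (d - c) * nrm S r)).
    have e1 : is_derive t (1 : R) (fun s : R => s * S (f c) r + (L * (d - c) * nrm S r) * s)
       (S (f c) r + L * (d - c) * nrm S r).
      by apply: is_derive_eq; rewrite /GRing.scale/=; ring.
    exact: is_deriveB h1 e1.
  eexists; split; first exact: h2.
  rewrite sip0r addr0 subr_le0 -lerBlDl -sipNl -sipDl; apply: le_trans (sip_le _ _ _) _.
  rewrite ler_wpM2r ?nrm_ge0//; apply: le_trans (fL _ _ _ _) _.
  - by rewrite (le_trans ac (ltW ct)) (ltW (lt_le_trans td db)).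
  - by rewrite ac (le_trans cd db).
  - by rewrite ler_wpM2l// ger0_norm ?subr_ge0 ?lerD2r ltW.
have rz z : S r z = S (Q d) z - S (Q c) z - (d - c) * S (f c) z by rewrite /r !sipE.
have rr := rz r.
have : S r r <= L * (d - c) ^+ 2 * nrm S r -> nrm S r <= L * (d - c) ^+ 2.
  have [->|r0] := eqVneq (nrm S r) 0; first by rewrite mulr_ge0 ?sqr_ge0.
  by rewrite -nrm_sq expr2 ler_pM2r// lt_def r0 nrm_ge0.
rewrite /g rr => h h'; apply: h; move: h'.
move: (S (Q d) r) (S (Q c) r) (S (f c) r) (nrm S r) => p q w n; nra.
Qed.

Lemma primitive_lip a b f Q L : a <= b -> 0 <= L -> liponE a b L f -> primitive a b f Q ->
  exists2 M, 0 <= M & liponE a b M Q.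
Proof.
move=> ab L0 fL [M M0 H]; pose K := nrm S (f a) + L * (b - a).
have fK c : a <= c <= b -> nrm S (f c) <= K.
  move=> /andP[ac cb]; apply: le_trans (nrm_le_dist S _ (f a)) _; rewrite lerD2l.
  apply: le_trans (fL _ _ _ _) _; rewrite ?ac ?cb ?lexx//.
  by rewrite ler_wpM2l// ger0_norm ?subr_ge0// lerD2r.
have K0 : 0 <= K by rewrite addr_ge0 ?nrm_ge0// mulr_ge0 ?subr_ge0.
exists (K + M * (b - a)); first by rewrite addr_ge0// mulr_ge0 ?subr_ge0.
move=> s t; wlog st : s t / s <= t.
  move=> W; have [st|/ltW ts] := leP s t; first exact: W.
  by move=> hs ht; rewrite nrmB distrC; exact: W.
move=> /andP[as_ sb] /andP[at_ tb]; rewrite nrmB distrC ger0_norm ?subr_ge0//.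
apply: le_trans (nrm_le_dist S _ ((t - s) *: f s)) _; rewrite nrmZ ger0_norm ?subr_ge0// [leRHS]mulrDl.
apply: lerD; first by rewrite mulrC ler_wpM2r ?subr_ge0// fK// as_.
apply: le_trans (H _ _ as_ st tb) _; rewrite -mulrA ler_wpM2l// expr2 ler_wpM2r ?subr_ge0//.
by lra.
Qed.

Lemma primitive_derivative a b f Q L t : liponE a b L f -> primitive a b f Q -> a < t < b ->
  tends S (0 : R)^' (quot Q t) (f t).
Proof.
move=> fL [M M0 H] /andP[a_t tb].
have h0 : (M + `|L|) * `|h| @[h --> (0 : R)^'] --> (0 : R).
  rewrite -[X in _ --> X](mulr0 (M + `|L|)); apply: cvgM; first exact: cvg_cst.
  by rewrite -[X in _ --> X](normr0 R); apply: cvg_norm; exact: nbhs_dnbhs.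
apply: (tends_le _ h0); near=> h.
have hn0 : h != 0 by near: h; exact: nbhs_dnbhs_neq.
have h1 : `|h| < t - a by near: h; apply: dnbhs0_lt; rewrite subr_gt0.
have h2 : `|h| < b - t by near: h; apply: dnbhs0_lt; rewrite subr_gt0.
have hh : 0 < `|h| by rewrite normr_gt0.
rewrite /quot -(@ler_pM2l _ `|h|)// -nrmZ scalerBr scalerA divff// scale1r.
have [hp|hm] := leP 0 h.
  have th : t + h - t = h by ring.
  have := H t (t + h) (ltW a_t); rewrite lerDl hp th => /(_ isT) H'.
  apply: le_trans (H' _) _; first by rewrite ger0_norm// in h2; lra.
  rewrite ger0_norm//; have : 0 <= `|L| * (h * h) by rewrite !mulr_ge0.
  by nra.
have hneg : `|h| = - h by rewrite ltr0_norm.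
rewrite hneg in h1 h2 *.
have := H (t + h) t; rewrite opprD addNKr.
move=> /(_ _ _ (ltW tb)) H'.
have H'' : nrm S (Q t - Q (t + h) - (- h) *: f (t + h)) <= M * (- h) ^+ 2 by apply: H'; lra.
have e : Q (t + h) - Q t - h *: f t = - (Q t - Q (t + h) - (- h) *: f (t + h)) + h *: (f (t + h) - f t).
  by rewrite scaleNr opprK opprD opprB scalerBr addrA subrK.
rewrite e; apply: le_trans (nrmD _ _ _) _; rewrite nrmN nrmZ hneg.
have hl : nrm S (f (t + h) - f t) <= `|L| * (- h).
  apply: le_trans (fL _ _ _ _) _; [apply/andP; split; lra|apply/andP; split; lra|].
  by rewrite addrAC subrr add0r hneg ler_wpM2r ?ler_norm// oppr_ge0 ltW.
have : - h * nrm S (f (t + h) - f t) <= - h * (`|L| * (- h)) by rewrite ler_wpM2l// oppr_ge0 ltW.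
move: H''; move: (nrm S _) (nrm S _) => p q; move: `|L| => l; nra.
Unshelve. all: by end_near. Qed.

End Primitive.

Section PrimitiveExists.
Context {R : realType} {E : lmodType R} (S : semi_inner E).
Implicit Types (f Q u : R -> E) (T L : R).
Local Notation leb := (@lebesgue_measure R).
Local Notation S2 := (ip_prod S S).

(** The autonomous system [Q' = f(tau), tau' = 1], where the clock [tau] runs along the
    unit vector [e]. *)
Lemma primitive_exists f T L (e : E) : 0 <= T -> 0 <= L -> liponE S 0 T L f ->
  ncomplete S [set: E] -> S e e = 1 -> exists Q, primitive S 0 T f Q.
Proof.
move=> T0 L0 fL Ecpl e1.
pose cl (r : R) := Num.max 0 (Num.min r T).
have cl01 r : 0 <= cl r <= T by rewrite /cl le_max lexx ge_max T0 ge_min lexx orbT.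
have clid r : 0 <= r <= T -> cl r = r by move=> /andP[h1 h2]; rewrite /cl min_l// max_r.
have cl1 r s : `|cl r - cl s| <= `|r - s|.
  rewrite /cl; wlog rs : r s / r <= s.
    move=> W; have [h|/ltW h] := leP r s; first exact: W.
    by rewrite distrC (distrC r); exact: W.
  rewrite distrC (distrC r) (ger0_norm (_ : 0 <= s - r)) ?subr_ge0//.
  have clP x : [\/ x <= 0 /\ Num.max 0 (Num.min x T) = 0,
      [/\ 0 <= x, x <= T & Num.max 0 (Num.min x T) = x] |
      T <= x /\ Num.max 0 (Num.min x T) = T].
    have [x0|/ltW x0] := leP x 0.
      by constructor 1; split => //; rewrite max_l// ge_min x0.
    have [xT|/ltW xT] := leP x T; first by constructor 2; split => //; rewrite max_r.
    by constructor 3; split => //; rewrite max_r.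
  rewrite ler_norml; case: (clP r) => [[h1 ->]|[h1 h2 ->]|[h1 ->]];
    case: (clP s) => [[k1 ->]|[k1 k2 ->]|[k1 ->]]; apply/andP; split; lra.
pose B (x : E * E) := (f (cl (S x.2 e)), e) : (E * E)%type.
have ne : nrm S e = 1 by rewrite /nrm e1 sqrtr1.
have BL : lipschitz_map S2 setT B L.
  move=> x y _ _; apply: le_trans (nrm_prod _ _ _) _ => /=; rewrite subrr nrm0 addr0.
  apply: le_trans (fL _ _ (cl01 _) (cl01 _)) _; rewrite ler_wpM2l//.
  apply: le_trans (cl1 _ _) _; rewrite -sipNl -sipDl; apply: le_trans (sip_norm_le _ _ _) _.
  by rewrite ne mulr1; exact: (nrm_snd S S (x - y)).
have c2 : ncomplete S2 [set: E * E].
  have := prod_complete Ecpl Ecpl; congr (ncomplete _ _).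
  by apply/seteqP; split.
have cv : nconvex [set: E * E] by [].
have [u [[_ ul uD] u0 _]] := strong_exists (u0 := 0) L0 BL cv c2 c2 I.
have {}uD : {ae leb, forall t, 0 < t -> tends S2 (0 : R)^' (quot u t) (B (u t))}.
  apply: ae_impl uD => t H t0; have [D D1 D2] := H t0.
  apply: tends_congr D1 => [h|]; first by rewrite subrr nrm0.
  by apply: nrm0_sym; apply: (@normal_setT _ _ _ (u t)) => w; exact: D2.
pose Q t := (u t).1; pose Z t := (u t).2.
have Zt t : 0 <= t -> S (Z t) e = t.
  move=> t0; pose g s := S (Z s) e - s.
  have gl : lip_on 0 t g.
    apply: lip_onB; last exact: lip_on_id.
    apply: lip_on_sip => //; last exact: loclip_cst.
    move=> r r0; have [K K0 HK] := ul r r0; exists K => // x y hx hy.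
    by apply: le_trans (HK x y hx hy); exact: (nrm_snd S S (u x - u y)).
  have gd : {ae leb, forall s, 0 < s < t -> is_derive s (1 : R) g 0}.
    apply: ae_impl uD => s H /andP[s0 _].
    have hZ : tends S (0 : R)^' (quot Z s) e by exact: (tends_snd (H s0)).
    have h := is_derive_sip hZ (tends_quot_cst S e s).
    have := is_deriveB h (is_derive_id s (1 : R)).
    by rewrite /= e1 sip0r addr0 subrr.
  have g0 : g 0 = 0.
    rewrite /g subr0 /Z; have /(nrm0_sipl e) : nrm S ((u 0).2 - 0) = 0.
      by apply: nrm0_le; rewrite -[leRHS]u0; exact: (nrm_snd S S (u 0 - 0)).
    by rewrite sip0l.
  have h1 : g t <= g 0.
    by apply: ae_nonincreasing => //; apply: ae_impl gd => s h hs; exists 0; split => //; exact: h.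
  have h2 : - g t <= - g 0.
    apply: (ae_nonincreasing (g := fun s => - g s)) => //; first exact: lip_onN.
    apply: ae_impl gd => s h hs; exists 0; split => //.
    by have := is_deriveN (h hs); rewrite oppr0.
  by move: h1 h2; rewrite g0 /g; move: (S _ _) => x; lra.
have [K K0 HK] := ul T T0.
exists Q; apply: (primitive_of_ae L0 fL (M := K)).
  by move=> x y hx hy; apply: le_trans (HK x y hx hy); exact: (nrm_fst S S (u x - u y)).
apply: ae_impl uD => t H /andP[t0 tT].
have : tends S (0 : R)^' (quot Q t) (B (u t)).1 by exact: (tends_fst (H t0)).
rewrite /B/= Zt ?(ltW t0)// clid ?(ltW t0) ?(ltW tT)//.
Qed.

End PrimitiveExists.

(** * Bochner integrals of Lipschitz curves *)

Section Bochner.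
Context {R : realType}.
Local Notation L2 := (L2 R).
Local Notation mu := (@muOmega R).
Local Notation leb := (@lebesgue_measure R).
Local Notation T := (measurableTypeR R).
Local Notation ip := (@ipL2 R).
Implicit Types (U V W J : L2) (f Q : R -> L2) (a b c m : R) (s : @simple_fun R).

Lemma inner2_suml n (c : 'I_n -> R) (v : 'I_n -> L2) W :
  inner2 (\sum_(i < n) c i *: v i) W = \sum_(i < n) c i * inner2 (v i) W.
Proof.
elim/big_ind2: _ => [|x x' y y' hx hy|i _]; first exact: inner20l.
  by rewrite inner2Dl hx hy.
by rewrite inner2Zl.
Qed.

Lemma leb_itv_lty a b (A : set T) : measurable A ->
  (leb (A `&` `[a, b]%classic) < +oo)%E.
Proof.
move=> mA; apply: (@le_lt_trans _ _ (leb `[a, b]%classic)).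
  by apply: le_measure; rewrite ?inE//; apply: measurableI => //; exact: measurable_itv.
by rewrite lebesgue_measure_itv/=; case: ifP => _; rewrite ?ltry// -EFinD ltry.
Qed.

Lemma sf_eval_measurable s a b W :
  measurable_fun (`[a, b]%classic : set T) (fun x : T => inner2 (sf_eval s x) W).
Proof.
rewrite (_ : (fun x => _) = fun x : T => \sum_(i < sf_size s) \1_(sf_set i) x * inner2 (sf_val i) W).
  apply: measurable_sum => i; apply: measurable_funM => //.
  by apply: measurable_funTS; apply: measurable_indic; exact: sf_measurable.
by apply/funext => x; rewrite inner2_suml.
Qed.

Lemma sf_eval_integrable s a b W :
  leb.-integrable (`[a, b]%classic : set T) (fun x : T => (inner2 (sf_eval s x) W)%:E) /\
  (\int[leb]_(x in `[a, b]%classic) (inner2 (sf_eval s x) W)%:E = (inner2 (sf_int s a b) W)%:E)%E.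
Proof.
have mI : measurable (`[a, b]%classic : set T) by exact: measurable_itv.
have iA i : leb.-integrable (`[a, b]%classic : set T) (fun x : T => (\1_(@sf_set R s i) x)%:E).
  apply/integrableP; split.
    by apply/measurable_EFinP; apply: measurable_funTS; apply: measurable_indic; exact: sf_measurable.
  under eq_integral => x _ do rewrite gee0_abs ?lee_fin//.
  rewrite integral_indic//; last exact: sf_measurable.
  by apply: leb_itv_lty; exact: sf_measurable.
have E : (fun x : T => (inner2 (sf_eval s x) W)%:E) =
    (fun x : T => (\sum_(i < sf_size s) (inner2 (sf_val i) W)%:E * (\1_(@sf_set R s i) x)%:E)%E).
  apply/funext => x; rewrite /sf_eval inner2_suml -sumEFin; apply: eq_bigr => i _.
  by rewrite -EFinM mulrC.
have iZ i : leb.-integrable (`[a, b]%classic : set T)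
    (fun x : T => ((inner2 (sf_val i) W)%:E * (\1_(@sf_set R s i) x)%:E)%E).
  exact: integrableZl.
split; first by rewrite E; apply: integrable_sum.
transitivity (\int[leb]_(x in `[a, b]%classic)
    (\sum_(i < sf_size s) (inner2 (sf_val i) W)%:E * (\1_(@sf_set R s i) x)%:E))%E.
  by congr (integral _ _ _); exact: E.
rewrite integral_sum// /sf_int inner2_suml -sumEFin; apply: eq_bigr => i _.
rewrite integralZl// integral_indic//; last exact: sf_measurable.
rewrite [RHS]EFinM muleC; congr (_ * _)%E; rewrite fineK// ge0_fin_numE//.
by apply: leb_itv_lty; exact: sf_measurable.
Qed.

(** Tested against a fixed vector, two approximating sequences of simple functions
    have asymptotically equal integrals. *)
Lemma bochner_unique f a b J J' : is_bochner f a b J -> is_bochner f a b J' ->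
  nrm ip (J - J') = 0.
Proof.
move=> [s [ms si sJ]] [s' [ms' si' sJ']].
have mI : measurable (`[a, b]%classic : set T) by exact: measurable_itv.
pose W := J - J'.
pose n k x := norm2 (f x - sf_eval (s k) x); pose n' k x := norm2 (f x - sf_eval (s' k) x).
have n0 k x : 0 <= n k x by rewrite /n norm2E nrm_ge0.
have n0' k x : 0 <= n' k x by rewrite /n' norm2E nrm_ge0.
pose I k := (\int[leb]_(x in `[a, b]%classic) (n k x)%:E)%E.
pose I' k := (\int[leb]_(x in `[a, b]%classic) (n' k x)%:E)%E.
have key k : (`|inner2 (sf_int (s k) a b - sf_int (s' k) a b) W|%:E <=
    (nrm ip W)%:E * (I k + I' k))%E.
  pose d x := inner2 (sf_eval (s k) x - sf_eval (s' k) x) W.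
  have dE : d = fun x => inner2 (sf_eval (s k) x) W - inner2 (sf_eval (s' k) x) W.
    by apply/funext => x; rewrite /d inner2Dl inner2Nl.
  have md : measurable_fun (`[a, b]%classic : set T) (d : T -> R).
    by rewrite dE; apply: measurable_funB; exact: sf_eval_measurable.
  have -> : (`|inner2 (sf_int (s k) a b - sf_int (s' k) a b) W|%:E =
    `| \int[leb]_(x in `[a, b]%classic) (d x)%:E |)%E.
    have [i1 e1] := sf_eval_integrable (s k) a b W; have [i2 e2] := sf_eval_integrable (s' k) a b W.
    by rewrite dE integralB_EFin// e1 e2 -EFinB inner2Dl inner2Nl.
  apply: le_trans (le_abse_integral _ mI _) _; first exact/measurable_EFinP.
  rewrite /I /I' -ge0_integralD//; [|by move=> x _; rewrite lee_fin|by apply/measurable_EFinP; exact: ms|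
    by move=> x _; rewrite lee_fin|by apply/measurable_EFinP; exact: ms'].
  rewrite -ge0_integralZl//; [|by apply: emeasurable_funD; apply/measurable_EFinP; [exact: ms|exact: ms']|
    by move=> x _; rewrite -EFinD lee_fin addr_ge0|by rewrite lee_fin nrm_ge0].
  apply: ge0_le_integral => //.
  - by apply: measurableT_comp => //; exact/measurable_EFinP.
  - apply/measurable_EFinP; apply: measurable_funM => //.
    by apply: measurable_funD; [exact: ms|exact: ms'].
  - move=> x _; rewrite -EFinD -EFinM lee_fin; apply: le_trans (sip_norm_le ip _ _) _.
    rewrite mulrC ler_wpM2l ?nrm_ge0//.
    have := nrm_tri ip (sf_eval (s k) x) (f x) (sf_eval (s' k) x).
    by rewrite /n /n' !norm2E (nrmB _ (sf_eval (s k) x) (f x)).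
have lim0 : (((nrm ip W)%:E * (I k + I' k))%E @[k --> \oo] --> 0%E).
  rewrite -[X in _ --> X](mule0 (nrm ip W)%:E); apply: cvgeZl => //.
  by rewrite -[X in _ --> X]adde0; apply: cvgeD.
have z : inner2 (sf_int (s k) a b - sf_int (s' k) a b) W @[k --> \oo] --> (0 : R).
  have h : (fun k => `|inner2 (sf_int (s k) a b - sf_int (s' k) a b) W|%:E) @ \oo --> 0%E.
    have hn : \forall k \near \oo, (cst 0 k <= `|inner2 (sf_int (s k) a b - sf_int (s' k) a b) W|%:E
        <= (nrm ip W)%:E * (I k + I' k))%E.
      by apply: nearW => k; rewrite lee_fin normr_ge0 key.
    exact: (squeeze_cvge hn (cvg_cst _) lim0).
  have h' := fine_cvg h.
  by apply: norm_cvg0; exact: h'.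
have z' : inner2 (sf_int (s k) a b - sf_int (s' k) a b) W @[k --> \oo] --> inner2 (J - J') W.
  apply: (tends_sip (S := ip)); last exact: tends_cst.
  apply: tendsB; [move: sJ|move: sJ']; rewrite /tends.
    by under eq_fun do rewrite norm2E nrmB.
  by under eq_fun do rewrite norm2E nrmB.
apply: (sip_eq0_nrm (S := ip)).
by rewrite -[LHS](cvg_lim (@Rhausdorff R) z') (cvg_lim (@Rhausdorff R) z).
Qed.

(** ** Riemann sums *)

(** The cells have length [1 / (k + 1)] whatever [a] and [b] are, so the last ones may
    stick out of the interval; the nodes [cpt] are clipped to it. *)
Section Riemann.
Context (a b : R) (k : nat).
Context (ab : a <= b).

Let step : R := k.+1%:R^-1.
Let pt (i : nat) := a + i%:R * step.
Let cpt i := Num.min (pt i) b.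
Let N := Num.bound ((b - a) * k.+1%:R).
Let cell (i : nat) : set T := `[pt i, pt i.+1[%classic.

Let step_gt0 : 0 < step. Proof. by rewrite invr_gt0. Qed.
Let ptS i : pt i.+1 = pt i + step. Proof. by rewrite /pt -natr1; ring. Qed.
Let pt0 : pt 0 = a. Proof. by rewrite /pt mul0r addr0. Qed.
Let pt_lt i j : (i < j)%N -> pt i.+1 <= pt j.
Proof. by move=> ij; rewrite /pt lerD2l ler_wpM2r ?(ltW step_gt0)// ler_nat. Qed.
Let ptN : b < pt N.
Proof.
rewrite /pt -ltrBlDl ltr_pdivlMr//.
by apply: archi_boundP; rewrite mulr_ge0 ?subr_ge0.
Qed.
Let cpt_ge i : a <= cpt i.
Proof. by rewrite /cpt le_min ab andbT /pt lerDl mulr_ge0// ltW. Qed.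
Let cpt_le i : cpt i <= b. Proof. by rewrite /cpt ge_min lexx orbT. Qed.
Let cptS i : cpt i <= cpt i.+1.
Proof. by rewrite /cpt; apply: le_min2 => //; rewrite ptS lerDl ltW. Qed.
Let cpt_step i : cpt i.+1 - cpt i <= step.
Proof.
rewrite /cpt ptS; move: (pt i) step step_gt0 => p d d0.
by case: (leP p b) => h; case: (leP (p + d) b) => h'; lra.
Qed.

Definition riemann_sum f : simple_fun := @SimpleFun R N (fun i => cell i)
  (fun i => measurable_itv _) (fun i => f (cpt i)).

Let cell_measure i : fine (leb (cell i `&` `[a, b]%classic)) = cpt i.+1 - cpt i.
Proof.
have pa : a <= pt i by rewrite /pt lerDl mulr_ge0// ltW.
rewrite /cell /cpt; have := ptS i; move: (pt i.+1) (pt i) pa => q p pa qE.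
have pq : p < q by rewrite qE ltrDl.
have [pb|bp] := leP p b; last first.
  have -> : `[p, q[ `&` `[a, b] = set0.
    apply/seteqP; split => x //=; rewrite !in_itv/= => -[/andP[h1 _] /andP[_ h2]].
    by have := le_trans h1 h2; rewrite leNgt bp.
  by rewrite measure0 min_r ?subrr// ltW// (lt_trans bp).
have [qb|bq] := leP q b.
  have -> : `[p, q[ `&` `[a, b] = `[p, q[%classic.
    apply/seteqP; split => x /=; rewrite !in_itv/=; first by case.
    by move=> /andP[h1 h2]; rewrite h1 h2 (le_trans pa h1) (le_trans (ltW h2) qb).
  by rewrite lebesgue_measure_itv/= lte_fin pq.
have -> : `[p, q[ `&` `[a, b] = `[p, b]%classic.
  apply/seteqP; split => x /=; rewrite !in_itv/=; first by move=> [/andP[-> _] /andP[_ ->]].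
  by move=> /andP[h1 h2]; rewrite h1 h2 (le_trans pa h1) (le_lt_trans h2 bq).
rewrite lebesgue_measure_itv/= lte_fin; case: ltP => // h.
by apply/esym/eqP; rewrite subr_eq0 eq_le h pb.
Qed.

Lemma riemann_sum_int f Q M : 0 <= M ->
  (forall c d, a <= c -> c <= d -> d <= b -> nrm ip (Q d - Q c - (d - c) *: f c) <= M * (d - c) ^+ 2) ->
  nrm ip (Q b - Q a - sf_int (riemann_sum f) a b) <= M * (b - a) * step.
Proof.
move=> M0 H; rewrite /sf_int/=.
have main n : nrm ip (Q (cpt n) - Q (cpt 0) -
    \sum_(i < n) (cpt i.+1 - cpt i) *: f (cpt i)) <= M * (cpt n - cpt 0) * step.
  elim: n => [|n IH]; first by rewrite big_ord0 subr0 !subrr nrm0 mulr0 mul0r.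
  rewrite big_ord_recr/=; move: IH; set S := \sum_(i < n) _.
  have := H _ _ (cpt_ge n) (cptS n) (cpt_le n.+1).
  set r := _ - _ *: _ => h1; set r' := _ - S => h2.
  have -> : Q (cpt n.+1) - Q (cpt 0) - (S + (cpt n.+1 - cpt n) *: f (cpt n)) = r + r'.
    rewrite /r /r' opprD [RHS]addrC (addrA _ (- S)) [RHS]addrA; congr (_ - _).
    by rewrite [RHS]addrC !addrA subrK.
  apply: le_trans (nrmD _ _ _) _.
  have : M * (cpt n.+1 - cpt n) ^+ 2 <= M * (cpt n.+1 - cpt n) * step.
    by rewrite -mulrA ler_wpM2l// expr2 ler_wpM2l ?subr_ge0 ?cptS ?cpt_step.
  move: h1 h2; move: (nrm _ r) (nrm _ r') => x y h1 h2.
  by move=> h; apply: (le_trans (lerD h1 h2)); apply: (le_trans (lerD h (lexx _))); rewrite le_eqVlt; apply/orP; left; apply/eqP; ring.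
have := main N.
have -> : cpt N = b by rewrite /cpt min_r// ltW.
have -> : cpt 0 = a by rewrite /cpt pt0 min_l.
by move=> h; under eq_bigr do rewrite cell_measure.
Qed.

Let cell_partition x : a <= x -> x <= b ->
  exists2 i : 'I_N, `|x - cpt i| <= step &
    forall j : 'I_N, \1_(cell j) x = (j == i)%:R :> R.
Proof.
move=> ax xb; have [|i xi mi] := @ex_minnP (fun i => x < pt i.+1).
  by exists N; apply: (le_lt_trans xb); apply: (lt_le_trans ptN); rewrite ptS lerDl ltW.
have pix : pt i <= x.
  case: i xi mi => [_ _|i xi mi]; first by rewrite pt0.
  by rewrite leNgt; apply/negP => /mi; rewrite ltnn.
have iN : (i < N)%N.
  rewrite ltnNge; apply/negP => Ni.
  have : pt N <= pt i by rewrite /pt lerD2l ler_wpM2r ?(ltW step_gt0)// ler_nat.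
  by move=> /(lt_le_trans ptN) /lt_le_trans /(_ pix); rewrite ltNge xb.
have ci : cpt i = pt i by rewrite /cpt min_l// (le_trans pix).
exists (Ordinal iN) => /=.
  rewrite ci ger0_norm ?subr_ge0// lerBlDl -ptS; exact: ltW.
move=> j; rewrite indicE; have [->|ji] := eqVneq j (Ordinal iN).
  by rewrite mem_set// /cell /= in_itv/= pix xi.
rewrite memNset// /cell /= in_itv/= => /andP[h1 h2].
have : (j : nat) != i by apply: contraNneq ji => ji; apply/eqP/val_inj.
rewrite neq_ltn => /orP[/pt_lt|/pt_lt] h.
  by have := lt_le_trans h2 (le_trans h pix); rewrite ltxx.
by have := le_lt_trans (le_trans h h1) xi; rewrite ltxx.
Qed.

Lemma riemann_sum_eval f x : a <= x -> x <= b ->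
  exists i : 'I_N, [/\ `|x - cpt i| <= step, sf_eval (riemann_sum f) x = f (cpt i) &
    nrm ip (f x - sf_eval (riemann_sum f) x) =
    \sum_(j < N) \1_(cell j) x * nrm ip (f x - f (cpt j))].
Proof.
move=> ax xb; have [i xi H] := cell_partition ax xb; exists i.
have e : sf_eval (riemann_sum f) x = f (cpt i).
  rewrite /sf_eval (bigD1 i)//= big1 ?addr0 ?H ?eqxx ?scale1r//.
  by move=> j /negbTE ji; rewrite H ji scale0r.
split=> //; rewrite e (bigD1 i)//= big1 ?addr0 ?H ?eqxx ?mul1r//.
by move=> j /negbTE ji; rewrite H ji mul0r.
Qed.

Lemma riemann_sum_measurable f L : 0 <= L -> liponE ip a b L f ->
  measurable_fun (`[a, b]%classic : set T)
    (fun x : T => norm2 (f x - sf_eval (riemann_sum f) x)).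
Proof.
move=> L0 fL.
have mI : measurable (`[a, b]%classic : set T) by exact: measurable_itv.
pose cl x := Num.max a (Num.min x b).
have clI x : a <= cl x <= b by rewrite /cl le_max lexx/= ge_max ab ge_min lexx orbT.
have clid x : a <= x <= b -> cl x = x by move=> /andP[h1 h2]; rewrite /cl min_l// max_r.
have clh x y : x <= y -> cl x <= cl y.
  by move=> xy; rewrite /cl; apply: le_max2 => //; exact: le_min2.
(* adding [L x] makes a Lipschitz function monotone *)
have mf (v : L2) : measurable_fun (`[a, b]%classic : set T) (fun x : T => nrm ip (f x - v)).
  apply: (eq_measurable_fun (fun x => (nrm ip (f (cl x) - v) + L * cl x) - L * x)).
    by move=> x; rewrite inE/= in_itv/= => xab; rewrite clid// addrK.
  apply: measurable_funB; last by apply: measurable_funM.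
  apply: nondecreasing_measurable => // x y xy.
  have : nrm ip (f (cl x) - v) - nrm ip (f (cl y) - v) <= nrm ip (f (cl x) - f (cl y)).
    by rewrite lerBlDr; exact: nrm_tri.
  have := fL _ _ (clI x) (clI y); rewrite distrC ger0_norm ?subr_ge0 ?clh//.
  by rewrite mulrBr; move: (nrm _ _) (nrm _ _) (nrm _ _) (L * _) (L * _) => p q r u w; lra.
apply: (eq_measurable_fun (fun x : T => \sum_(i < N) \1_(cell i) x * nrm ip (f x - f (cpt i)))).
  move=> x; rewrite inE/= in_itv/= => /andP[ax xb].
  by have [i [_ _ h]] := riemann_sum_eval f ax xb; rewrite norm2E h.
apply: measurable_sum => i; apply: measurable_funM => //.
by apply: measurable_funTS; apply: measurable_indic; exact: measurable_itv.
Qed.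

Lemma riemann_sum_close f L x : 0 <= L -> liponE ip a b L f -> a <= x -> x <= b ->
  norm2 (f x - sf_eval (riemann_sum f) x) <= L * step.
Proof.
move=> L0 fL ax xb; have [i [xi e _]] := riemann_sum_eval f ax xb.
rewrite norm2E e; apply: le_trans (fL _ _ _ _) _; rewrite ?ax ?xb ?cpt_ge ?cpt_le//.
exact: ler_wpM2l.
Qed.

End Riemann.

Lemma primitive_bochner f Q a b L : a <= b -> 0 <= L -> liponE ip a b L f ->
  primitive ip a b f Q -> is_bochner f a b (Q b - Q a).
Proof.
move=> ab L0 fL [M M0 H]; exists (fun k => riemann_sum a b k f); split.
- by move=> k; exact: riemann_sum_measurable fL.
- have lim0 : ((L * (b - a)) * k.+1%:R^-1)%:E @[k --> \oo] --> (0 : R)%:E.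
    apply: cvg_EFin; first by near=> k.
    rewrite -[X in _ --> X](mulr0 (L * (b - a))).
    by apply: cvgM; [exact: cvg_cst|exact: cvg_harmonic].
  have hn : \forall k \near \oo, (cst 0 k <= \int[leb]_(x in `[a, b]%classic)
      (norm2 (f x - sf_eval (riemann_sum a b k f) x))%:E <= ((L * (b - a)) * k.+1%:R^-1)%:E)%E.
    apply: nearW => k; apply/andP; split.
      by apply: integral_ge0 => x _; rewrite lee_fin norm2E nrm_ge0.
    apply: (@le_trans _ _ (\int[leb]_(x in `[a, b]%classic) (L * k.+1%:R^-1)%:E)%E).
      apply: ge0_le_integral => //.
      - by move=> x _; rewrite lee_fin norm2E nrm_ge0.
      - by apply/measurable_EFinP; exact: riemann_sum_measurable fL.
      - by move=> x /=; rewrite in_itv/= => /andP[ax xb]; rewrite lee_fin riemann_sum_close.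
    have -> : (\int[leb]_(x in `[a, b]%classic) (L * k.+1%:R^-1)%:E =
        (L * k.+1%:R^-1)%:E * leb (`[a, b]%classic : set R))%E.
      by apply: (@integral_cst _ T); exact: measurable_itv.
    rewrite lebesgue_measure_itv/= lte_fin.
    case: ltP => h; first by rewrite -EFinD -EFinM lee_fin mulrAC.
    by rewrite mule0 lee_fin !mulr_ge0// subr_ge0.
  exact: (squeeze_cvge hn (cvg_cst _) lim0).
- have lim0 : (M * (b - a)) * k.+1%:R^-1 @[k --> \oo] --> (0 : R).
    rewrite -[X in _ --> X](mulr0 (M * (b - a))).
    by apply: cvgM; [exact: cvg_cst|exact: cvg_harmonic].
  apply: (squeeze_cvgr _ (cvg_cst 0) lim0); apply: nearW => k.
  by rewrite norm2E nrm_ge0/=; exact: riemann_sum_int.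
Unshelve. all: by end_near. Qed.

Lemma nrm_oneL2 : ip oneL2 oneL2 = 1.
Proof.
by rewrite -[LHS](@inner2_ind_le0 R oneL2 0)// -[LHS]/(inner2 _ _) inner2C ind_one// subr0.
Qed.

(** The primitives on the intervals [[0, T]] agree by uniqueness of the integral. *)
Lemma primitive_global f : loclip ip f -> exists Y,
  [/\ nrm ip (Y 0) = 0, loclip ip Y,
      forall t, 0 < t -> tends ip (0 : R)^' (quot Y t) (f t) &
      forall a b, 0 <= a -> a <= b -> is_bochner f a b (Y b - Y a)].
Proof.
move=> fl.
have /choice[Q QP] : forall t : R, exists Q, 0 <= t -> primitive ip 0 t f Q.
  move=> t; have [t0|tn] := leP 0 t; last by exists (cst 0).
  have [L L0 HL] := fl t t0.
  by have [Q HQ] := primitive_exists t0 L0 HL (@L2_complete R) nrm_oneL2; exists Q.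
pose Y t := Q t t - Q t 0.
have YQ c t : 0 <= c -> c <= t -> nrm ip (Y c - (Q t c - Q t 0)) = 0.
  move=> c0 ct; have t0 := le_trans c0 ct.
  have [L L0 HL] := fl c c0.
  apply: (@bochner_unique f 0 c); apply: (primitive_bochner c0 L0 HL); first exact: QP.
  exact: primitive_sub (QP t t0).
have YD c d t : 0 <= c -> c <= d -> d <= t -> nrm ip ((Y d - Y c) - (Q t d - Q t c)) = 0.
  move=> c0 cd dt; apply: nrm0_le.
  have := nrmB ip (Y c) (Q t c - Q t 0); rewrite YQ ?(le_trans cd dt)// => h.
  have := nrmD ip (Y d - (Q t d - Q t 0)) ((Q t c - Q t 0) - Y c).
  rewrite YQ ?(le_trans c0 cd)// -h addr0; congr (nrm _ _ <= _).
  exact: addrB_regroup.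
have Yprim t : 0 <= t -> primitive ip 0 t f Y.
  move=> t0; have [M M0 H] := QP t t0; exists M; first exact: M0.
  move=> c d c0 cd dt.
  apply: le_trans (nrm_le_dist ip _ (Q t d - Q t c - (d - c) *: f c)) _.
  have -> : Y d - Y c - (d - c) *: f c - (Q t d - Q t c - (d - c) *: f c) = Y d - Y c - (Q t d - Q t c).
    exact: subr_sub2r.
  by rewrite YD// addr0; exact: H.
exists Y; split.
- by rewrite /Y subrr nrm0.
- move=> t t0; have [L L0 HL] := fl t t0.
  by have [M M0 HM] := primitive_lip t0 L0 HL (Yprim t t0); exists M.
- move=> t t0; have t1 : 0 <= t + 1 by rewrite addr_ge0// ltW.
  have [L L0 HL] := fl _ t1.
  by apply: (primitive_derivative HL (Yprim _ t1)); rewrite t0 ltrDl ltr01.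
- move=> a b a0 ab; have b0 := le_trans a0 ab; have [L L0 HL] := fl b b0.
  apply: (@primitive_bochner f Y a b L ab L0); last exact: primitive_sub (Yprim b b0).
  move=> x y /andP[ax xb] /andP[ay yb]; apply: HL; rewrite ?xb ?yb ?andbT.
    exact: le_trans ax.
  exact: le_trans ay.
Qed.

End Bochner.

(** * Lagrangian solutions *)

Section Dynamics.
Context {R : realType}.
Local Notation L2 := (L2 R).
Local Notation mu := (@muOmega R).
Local Notation leb := (@lebesgue_measure R).
Local Notation K := (@Kcone R).
Local Notation ip := (@ipL2 R).
Local Notation ip2 := (ip_prod ip ip).
Local Notation K2 := [set x : L2 * L2 | K x.1 /\ [set: L2] x.2].
Implicit Types (U V W Z J D Xb Vb : L2) (X Y : R -> L2) (s t tau : R).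

Context (F : L2 -> L2) (L : R).
Context (L0 : 0 <= L) (FL : lipschitz_map ip K F L).

(** The second-order inclusion as a first-order system in position and momentum. *)
Definition dyn (x : L2 * L2) : L2 * L2 := (x.2, F x.1).

Lemma dyn_lipschitz :
  lipschitz_map ip2 K2 dyn (1 + L).
Proof.
move=> x y [Kx _] [Ky _]; apply: le_trans (nrm_prod _ _ _) _.
rewrite mulrDl mul1r; apply: lerD; first exact: (nrm_snd ip ip (x - y)).
have h := FL Kx Ky; apply: (le_trans h).
by rewrite ler_wpM2l//; exact: (nrm_fst ip ip (x - y)).
Qed.

Lemma is_derivE X t D : is_deriv X t D <-> tends ip (0 : R)^' (quot X t) D.
Proof. by rewrite /is_deriv /tends; under eq_fun do rewrite norm2E. Qed.

Lemma is_rderivE X t D : is_rderiv X t D <-> tends ip (0 : R)^'+ (quot X t) D.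
Proof. by rewrite /is_rderiv /tends; under eq_fun do rewrite norm2E. Qed.

Lemma lip_locE X : lip_loc X <-> loclip ip X.
Proof.
split=> H T T0; have [M M0 HM] := H T T0; exists M => // s t hs ht.
  by rewrite -norm2E; exact: HM.
by rewrite norm2E; exact: HM.
Qed.

Lemma loclip_comp X :
  (forall t, 0 <= t -> K (X t)) -> loclip ip X -> loclip ip (fun t => F (X t)).
Proof.
move=> KX Xl T T0; have [M M0 HM] := Xl T T0; exists (L * M); first exact: mulr_ge0.
move=> s t hs ht; have Ks : K (X s) by apply: KX; case/andP: hs.
have Kt : K (X t) by apply: KX; case/andP: ht.
have h := FL Ks Kt; apply: (le_trans h).
by rewrite -mulrA ler_wpM2l//; exact: HM.
Qed.

Lemma loclip_fst (u : R -> L2 * L2) : loclip ip2 u -> loclip ip (fun t => (u t).1).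
Proof.
move=> ul T T0; have [M M0 HM] := ul T T0; exists M => // s t hs ht.
by apply: le_trans (HM s t hs ht); exact: (nrm_fst ip ip (u s - u t)).
Qed.
Lemma loclip_snd (u : R -> L2 * L2) : loclip ip2 u -> loclip ip (fun t => (u t).2).
Proof.
move=> ul T T0; have [M M0 HM] := ul T T0; exists M => // s t hs ht.
by apply: le_trans (HM s t hs ht); exact: (nrm_snd ip ip (u s - u t)).
Qed.
Lemma loclip_pair X Y : loclip ip X -> loclip ip Y -> loclip ip2 (fun t => (X t, Y t)).
Proof.
move=> Xl Yl T T0; have [M M0 HM] := Xl T T0; have [N N0 HN] := Yl T T0.
exists (M + N); first exact: addr_ge0.
move=> s t hs ht; apply: le_trans (nrm_prod _ _ _) _; rewrite mulrDl.
by apply: lerD; [exact: HM|exact: HN].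
Qed.

(** The momentum ranges over a full space, so the constraint acts on positions only. *)
Lemma normal_K2 (x n : L2 * L2) : normal ip2 K2 x n -> K x.1 ->
  subdiff x.1 n.1 /\ nrm ip n.2 = 0.
Proof.
move=> H Kx; split.
  move=> Z KZ; have := H (Z, x.2) (conj KZ I); rewrite /= /prod_sip /=.
  by rewrite subrr inner20r addr0.
apply: (@normal_setT _ _ _ x.2) => w; have := H (x.1, w) (conj Kx I).
by rewrite /= /prod_sip /= subrr inner20r add0r.
Qed.

Lemma K2_normal (x n : L2 * L2) : subdiff x.1 n.1 -> nrm ip n.2 = 0 -> normal ip2 K2 x n.
Proof.
move=> H n0 w [Kw _]; rewrite /= /prod_sip.
have e : ip n.2 (w - x).2 = 0.
  by have := @nrm0_sipl _ _ ip n.2 0 (w - x).2; rewrite subr0 sip0l; exact.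
by rewrite e addr0; exact: H.
Qed.

Lemma subdiff_congr U W W' : nrm ip (W - W') = 0 -> subdiff U W -> subdiff U W'.
Proof.
move=> h WU Z KZ; have := WU Z KZ.
by have := nrm0_sipl (Z - U) h => /= ->.
Qed.

Lemma subdiff_congr_point U U' W : nrm ip (U - U') = 0 -> subdiff U W -> subdiff U' W.
Proof.
move=> h WU Z KZ; have := WU Z KZ; rewrite !inner2E.
by have := nrm0_sipr W h => /= ->.
Qed.

Lemma strong_lagrangian Xb Vb X Y :
  strong ip2 K2 dyn (fun t => (X t, Y t)) ->
  nrm ip (X 0 - Xb) = 0 -> nrm ip (Y 0 - Vb) = 0 -> lagrangian_solution F Xb Vb X.
Proof.
move=> [uC ul ua] X0 Y0.
have KX t : 0 <= t -> K (X t) by move=> t0; exact: (uC t t0).1.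
have Xl : loclip ip X := loclip_fst ul; have Yl : loclip ip Y := loclip_snd ul.
have Fl := loclip_comp KX Xl.
have uD : {ae leb, forall t, 0 < t -> exists D, [/\ tends ip (0 : R)^' (quot X t) D,
    tends ip (0 : R)^' (quot Y t) (F (X t)) & subdiff (X t) (Y t - D)]}.
  apply: ae_impl ua => t H t0; have [D D1 D2] := H t0.
  have [n1 n2] := normal_K2 D2 (KX t (ltW t0)); exists D.1; split.
  - exact: (tends_fst D1).
  - have h : tends ip (0 : R)^' (quot Y t) D.2 by exact: (tends_snd D1).
    by apply: tends_congr h => [?|]; [rewrite subrr nrm0|exact: nrm0_sym].
  - exact: n1.
split=> //; [exact/lip_locE|exact/nrm0_ae|].
apply: (ae_impl _ uD) => t H t0; have t0' := ltW t0; have [D [D1 D2 D3]] := H t0.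
exists D, (Y t - Y 0); split; first exact/is_derivE.
  have [M M0 HM] := Fl t t0'; have [N N0 HN] := Yl t t0'.
  apply: (primitive_bochner t0' M0 HM); apply: (primitive_of_ae M0 HM HN).
  by apply: ae_impl uD => s Hs /andP[s0 _]; have [? []] := Hs s0.
by apply: subdiff_congr D3; rewrite subr_sub_shift.
Qed.

Lemma lagrangian_strong Xb Vb X :
  lagrangian_solution F Xb Vb X -> exists Y,
  [/\ strong ip2 K2 dyn (fun t => (X t, Y t)), nrm ip (X 0 - Xb) = 0, nrm ip (Y 0 - Vb) = 0,
    forall t, 0 < t -> tends ip (0 : R)^' (quot Y t) (F (X t)) &
    forall a b, 0 <= a -> a <= b -> is_bochner (fun t => F (X t)) a b (Y b - Y a)].
Proof.
move=> [KX /lip_locE Xl /nrm0_ae X0 ae].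
have Fl := loclip_comp KX Xl.
have [Q [Q0 Ql QD QB]] := primitive_global Fl.
pose Y t := Vb + Q t.
have Yl : loclip ip Y by apply: loclipD => //; exact: loclip_cst.
have YD t : 0 < t -> tends ip (0 : R)^' (quot Y t) (F (X t)).
  move=> t0; have := tends_quotD (tends_quot_cst ip Vb t) (QD t t0).
  by rewrite add0r.
exists Y; split=> //.
- split; [by move=> t t0; split; [exact: KX|]|exact: loclip_pair|].
  apply: ae_impl ae => t H t0; have [D [J [/is_derivE D1 D2 D3]]] := H t0.
  exists (D, F (X t)); first by apply: tends_prod; [exact: D1|exact: YD].
  apply: K2_normal => /=; last by rewrite subrr nrm0.
  apply: subdiff_congr D3.
  have h := bochner_unique D2 (QB 0 t (lexx 0) (ltW t0)).
  rewrite addr_sub2lr; apply: (nrm0_trans h).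
  by rewrite addrAC subrr add0r nrmN.
- by rewrite /Y addrAC subrr add0r.
- move=> a b a0 ab; rewrite (_ : Y b - Y a = Q b - Q a); first exact: QB.
  by rewrite /Y opprD addrACA subrr add0r.
Qed.

End Dynamics.

Section Restart.
Context {R : realType}.
Local Notation L2 := (L2 R).
Local Notation mu := (@muOmega R).
Local Notation leb := (@lebesgue_measure R).
Local Notation K := (@Kcone R).
Local Notation ip := (@ipL2 R).
Local Notation ip2 := (ip_prod ip ip).
Local Notation K2 := [set x : L2 * L2 | K x.1 /\ [set: L2] x.2].
Implicit Types (U V W Z J D Xb Vb : L2) (X Y : R -> L2) (s t tau : R).

Context (F : L2 -> L2) (L : R).
Context (L0 : 0 <= L) (FL : lipschitz_map ip K F L).

Local Notation dyn := (dyn F).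

Lemma pair_nrm0 (x y : L2 * L2) : nrm ip (x.1 - y.1) = 0 -> nrm ip (x.2 - y.2) = 0 ->
  nrm ip2 (x - y) = 0.
Proof.
move=> h1 h2; apply: nrm0_le; apply: le_trans (nrm_prod _ _ _) _.
by rewrite -[(x - y).1]/(x.1 - y.1) h1 -[(x - y).2]/(x.2 - y.2) h2 addr0.
Qed.

Lemma evolution_exists U W : K U -> exists u : R -> L2 * L2,
  [/\ strong ip2 K2 dyn u, nrm ip2 (u 0 - (U, W)) = 0 &
    forall t, 0 <= t -> exists v, [/\ tends ip2 (0 : R)^'+ (quot u t) v,
      normal ip2 K2 (u t) (dyn (u t) - v) & ip2 (dyn (u t) - v) v = 0]].
Proof.
move=> KU; have dL : 0 <= 1 + L by rewrite addr_ge0.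
have K2c : nconvex K2 by apply: prod_convex => //; exact: K_convex.
have K2cpl : ncomplete ip2 K2 by apply: prod_complete; [exact: K_complete|exact: L2_complete].
have Ecpl : ncomplete ip2 [set: L2 * L2].
  have := prod_complete (@L2_complete R) (@L2_complete R); congr (ncomplete _ _).
  by apply/seteqP; split.
exact: (strong_exists (u0 := (U, W)) dL (dyn_lipschitz L0 FL) K2c K2cpl Ecpl (conj KU I)).
Qed.

Lemma right_derivative_polar X t D W : (forall s, 0 <= s -> K (X s)) -> 0 <= t ->
  tends ip (0 : R)^'+ (quot X t) D -> subdiff (X t) W -> inner2 W D <= 0.
Proof.
move=> KX t0 XD WN.
have h : ip W (quot X t h) @[h --> (0 : R)^'+] --> ip W D.
  by apply: tends_sip => //; exact: tends_cst.
apply: (ler_cvg_to h (cvg_cst 0)); near=> r.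
have r0 : 0 < r by near: r; exact: nbhs_right_gt.
rewrite /quot (sipZr ip) pmulr_rle0 ?invr_gt0//.
by apply: WN; apply: KX; rewrite addr_ge0// ltW.
Unshelve. all: by end_near. Qed.

Lemma left_derivative_polar X t D W : (forall s, 0 <= s -> K (X s)) -> 0 < t ->
  tends ip (0 : R)^'- (quot X t) D -> subdiff (X t) W -> 0 <= inner2 W D.
Proof.
move=> KX t0 XD WN.
have h : ip W (quot X t h) @[h --> (0 : R)^'-] --> ip W D.
  by apply: tends_sip => //; exact: tends_cst.
apply: (ler_cvg_to (cvg_cst 0) h); near=> r.
have r0 : r < 0 by near: r; exact: nbhs_left_lt.
have rt : - t < r by near: r; apply: nbhs_left_gt; rewrite oppr_lt0.
rewrite /quot (sipZr ip); apply: mulr_le0; first by rewrite invr_le0 ltW.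
by apply: WN; apply: KX; lra.
Unshelve. all: by end_near. Qed.

(** A two-sided derivative of a curve in [K] annihilates the normal cone, because
    difference quotients of either sign are available. *)
Lemma derivative_Hspace X t D : (forall s, 0 <= s -> K (X s)) -> 0 < t ->
  tends ip (0 : R)^' (quot X t) D -> Hspace (X t) D.
Proof.
move=> KX t0 XD; apply: Hspace_orth => W WN; apply/eqP; rewrite inner2C eq_le.
rewrite (right_derivative_polar KX (ltW t0) (cvg_dnbhs_at_right XD) WN).
by rewrite (left_derivative_polar KX t0 (cvg_dnbhs_at_left XD) WN).
Qed.

(** Restarting with the projected momentum: as long as the projection removes a normal
    vector, that vector stays normal along the restarted solution, so adding it back
    gives the original solution. *)
Lemma restart X Y tau W :
  (forall (Xb Vb : L2) (X : R -> L2), K Xb -> Hspace Xb Vb -> lagrangian_solution F Xb Vb X ->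
     forall t : R, 0 <= t -> Omega_of Xb `<=` Omega_of (X t)) ->
  strong ip2 K2 dyn (fun t => (X t, Y t)) -> 0 <= tau ->
  Hspace (X tau) W -> subdiff (X tau) (Y tau - W) ->
  (forall t, tau <= t -> Omega_of (X tau) `<=` Omega_of (X t)) /\
  strong ip2 K2 dyn (fun t => (X (t + tau), Y (t + tau) - (Y tau - W))).
Proof.
move=> hyp uS tau0 HW NW; have [uC _ _] := uS.
have KX t : 0 <= t -> K (X t) by move=> t0; exact: (uC t t0).1.
have dL : 0 <= 1 + L by rewrite addr_ge0.
have dynL := dyn_lipschitz L0 FL.
have [u [wS w0 _]] := evolution_exists W (KX tau tau0).
pose X' t := (u t).1; pose Y' t := (u t).2.
have wS' : strong ip2 K2 dyn (fun t => (X' t, Y' t)).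
  by move: wS; rewrite (_ : (fun t => (X' t, Y' t)) = u)//; apply/funext => t; rewrite -surjective_pairing.
have X'0 : nrm ip (X' 0 - X tau) = 0.
  by apply: nrm0_le; rewrite -[leRHS]w0; exact: (nrm_fst ip ip (u 0 - (X tau, W))).
have Y'0 : nrm ip (Y' 0 - W) = 0.
  by apply: nrm0_le; rewrite -[leRHS]w0; exact: (nrm_snd ip ip (u 0 - (X tau, W))).
have lag := strong_lagrangian L0 FL wS' X'0 Y'0.
have Om t : 0 <= t -> Omega_of (X tau) `<=` Omega_of (X' t).
  exact: (hyp _ _ _ (KX tau tau0) HW lag).
have KX' t : 0 <= t -> K (X' t) by move=> t0; have [wC _ _] := wS'; exact: (wC t t0).1.
have NX' t : 0 <= t -> subdiff (X' t) (Y tau - W).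
  by move=> t0; exact: (subdiff_monotone (KX tau tau0) (KX' t t0) (Om t t0)).
pose N := Y tau - W.
have sS : strong ip2 K2 dyn (fun t => (X' t, Y' t + N)).
  have [wC wl wae] := wS'; split; first by move=> t t0; split => //; exact: KX'.
    apply: loclip_pair; first exact: (loclip_fst wl).
    by apply: loclipD; [exact: (loclip_snd wl)|exact: loclip_cst].
  apply: ae_impl wae => t H t0; have [D D1 D2] := H t0; have t0' := ltW t0.
  exists D.
    apply: tends_prod; first exact: (tends_fst D1).
    have h := tends_quotD (tends_snd D1 : tends ip _ (quot Y' t) D.2) (tends_quot_cst ip N t).
    by rewrite addr0 in h; exact: h.
  have [n1 n2] := normal_K2 D2 (KX' t t0'); apply: K2_normal; last exact: n2.
  move=> Z KZ; have h1 := n1 Z KZ; have h2 := NX' t t0' Z KZ.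
  have -> : (dyn (X' t, Y' t + N) - D).1 = (dyn (X' t, Y' t) - D).1 + N.
    by rewrite /= addrAC.
  by rewrite inner2Dl -(addr0 0) lerD.
have shS := strong_shift tau0 uS.
have eq0 : nrm ip2 ((X' 0, Y' 0 + N) - (X (0 + tau), Y (0 + tau))) = 0.
  apply: pair_nrm0; rewrite add0r; first exact: X'0.
  by have := addr_subAK (Y' 0) (Y tau) W => /= ->; exact: Y'0.
have same := strong_unique dL dynL sS shS eq0.
have sX t : 0 <= t -> nrm ip (X' t - X (t + tau)) = 0.
  move=> t0; apply: nrm0_le; apply: le_trans (nrm_fst ip ip ((X' t, Y' t + N) - (X (t + tau), Y (t + tau)))) _.
  by rewrite (same t t0).
have sY t : 0 <= t -> nrm ip (Y' t + N - Y (t + tau)) = 0.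
  move=> t0; apply: nrm0_le; apply: le_trans (nrm_snd ip ip ((X' t, Y' t + N) - (X (t + tau), Y (t + tau)))) _.
  by rewrite (same t t0).
split.
  move=> t taut; have t0 : 0 <= t - tau by rewrite subr_ge0.
  apply: subset_trans (Om _ t0) _; apply: Omega_of_eq; apply: K_ae_eq.
  - exact: KX'.
  - by apply: KX; exact: le_trans taut.
  - by apply/nrm0_ae; have := sX _ t0; rewrite subrK.
apply: (strong_congr dL dynL wS').
  by move=> t t0; split => //; apply: KX; exact: addr_ge0.
move=> t t0; apply: pair_nrm0; first exact: sX.
by have := subr_subr (Y' t) (Y (t + tau)) N => /= ->; exact: sY.
Qed.

End Restart.

Section SolutionProperties.
Context {R : realType}.
Local Notation L2 := (L2 R).
Local Notation mu := (@muOmega R).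
Local Notation leb := (@lebesgue_measure R).
Local Notation K := (@Kcone R).
Local Notation ip := (@ipL2 R).
Local Notation ip2 := (ip_prod ip ip).
Local Notation K2 := [set x : L2 * L2 | K x.1 /\ [set: L2] x.2].
Implicit Types (U V W Z J D Xb Vb : L2) (X Y : R -> L2) (s t tau : R).

Context (F : L2 -> L2) (L : R).
Context (L0 : 0 <= L) (FL : lipschitz_map ip K F L).

Local Notation dyn := (dyn F).

Lemma normal_is_proj (C : set L2) U P : C P -> (forall Q, C Q -> inner2 (U - P) (Q - P) <= 0) ->
  is_proj C U P.
Proof.
move=> CP H; split=> // Q CQ; rewrite !norm2E.
rewrite -(@ler_pXn2r _ 2) ?nnegrE ?nrm_ge0// !nrm_sq.
have e : U - Q = (U - P) - (Q - P) by rewrite opprB subrKA.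
rewrite e; have := H Q CQ; have := sip_ge0 ip (Q - P); rewrite -[inner2 _ _]/(ip (U - P) (Q - P)).
move: (U - P) (Q - P) => a b; rewrite !sipE (sipC ip b a).
by move: (ip a a) (ip a b) (ip b b) => x y z; lra.
Qed.

Lemma loclip_clock c X : loclip ip X -> loclip ip (fun s => (c - s) *: X s).
Proof.
move=> Xl T T0; have [M M0 HM] := Xl T T0.
exists ((`|c| + T) * M + (nrm ip (X 0) + M * T)).
  by rewrite addr_ge0 ?mulr_ge0 ?addr_ge0 ?nrm_ge0 ?mulr_ge0.
move=> s t hs ht; have [s0 sT] := andP hs; have [t0 tT] := andP ht.
have -> : (c - s) *: X s - (c - t) *: X t = (c - s) *: (X s - X t) + (t - s) *: X t.
  have <- : (c - s) - (c - t) = t - s by ring.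
  exact: scale_diff.
apply: le_trans (nrmD _ _ _) _; rewrite !nrmZ mulrDl; apply: lerD.
  rewrite -mulrA; apply: ler_pM; rewrite ?nrm_ge0//; last exact: HM.
  by apply: le_trans (ler_normB _ _) _; rewrite lerD2l ger0_norm.
rewrite mulrC distrC ler_wpM2r//.
apply: le_trans (nrm_le_dist ip _ (X 0)) _; rewrite lerD2l.
apply: le_trans (HM _ _ ht _) _; first by rewrite lexx.
by rewrite subr0 ler_wpM2l// ger0_norm.
Qed.

Section Solution.
Context (Xb Vb : L2) (X Y : R -> L2).
Context (hyp : forall (Xb Vb : L2) (X : R -> L2), K Xb -> Hspace Xb Vb ->
  lagrangian_solution F Xb Vb X -> forall t : R, 0 <= t -> Omega_of Xb `<=` Omega_of (X t)).
Context (KXb : K Xb) (HVb : Hspace Xb Vb).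
Context (uS : strong ip2 K2 dyn (fun t => (X t, Y t))).
Context (X0 : nrm ip (X 0 - Xb) = 0) (Y0 : nrm ip (Y 0 - Vb) = 0).
Context (YD : forall t, 0 < t -> tends ip (0 : R)^' (quot Y t) (F (X t))).

Let KX t : 0 <= t -> K (X t).
Proof. by move=> t0; have [uC _ _] := uS; exact: (uC t t0).1. Qed.

Let Xl : loclip ip X. Proof. by have [_ ul _] := uS; exact: (loclip_fst ul). Qed.
Let Yl : loclip ip Y. Proof. by have [_ ul _] := uS; exact: (loclip_snd ul). Qed.

Definition restartable tau W := Hspace (X tau) W /\ subdiff (X tau) (Y tau - W).

Lemma restartable_Omega_of tau W t : restartable tau W -> 0 <= tau -> tau <= t ->
  Omega_of (X tau) `<=` Omega_of (X t).
Proof.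
move=> [HW NW] tau0; have [H _] := restart L0 FL hyp uS tau0 HW NW; exact: H.
Qed.

Lemma restartable_subdiff tau W t : restartable tau W -> 0 <= tau -> tau <= t ->
  subdiff (X tau) `<=` subdiff (X t).
Proof.
move=> r tau0 taut; apply: subdiff_monotone; [exact: KX|apply: KX; exact: le_trans taut|].
exact: restartable_Omega_of r tau0 taut.
Qed.

Lemma ae_restartable : {ae leb, forall t, 0 < t ->
  exists2 D, tends ip (0 : R)^' (quot X t) D & restartable t D}.
Proof.
have [uC _ ae] := uS; apply: ae_impl ae => t H t0; have [D D1 D2] := H t0.
have XD : tends ip (0 : R)^' (quot X t) D.1 by exact: (tends_fst D1).
exists D.1 => //; split; first exact: derivative_Hspace KX t0 XD.
by have [] := normal_K2 D2 (KX (ltW t0)).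
Qed.

Lemma restartable0 : restartable 0 Vb.
Proof.
have XX m : Omega m -> X 0 m = Xb m :> R.
  by apply: K_ae_eq => //; [exact: KX|exact/nrm0_ae].
split; first exact: (Hspace_sub (Omega_of_eq XX)).
move=> Z _; have h : nrm ip (Y 0 - Vb - 0) = 0 by rewrite subr0.
have := nrm0_sipl (Z - X 0) h; rewrite sip0l => e.
by rewrite -[inner2 _ _]/(ip (Y 0 - Vb) (Z - X 0)) e.
Qed.

(** Suppose the projection of [Y tau] removed a non-normal vector.  At almost every
    earlier time [r] the removed vector [Y r - X' r] is normal, hence normal at [tau]
    because the normal cones grow up to [tau].  So, against [Z' = Z - P Z], the curve [X]
    would move at a rate bounded below by a positive constant just before [tau] and reach
    zero at [tau], although it stays nonnegative. *)
Lemma restartable_all tau : 0 < tau -> exists W, restartable tau W.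
Proof.
move=> tau0; have tau0' := ltW tau0; have Kt := KX tau0'.
have [p Hp Yp] := Hspace_projection (X tau) (Y tau); exists p; split => //.
apply: subdiffI; first by apply: Yp; exact: Hspace_self.
move=> Z KZ; have [q Hq Zq] := Hspace_projection (X tau) Z.
pose Z' := Z - q.
have -> : inner2 (Y tau - p) Z = inner2 (Y tau) Z'.
  have e1 := Yp _ Hq; have e2 : inner2 p Z' = 0 by rewrite inner2C; exact: Zq.
  have : inner2 (Y tau - p) Z' = inner2 (Y tau - p) Z - inner2 (Y tau - p) q.
    by rewrite inner2Dr inner2Nr.
  by rewrite e1 subr0 => <-; rewrite inner2Dl inner2Nl e2 subr0.
rewrite leNgt; apply/negP => c0; pose c := inner2 (Y tau) Z'.
have [M M0 HM] := Yl tau0'.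
pose d := Num.min tau (c / (2 * (M * nrm ip Z' + 1))).
have den0 : 0 < M * nrm ip Z' + 1 by rewrite ltr_wpDl ?mulr_ge0 ?nrm_ge0.
have d0 : 0 < d by rewrite lt_min tau0 divr_gt0// mulr_gt0.
have dtau : d <= tau by rewrite ge_min lexx.
have dc : d * (M * nrm ip Z' + 1) <= c / 2.
  have : d <= c / (2 * (M * nrm ip Z' + 1)) by rewrite ge_min lexx orbT.
  by rewrite invfM mulrA ler_pdivlMr.
pose s := tau - d.
have s0 : 0 <= s by rewrite subr_ge0.
have Yc r : s <= r -> r <= tau -> c / 2 <= inner2 (Y r) Z'.
  move=> sr rtau; have h : inner2 (Y tau - Y r) Z' <= d * (M * nrm ip Z').
    apply: le_trans (sip_le ip _ _) _; rewrite mulrA ler_wpM2r ?nrm_ge0//.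
    apply: le_trans (HM _ _ _ _) _; [by rewrite tau0' lexx|by rewrite (le_trans s0 sr)|].
    rewrite mulrC ler_wpM2r// ger0_norm ?subr_ge0//.
    by rewrite lerBlDl -lerBlDr.
  move: h; rewrite inner2Dl inner2Nl -/c => h.
  by move: dc h d0; rewrite mulrDr mulr1; move: (inner2 _ _) (d * (M * _)) => u v; lra.
pose g r := (c / 2) * r - inner2 (X r) Z'.
have stau : s <= tau by rewrite gerBl ltW.
have : g tau <= g s.
  apply: ae_nonincreasing => //.
    apply: lip_onB; first by apply: lip_onM => //; [exact: lip_on_cst|exact: lip_on_id].
    exact: (@lip_on_sip _ _ ip X (cst Z') s tau s0 stau Xl (loclip_cst ip Z')).
  apply: ae_impl ae_restartable => r H /andP[sr rtau].
  have r0 : 0 < r := le_lt_trans s0 sr; have [D XD rD] := H r0.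
  have h1 := is_derive_sip XD (tends_quot_cst ip Z' r).
  have h2 : is_derive r (1 : R) (fun x : R => (c / 2) * x) (c / 2).
    by apply: is_derive_eq; rewrite /GRing.scale/= mulr1.
  eexists; split; first exact: (is_deriveB h2 h1).
  have N := restartable_subdiff rD (ltW r0) (ltW rtau) rD.2.
  have n1 : inner2 (Y r - D) Z <= 0 by exact: subdiff_polar Kt N KZ.
  have n2 : inner2 (Y r - D) q = 0 by exact: subdiff_Hspace Kt N Hq.
  have : inner2 (Y r - D) Z' <= 0 by rewrite /Z' inner2Dr inner2Nr n2 subr0.
  rewrite inner2Dl inner2Nl; have := Yc r (ltW sr) (ltW rtau).
  rewrite -[ip D _]/(inner2 D Z') -[ip (X r) 0]/(inner2 (X r) 0) inner20r addr0.
  by move: (inner2 D Z') (inner2 (Y r) Z') => u v; lra.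
have e1 : inner2 (X tau) Z' = 0 by rewrite inner2C; apply: Zq; exact: Hspace_self.
have e2 : 0 <= inner2 (X s) Z'.
  have := projection_polar Kt KZ Hq Zq (KX s0); rewrite inner2C.
  by rewrite -(opprB Z) inner2Nr oppr_le0.
rewrite /g e1 /s subr0 mulrBr; have : 0 < c / 2 * d by rewrite mulr_gt0// divr_gt0.
by move: e2; move: (inner2 (X _) Z') (_ * tau) (_ * d) => u v w; lra.
Qed.

(** Both candidates for the right velocity remove a normal vector from [Y tau]: the one
    produced by the evolution is tangent, the projection lies in the space orthogonal
    to the normal vectors; this forces them to coincide. *)
Lemma restartable_velocity tau W v : 0 <= tau -> restartable tau W ->
  tends ip (0 : R)^'+ (quot X tau) v -> subdiff (X tau) (Y tau - v) ->
  inner2 (Y tau - v) v = 0 -> tends ip (0 : R)^'+ (quot X tau) W.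
Proof.
move=> tau0 [HW NW] Xv Nv v0; have Kt := KX tau0.
apply: (tends_congr _ _ Xv) => [h|]; first by rewrite subrr nrm0.
apply: sip_eq0_nrm; apply/eqP; rewrite eq_le sip_ge0 andbT.
have h1 : inner2 (Y tau - W) v <= 0 := right_derivative_polar KX tau0 Xv NW.
have h2 := subdiff_Hspace Kt NW HW; have h3 := subdiff_Hspace Kt Nv HW.
move: h1 h2 h3 v0; rewrite -[ip _ _]/(inner2 (v - W) (v - W)) !inner2E (inner2C W v).
move: (inner2 (Y tau) v) (inner2 W W) (inner2 v v) (inner2 v W) (inner2 (Y tau) W) => a b c d e.
by lra.
Qed.

Lemma velocity_exists t : 0 <= t -> exists v, [/\ tends ip (0 : R)^'+ (quot X t) v,
  subdiff (X t) (Y t - v) & inner2 (Y t - v) v = 0].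
Proof.
move=> t0; have dL : 0 <= 1 + L by rewrite addr_ge0.
have dynL := dyn_lipschitz L0 FL.
have [u [wS w0 wv]] := evolution_exists L0 FL Vb KXb.
have eq0 : nrm ip2 (u 0 - (X 0, Y 0)) = 0.
  apply: nrm0_trans w0 _; apply: nrm0_sym; exact: pair_nrm0.
have same := strong_unique dL dynL wS uS eq0.
have sX r : 0 <= r -> nrm ip ((u r).1 - X r) = 0.
  by move=> r0; apply: nrm0_le; apply: le_trans (nrm_fst ip ip (u r - (X r, Y r))) _; rewrite same.
have sY r : 0 <= r -> nrm ip ((u r).2 - Y r) = 0.
  by move=> r0; apply: nrm0_le; apply: le_trans (nrm_snd ip ip (u r - (X r, Y r))) _; rewrite same.
have Ku : K (u t).1 by have [wC _ _] := wS; exact: (wC t t0).1.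
have [v [v1 v2 v3]] := wv t t0; have [n1 n2] := normal_K2 v2 Ku.
have hv : nrm ip ((u t).2 - v.1 - (Y t - v.1)) = 0 by rewrite subr_sub2r; exact: sY.
exists v.1; split.
- have h : tends ip (0 : R)^'+ (quot (fun r => (u r).1) t) v.1 by exact: (tends_fst v1).
  apply: (tends_le _ h); near=> r.
  apply: le_trans (nrm_tri _ _ (quot (fun r => (u r).1) t r) _) _.
  rewrite gerDr /quot -scalerBr nrmZ.
  have r0 : 0 <= t + r by rewrite addr_ge0//; near: r; exact: nbhs_right_ge.
  rewrite (_ : nrm _ _ = 0) ?mulr0//; apply: nrm0_le.
  rewrite subrB_exchange; apply: le_trans (nrmD _ _ _) _.
  by rewrite nrmB sX// sX// addr0.
- apply: subdiff_congr hv _; apply: (subdiff_congr_point (sX t t0)); exact: n1.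
- move: v3; rewrite /= /prod_sip.
  have h2 : nrm ip ((dyn (u t) - v).2 - 0) = 0 by rewrite subr0.
  rewrite (nrm0_sipl v.2 h2) sip0l addr0 => h.
  by rewrite -[LHS](nrm0_sipl v.1 hv).
Unshelve. all: by end_near. Qed.

Lemma velocity_projection t1 t W1 W : 0 <= t1 -> t1 <= t ->
  restartable t1 W1 -> restartable t W -> is_proj (Hspace (X t)) (W1 + (Y t - Y t1)) W.
Proof.
move=> t10 t1t r1 [HW NW]; have Kt := KX (le_trans t10 t1t).
apply: normal_is_proj => // Q HQ.
have N1 : subdiff (X t) (Y t1 - W1) := restartable_subdiff r1 t10 t1t r1.2.
have HQW : Hspace (X t) (Q - W) by apply: Hspace_D => //; exact: Hspace_N.
have -> : W1 + (Y t - Y t1) - W = (Y t - W) - (Y t1 - W1) by exact: addrB_exchange.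
by rewrite inner2Dl inner2Nl (subdiff_Hspace Kt NW HQW) (subdiff_Hspace Kt N1 HQW) subr0.
Qed.

(** Between [t1] and [t] the removed vectors [V t1 + (Y r - Y t1) - X' r] are normal at
    [X r], hence at [X t]; the quantity to be shown normal at [X t] is their integral. *)
Lemma position_projection t1 t W Q : 0 <= t1 -> t1 <= t -> restartable t1 W ->
  loclip ip Q -> (forall s, 0 < s -> tends ip (0 : R)^' (quot Q s) ((t - s) *: F (X s))) ->
  is_proj K (X t1 + (t - t1) *: W + (Q t - Q t1)) (X t).
Proof.
move=> t10 t1t r1 Ql QD; have t0 := le_trans t10 t1t; have Kt := KX t0.
apply: normal_is_proj => // Z KZ; pose z := Z - X t.
have [_ [_ _ ae]] := restart L0 FL hyp uS t10 r1.1 r1.2.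
have aeN : {ae leb, forall r, t1 < r < t -> exists2 D,
    tends ip (0 : R)^' (quot X r) D & inner2 (Y r - (Y t1 - W) - D) z <= 0}.
  apply: ae_impl2 (ae_shift (- t1) ae) ae_restartable => r H G /andP[t1r rt].
  have r0 : 0 < r := le_lt_trans t10 t1r.
  have h : 0 < r - t1 by rewrite subr_gt0.
  have [D D1 D2] := H h; have [D' XD' rD'] := G r0.
  have [n1 _] := normal_K2 D2 (KX (addr_ge0 (ltW h) t10)).
  have XD : tends ip (0 : R)^' (quot X r) D.1.
    have : tends ip (0 : R)^' (quot (fun t => X (t + t1)) (r - t1)) D.1.
      exact: (tends_fst D1).
    by rewrite quot_shift subrK.
  exists D.1 => //; rewrite /= subrK in n1.
  have := subdiff_monotone (KX (ltW r0)) Kt (restartable_Omega_of rD' (ltW r0) (ltW rt)) n1.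
  exact.
pose B r := (r - t1) * inner2 W z - inner2 (X r) z.
pose A r := (r - t) * inner2 (Y r - Y t1) z.
pose g r := (inner2 (Q r) z + A r) + B r.
have : g t <= g t1.
  have lz := loclip_cst ip z.
  have lY : loclip ip (fun r => Y r - Y t1) by apply: loclipB => //; exact: loclip_cst.
  have la (c : R) : lip_on t1 t (fun r : R => r - c).
    by apply: lip_onB; [exact: lip_on_id|exact: lip_on_cst].
  apply: ae_nonincreasing => //.
    apply: lip_onD; first apply: lip_onD.
    - exact: (@lip_on_sip _ _ ip Q (cst z) t1 t t10 t1t Ql lz).
    - apply: lip_onM => //.
      exact: (@lip_on_sip _ _ ip (fun r => Y r - Y t1) (cst z) t1 t t10 t1t lY lz).
    - apply: lip_onB; first by apply: lip_onM => //; exact: lip_on_cst.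
      exact: (@lip_on_sip _ _ ip X (cst z) t1 t t10 t1t Xl lz).
  apply: (ae_impl _ aeN) => r H /andP[t1r rt]; have r0 : 0 < r := le_lt_trans t10 t1r.
  have [|D XD n] := H; first by rewrite t1r rt.
  have zD := tends_quot_cst ip z r.
  have dQ : is_derive r (1 : R) (fun x => inner2 (Q x) z) ((t - r) * inner2 (F (X r)) z).
    have := is_derive_sip (QD r r0) zD.
    by rewrite -[ip (Q r) 0]/(inner2 (Q r) 0) inner20r addr0 -[ip _ _]/(inner2 _ _) inner2Zl.
  have dX : is_derive r (1 : R) (fun x => inner2 (X x) z) (inner2 D z).
    have := is_derive_sip XD zD.
    by rewrite -[ip (X r) 0]/(inner2 (X r) 0) inner20r addr0.
  have dY : is_derive r (1 : R) (fun x => inner2 (Y x - Y t1) z) (inner2 (F (X r)) z).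
    have YD' := tends_quotD (YD r0) (tends_quotN (tends_quot_cst ip (Y t1) r)).
    have := is_derive_sip YD' zD.
    rewrite -[ip (_ + _) 0]/(inner2 _ 0) inner20r addr0 -[ip _ _]/(inner2 _ _).
    by rewrite inner2Dl inner2Nl inner20l subr0.
  have dA : is_derive r (1 : R) A ((r - t) * inner2 (F (X r)) z + inner2 (Y r - Y t1) z).
    have d1 : is_derive r (1 : R) (fun x : R => x - t) 1.
      by apply: is_derive_eq; rewrite subr0.
    by have := is_deriveM d1 dY; rewrite /GRing.scale/= mulr1.
  have dB : is_derive r (1 : R) B (inner2 W z - inner2 D z).
    have d1 : is_derive r (1 : R) (fun x : R => (x - t1) * inner2 W z) (inner2 W z).
      by apply: is_derive_eq; rewrite /GRing.scale/=; ring.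
    exact: is_deriveB d1 dX.
  eexists; split; first exact: (is_deriveD (is_deriveD dQ dA) dB).
  move: n; rewrite !(inner2Dl, inner2Nl).
  move: (inner2 (F _) z) (inner2 D z) (inner2 W z) (inner2 (Y r) z) (inner2 (Y t1) z) => a b c d e.
  by move=> n; apply: le_trans n; rewrite le_eqVlt; apply/orP; left; apply/eqP; ring.
rewrite /g /A /B -/z !subrr !mul0r !inner2E.
move: (inner2 (Q t) z) (inner2 (Q t1) z) (inner2 (X t) z) (inner2 (X t1) z) (inner2 W z) => a b c d e.
by lra.
Qed.

End Solution.

End SolutionProperties.

Theorem theorem3p10 (R : realType) (F : L2 R -> L2 R) :
  lipschitzK F ->
  sticking F ->
  (forall (Xb Vb : L2 R) (X : R -> L2 R),
     Kcone Xb -> Hspace Xb Vb -> lagrangian_solution F Xb Vb X ->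
     forall t : R, 0 <= t -> Omega_of Xb `<=` Omega_of (X t)) ->
  forall (Xb Vb : L2 R) (X : R -> L2 R),
    Kcone Xb -> Hspace Xb Vb -> lagrangian_solution F Xb Vb X ->
    sticky X /\
    exists V : R -> L2 R,
    [/\ forall t : R, 0 <= t -> is_rderiv X t (V t),
        forall tau : R, 0 < tau ->
          lagrangian_solution F (X tau) (V tau) (fun t => X (t + tau)) /\
          (forall Y : R -> L2 R, lagrangian_solution F (X tau) (V tau) Y ->
             forall t : R, 0 <= t -> Y t = X (t + tau) %[ae muOmega]),
        forall t1 t : R, 0 <= t1 -> t1 <= t ->
          exists J : L2 R,
            is_bochner (fun s => (t - s) *: F (X s)) t1 t J /\
            is_proj Kcone (X t1 + (t - t1) *: V t1 + J) (X t)
      & forall t1 t : R, 0 <= t1 -> t1 <= t ->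
          exists J : L2 R,
            is_bochner (fun s => F (X s)) t1 t J /\
            is_proj (Hspace (X t)) (V t1 + J) (V t)].
Proof.
move=> [L L0 FL'] _ hyp Xb Vb X KXb HVb lag.
have FL : lipschitz_map (@ipL2 R) (@Kcone R) F L.
  by move=> x y Kx Ky; rewrite -!norm2E; exact: FL'.
have [Y [uS X0 Y0 YD YB]] := lagrangian_strong L0 FL lag.
have KX t : 0 <= t -> Kcone (X t) by move=> t0; have [uC _ _] := uS; exact: (uC t t0).1.
have /choice[V VP] : forall tau, exists W, 0 <= tau -> restartable X Y tau W.
  move=> tau; have [t0|t0|t0] := ltgtP 0 tau.
  - by have [W HW] := restartable_all L0 FL hyp uS t0; exists W.
  - by exists 0.
  - by exists Vb => _; rewrite -t0; exact: (restartable0 KXb HVb uS X0 Y0).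
split.
  by move=> t1 t2 t10 t12; exact: (restartable_Omega_of L0 FL hyp uS (VP t1 t10) t10 t12).
exists V; split.
- move=> t t0; have [v [v1 v2 v3]] := velocity_exists L0 FL KXb uS X0 Y0 t0.
  by apply/is_rderivE; exact: (restartable_velocity uS t0 (VP t t0) v1 v2 v3).
- move=> tau /ltW tau0; have [HV NV] := VP tau tau0.
  have [_ shS] := restart L0 FL hyp uS tau0 HV NV.
  have Xs0 : nrm (@ipL2 R) (X (0 + tau) - X tau) = 0 by rewrite add0r subrr nrm0.
  have Ys0 : nrm (@ipL2 R) (Y (0 + tau) - (Y tau - V tau) - V tau) = 0.
    by rewrite add0r opprB addrCA subrr addr0 subrr nrm0.
  split; first exact: (strong_lagrangian L0 FL shS Xs0 Ys0).
  move=> X' lag' t t0; have [Y' [uS' X'0 Y'0 _ _]] := lagrangian_strong L0 FL lag'.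
  have dL : 0 <= 1 + L by rewrite addr_ge0.
  have eq0 : nrm (ip_prod (@ipL2 R) (@ipL2 R))
      ((X' 0, Y' 0) - (X (0 + tau), Y (0 + tau) - (Y tau - V tau))) = 0.
    by apply: pair_nrm0; [exact: nrm0_trans X'0 (nrm0_sym Xs0)|exact: nrm0_trans Y'0 (nrm0_sym Ys0)].
  have same := strong_unique dL (dyn_lipschitz L0 FL) uS' shS eq0 t0.
  apply/nrm0_ae; apply: nrm0_le; rewrite -same.
  exact: (nrm_fst _ _ ((X' t, Y' t) - (X (t + tau), Y (t + tau) - (Y tau - V tau)))).
- move=> t1 t t10 t1t.
  have Xl : loclip (@ipL2 R) X by have [_ ul _] := uS; exact: (loclip_fst ul).
  have fl : loclip (@ipL2 R) (fun s => (t - s) *: F (X s)).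
    by apply: loclip_clock; exact: (loclip_comp L0 FL).
  have [Q [_ Ql QD QB]] := primitive_global fl.
  exists (Q t - Q t1); split; first exact: QB.
  exact: (position_projection L0 FL hyp uS YD t10 t1t (VP t1 t10) Ql QD).
- move=> t1 t t10 t1t; exists (Y t - Y t1); split; first exact: YB.
  exact: (velocity_projection L0 FL hyp uS t10 t1t (VP t1 t10) (VP t (le_trans t10 t1t))).
Qed.
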